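(* Let $0<s<1$, $N>2s$, and let $\Omega\subset\mathbb{R}^N$ be a bounded smooth domain. Let $f\colon\mathbb{R}\to[0,\infty)$ be a continuous function such that: (F1) $\displaystyle\lim_{t\to0^+}\frac{f(t)}{|t|^{p-1}t}=1$ for some $1<p<\frac{N+2s}{N-2s}$; (F2) $f(1)=0$ and $f(t)>0$ for $t\in(0,1)\cup(1,2)$; (F3) there exists $M_0>0$ such that the map $t\mapsto f(t)+M_0t$ is increasing for $t\in\mathbb{R}$. Then there exists $\bar\lambda>0$ such that for every $\lambda>\bar\lambda$ the problem $$(-\Delta)^su=\lambda f(u)\ \text{ in }\Omega,\qquad u=0\ \text{ on }\mathbb{R}^N\setminus\Omega$$ admits two nontrivial nonnegative weak solutions $u_\lambda,v_\lambda\in X_0^s(\Omega)$. Moreover, $0\le u_\lambda<v_\lambda\le1$ in $\Omega$.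
   Context: Write $K(x)=|x|^{-(N+2s)}$, $\Omega^c=\mathbb{R}^N\setminus\Omega$, $Q=(\mathbb{R}^N\times\mathbb{R}^N)\setminus(\Omega^c\times\Omega^c)$. $X^s(\Omega)$ is the space of Lebesgue measurable functions $u:\mathbb{R}^N\to\mathbb{R}$ with $u|_\Omega\in L^2(\Omega)$ and $(x,y)\mapsto(u(x)-u(y))\sqrt{K(x-y)}\in L^2(Q)$; $X_0^s(\Omega)=\{u\in X^s(\Omega):u=0\text{ a.e. in }\Omega^c\}$. A function $u\in X_0^s(\Omega)$ is a weak solution of the problem if $$\frac12\int_{\mathbb{R}^N\times\mathbb{R}^N}(u(x)-u(y))(v(x)-v(y))K(x-y)\,dx\,dy=\lambda\int_\Omega f(u)v\,dx\quad\text{for every }v\in X_0^s(\Omega).$$ Solutions are understood in this sense. Inequalities between elements of $X_0^s(\Omega)$ are understood a.e. in $\Omega$. *)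

(* Defs.v *)
From HB Require Import structures.
From mathcomp Require Import all_boot all_order all_algebra.
From mathcomp Require Import all_classical all_reals all_analysis.
Import Order.TTheory GRing.Theory Num.Theory.
Import numFieldNormedType.Exports.
Set Implicit Arguments.
Unset Strict Implicit.
Unset Printing Implicit Defensive.
Local Open Scope classical_set_scope.
Local Open Scope ring_scope.

Section lebesgue_outer_measure.
Context (R : realType) (N : nat).
Implicit Types (a b x : 'rV[R]_N) (o : option ('rV[R]_N * 'rV[R]_N)).

(* [None] is the empty box: for N = 0 there is no empty pair of endpoints. *)
Definition box o : set 'rV[R]_N :=
  if o is Some (a, b) then [set x | forall i, a 0 i <= x 0 i <= b 0 i]
  else set0.

Definition box_vol o : \bar R :=
  if o is Some (a, b) then (\prod_i Num.max 0 (b 0 i - a 0 i))%:E else 0%E.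

Definition box_cover (X : set 'rV[R]_N) :=
  [set c : nat -> option ('rV[R]_N * 'rV[R]_N) | X `<=` \bigcup_k box (c k)].

Definition lebesgue_outer (X : set 'rV[R]_N) : \bar R :=
  ereal_inf [set (\sum_(0 <= k <oo) box_vol (c k))%E | c in box_cover X].

Local Open Scope ereal_scope.

Lemma box_vol_ge0 o : 0 <= box_vol o.
Proof.
case: o => [[a b]|//]; rewrite /box_vol lee_fin; apply: prodr_ge0 => i _.
by rewrite le_max lexx.
Qed.

Lemma lebesgue_outer_ge0 X : 0 <= lebesgue_outer X.
Proof.
apply: le_ereal_inf_tmp => _ [c _ <-].
by apply: nneseries_ge0 => *; exact: box_vol_ge0.
Qed.

Lemma lebesgue_outer0 : lebesgue_outer set0 = 0.
Proof.
apply/eqP; rewrite eq_le lebesgue_outer_ge0 andbT.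
apply: ereal_inf_lbound; exists (fun=> None); first by move=> ? [].
by rewrite eseries0.
Qed.

Lemma le_lebesgue_outer :
  {homo lebesgue_outer : X Y / X `<=` Y >-> X <= Y}.
Proof.
move=> X Y XY; apply: ereal_inf_le_tmp => _ [c Yc <-].
by exists c => //; exact: subset_trans Yc.
Qed.

Lemma lebesgue_outer_sigma_subadditive : sigma_subadditive lebesgue_outer.
Proof.
move=> A; have [[i ioo]|] := pselect (exists i, lebesgue_outer (A i) = +oo).
  rewrite (eseries_pinfty _ _ ioo) ?leey// => n _.
  by rewrite -ltNye (lt_le_trans _ (lebesgue_outer_ge0 _)).
rewrite -forallNE => Aoo.
suff add2e (e : {posnum R}) :
    lebesgue_outer (\bigcup_n A n) <=
    \sum_(i <oo) lebesgue_outer (A i) + e%:num%:E.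
  by apply/lee_addgt0Pr => _/posnumP[].
rewrite (le_trans _ (epsilon_trick _ _ _))//; last first.
  by move=> n; exact: lebesgue_outer_ge0.
pose P n c := box_cover (A n) c /\
  \sum_(k <oo) box_vol (c k) <=
  lebesgue_outer (A n) + (e%:num / (2 ^ n.+1)%:R)%:E.
have [G PG] : {G : nat -> nat -> option ('rV[R]_N * 'rV[R]_N) & forall n : nat, P n (G n)}.
  apply: (@choice _ _ P) => n; rewrite /P /lebesgue_outer.
  set S := (X in ereal_inf X); move infS : (ereal_inf S) => iS.
  case: iS infS => [r Sr|Soo|Soo].
  - have en1 : (0 < e%:num / (2 ^ n.+1)%:R)%R by [].
    have /(lb_ereal_inf_adherent en1) : ereal_inf S \is a fin_num by rewrite Sr.
    move=> [x [c Anc muBx] xS].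
    by exists c; split => //; rewrite muBx -Sr; exact/ltW.
  - by have := Aoo n; rewrite /lebesgue_outer Soo.
  - have : 0 <= ereal_inf S by exact: (lebesgue_outer_ge0 (A n)).
    by rewrite Soo.
have volG_ge0 ij : 0 <= (box_vol \o uncurry G) ij by exact: box_vol_ge0.
apply: (@le_trans _ _ (\esum_(i in setT) (box_vol \o uncurry G) i)).
  apply: ereal_inf_lbound => /=.
  have /card_esym/ppcard_eqP[f] := card_nat2.
  exists (uncurry G \o f).
    move=> t [i _ /(PG i).1[j _ Bijt]]; exists (f^-1%FUN (i, j)) => //=.
    by rewrite invK ?inE.
  rewrite -(esum_pred_image (box_vol \o uncurry G) _ xpredT)//;
    rewrite ?[fun=> _]set_true//.
  by rewrite image_eq.
rewrite (_ : esum _ _ = \sum_(i <oo) \sum_(j <oo) box_vol (G i j)); last first.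
  pose J : nat -> set (nat * nat) := fun i => [set (i, j) | j in setT].
  rewrite (_ : setT = \bigcup_k J k); last first.
    by rewrite predeqE => -[a b]; split => // _; exists a => //; exists b.
  rewrite esum_bigcupT /=; last 2 first.
    - apply/trivIsetP => i j _ _ ij.
      rewrite predeqE => -[n m] /=; split => //= -[] [_] _ [<-{n} _].
      by move=> [m' _] [] /esym/eqP; rewrite (negbTE ij).
    - by move=> /= [n m]; exact: box_vol_ge0.
  rewrite -(image_id [set: nat]) -fun_true esum_pred_image//; last first.
    by move=> n _; apply: esum_ge0 => ij _; exact: box_vol_ge0.
  apply: eq_eseriesr => /= j _.
  rewrite -(esum_pred_image (box_vol \o uncurry G) (pair j) predT)/=; first last.
  - by move=> ? ? _ _; exact: (@can_inj _ _ _ snd).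
  - by move=> k _; exact: box_vol_ge0.
  by congr esum; rewrite predeqE => -[a b]; split; move=> [i _ <-]; exists i.
apply: lee_lim.
- apply: is_cvg_nneseries => n *.
  by apply: nneseries_ge0 => m *; exact: (volG_ge0 (n, m)).
- by apply: is_cvg_nneseries => n *; apply: adde_ge0 => //;
    exact: lebesgue_outer_ge0.
- by near=> n; apply: lee_sum => i _; exact: (PG i).2.
Unshelve. all: by end_near. Qed.

HB.instance Definition _ := isOuterMeasure.Build R 'rV[R]_N lebesgue_outer
  lebesgue_outer0 lebesgue_outer_ge0 le_lebesgue_outer
  lebesgue_outer_sigma_subadditive.

Let upd (a : 'rV[R]_N) (i : 'I_N) (t : R) : 'rV[R]_N :=
  (\row_j (if j == i then t else a 0 j))%R.

Let split_length (t p q : R) : (Num.max 0 (Num.min q t - p) +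
  Num.max 0 (q - Num.max p t) = Num.max 0 (q - p))%R.
Proof.
case: (leP q t) => qt.
  have [pt|tp] := leP p t.
    by rewrite [X in (_ + X)%R]max_l ?addr0// subr_le0.
  by rewrite !max_l ?addr0// subr_le0 (le_trans qt)// ltW.
have [pt|tp] := leP p t; last first.
  by rewrite [X in (X + _)%R]max_l ?add0r// subr_le0 ltW.
rewrite !max_r ?subr_ge0//; last 2 first.
- exact: le_trans (ltW qt).
- exact: ltW.
by rewrite addrC subrKA.
Qed.

Lemma lebesgue_outer_halfspace (i : 'I_N) (t : R) (H : set 'rV[R]_N) :
  (forall x, H x -> x 0 i <= t)%R -> (forall x, ~ H x -> t <= x 0 i)%R ->
  lebesgue_outer.-caratheodory H.
Proof.
move=> Hle Hge; apply: le_caratheodory_measurable => X.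
apply: le_ereal_inf_tmp => _ [c Xc <-].
pose lo o := if o is Some (a, b) then
  Some (a, upd b i (Num.min (b 0%R i) t)) else None.
pose hi o := if o is Some (a, b) then
  Some (upd a i (Num.max (a 0%R i) t), b) else None.
have -> : \sum_(k <oo) box_vol (c k) =
    \sum_(k <oo) box_vol (lo (c k)) + \sum_(k <oo) box_vol (hi (c k)).
  rewrite -nneseriesD//; try by move=> *; exact: box_vol_ge0.
  apply: eq_eseriesr => k _; case: (c k) => [[a b]|]/=; last by rewrite adde0.
  have prodE (a' b' : 'rV[R]_N) : (forall j, j != i -> a' 0%R j = a 0%R j) ->
      (forall j, j != i -> b' 0%R j = b 0%R j) ->
      (\prod_j Num.max 0 (b' 0 j - a' 0 j) = Num.max 0 (b' 0 i - a' 0 i) *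
       \prod_(j | j != i) Num.max 0 (b 0 j - a 0 j))%R.
    move=> a'E b'E; rewrite (bigD1 i)//=; congr (_ * _)%R.
    by apply: eq_bigr => j ji; rewrite a'E// b'E.
  rewrite -EFinD (prodE a b)// (prodE a)//; last first.
    by move=> j ji; rewrite mxE (negbTE ji).
  rewrite (prodE _ b)//; last by move=> j ji; rewrite mxE (negbTE ji).
  rewrite !mxE eqxx -mulrDl; congr (_ * _)%:E.
  exact/esym/split_length.
apply: leeD; apply: ereal_inf_lbound.
- exists (fun k => lo (c k)) => //.
  move=> x [/Xc[k _]]; case E : (c k) => [[a b]|//]/= xab Hx; exists k => //.
  rewrite E/= => j; rewrite mxE; have := xab j; case: eqP => [->|//].
  by rewrite le_min Hle// andbT.
- exists (fun k => hi (c k)) => //.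
  move=> x [/Xc[k _]]; case E : (c k) => [[a b]|//]/= xab Hx; exists k => //.
  rewrite E/= => j; rewrite mxE; have := xab j; case: eqP => [->|//].
  by rewrite ge_max Hge// andbT.
Qed.

Lemma lebesgue_outer_box o : lebesgue_outer.-caratheodory (box o).
Proof.
case: o => [[a b]|]; last exact: caratheodory_measurable_set0.
have -> : box (Some (a, b)) = ~` (\bigcup_(k in [set: nat])
    if insub k is Some i then
      [set x : 'rV[R]_N | (x 0 i < a 0 i)%R] `|`
      ~` [set x : 'rV[R]_N | (x 0 i <= b 0 i)%R]
    else set0).
  apply/seteqP; split => [x abx [k _]|x nx i].
    case: insubP => // i _ _ /= [|]; have /andP[ai bi] := abx i => //.
    by rewrite ltNge ai.
  apply/andP; split; rewrite leNgt; apply/negP => h; apply: nx;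
    exists (val i) => //; rewrite valK; [by left|right => /=].
  by rewrite leNgt h.
apply: caratheodory_measurable_setC; apply: caratheodory_measurable_bigcup.
move=> k; case: insubP => [i _ _|_]; last exact: caratheodory_measurable_set0.
apply: caratheodory_measurable_setU.
  apply: (@lebesgue_outer_halfspace i (a 0%R i)) => x /=; first exact: ltW.
  by move/negP; rewrite -leNgt.
apply: caratheodory_measurable_setC.
apply: (@lebesgue_outer_halfspace i (b 0%R i)) => x //=.
by move/negP; rewrite -ltNge; exact: ltW.
Qed.

End lebesgue_outer_measure.

(* 'rV[R]_N with its sigma-algebra of Lebesgue measurable sets *)
Definition lebesgue_space (R : realType) (N : nat) : Type := 'rV[R]_N.

Section lebesgue_measure_rV.
Context (R : realType) (N : nat).
Local Notation outer := (@lebesgue_outer R N).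

HB.instance Definition _ := Pointed.copy (lebesgue_space R N) 'rV[R]_N.
HB.instance Definition _ := @isMeasurable.Build (caratheodory_display outer)
  (lebesgue_space R N) outer.-caratheodory
  (caratheodory_measurable_set0 outer)
  (@caratheodory_measurable_setC _ _ outer)
  (@caratheodory_measurable_bigcup _ _ outer).

Definition lebesgue_rV : set (lebesgue_space R N) -> \bar R := outer.

HB.instance Definition _ := isMeasure.Build _ _ _ lebesgue_rV
  (@lebesgue_outer0 R N) (@lebesgue_outer_ge0 R N)
  (@caratheodory_measure_sigma_additive _ _ outer).

Lemma lebesgue_rV_sigma_finite : sigma_finite setT lebesgue_rV.
Proof.
pose B k : option ('rV[R]_N * 'rV[R]_N) :=
  Some (const_mx (- k%:R), const_mx k%:R).
exists (fun k => box (B k)).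
  apply/esym; rewrite -subTset => x _; exists (Num.truncn `|x|).+1 => //= i.
  rewrite !mxE -ler_norml (@le_trans _ _ `|x|)//.
    by rewrite [leRHS]/Num.norm/= mx_normrE; exact: (le_bigmax _ _ (0, i)).
  by rewrite ltW// truncnS_gt.
move=> k; split; first exact: lebesgue_outer_box.
apply: (@le_lt_trans _ _ (box_vol (B k))); last exact: ltry.
apply: ereal_inf_lbound; exists (fun j => if j == 0%N then B k else None).
  by move=> x Bx; exists 0%N.
rewrite (nneseries_split _ 1); last by move=> *; exact: box_vol_ge0.
rewrite big_mkord big_ord1 eseries0 ?adde0//.
by case.
Qed.

HB.instance Definition _ := Measure_isSigmaFinite.Build _ _ _ lebesgue_rV
  lebesgue_rV_sigma_finite.

End lebesgue_measure_rV.

Section smooth_domain.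
Context (R : realType).

Definition partial n (i : 'I_n) (g : 'rV[R]_n -> R) : 'rV[R]_n -> R :=
  fun x => 'D_(delta_mx 0 i) g x.

Fixpoint Ck n (k : nat) (g : 'rV[R]_n -> R) : Prop :=
  if k is k'.+1 then
    continuous g /\ forall i : 'I_n,
      (forall x, derivable g x (delta_mx 0 i)) /\ Ck k' (partial i g)
  else continuous g.

Definition smooth n (g : 'rV[R]_n -> R) : Prop := forall k, Ck k g.

(* Near each of its boundary points Omega is, up to relabeling and reorienting
   the coordinate axes, the region above the graph of a smooth function of
   the other N - 1 coordinates. *)
Definition smooth_boundary N (Omega : set 'rV[R]_N) : Prop :=
  forall x0, (closure Omega `\` Omega°) x0 ->
  exists (j : 'I_N) (b : bool) (g : 'rV[R]_N.-1 -> R),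
    smooth g /\
    \forall x \near x0, Omega x <-> g (col' j x) < (-1) ^+ b * x 0 j.

Definition bounded_smooth_domain N (Omega : set 'rV[R]_N) : Prop :=
  [/\ open Omega, connected Omega, Omega !=set0, bounded_set Omega &
      smooth_boundary Omega].

End smooth_domain.

Section fractional_laplacian.
Context (R : realType) (N : nat).
Local Notation mu := (@lebesgue_rV R N).
Local Notation mu2 := (mu \x mu)%E.

(* The norm of the library on 'rV[R]_N is the sup norm. *)
Definition enorm (x : 'rV[R]_N) : R := Num.sqrt (\sum_i x 0 i ^+ 2).

(* The value at 0 is 0 rather than +oo; K(x - y) only occurs multiplied by
   factors vanishing on the diagonal. *)
Definition frac_kernel (s : R) (x : 'rV[R]_N) : R :=
  enorm x `^ (- (N%:R + 2 * s)).

Definition sqr_integrable d (T : measurableType d) (m : set T -> \bar R)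
    (D : set T) (g : T -> R) : Prop :=
  measurable_fun D g /\ m.-integrable D (fun x => (g x ^+ 2)%:E).

Definition Qset (Omega : set 'rV[R]_N) :
    set (lebesgue_space R N * lebesgue_space R N) :=
  ~` ((~` Omega) `*` (~` Omega)).

Definition Xs (s : R) (Omega : set 'rV[R]_N) : set ('rV[R]_N -> R) :=
  [set u | [/\ measurable_fun setT (u : lebesgue_space R N -> R),
    sqr_integrable mu Omega u &
    sqr_integrable mu2 (Qset Omega)
      (fun z => (u z.1 - u z.2) *
        Num.sqrt (frac_kernel s (z.1 - z.2 : 'rV[R]_N)))]].

Definition Xs0 (s : R) (Omega : set 'rV[R]_N) : set ('rV[R]_N -> R) :=
  [set u | Xs s Omega u /\ {ae mu, forall x, (~` Omega) x -> u x = 0}].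

(* The left-hand side is finite for u and v in Xs0, so for lambda != 0 the
   equality forces f(u) v to be integrable on Omega. *)
Definition weak_solution (s : R) (Omega : set 'rV[R]_N) (lambda : R)
    (f : R -> R) (u : 'rV[R]_N -> R) : Prop :=
  Xs0 s Omega u /\ forall v, Xs0 s Omega v ->
  (2^-1%:E * \int[mu2]_z
     ((u z.1 - u z.2) * (v z.1 - v z.2) *
      frac_kernel s (z.1 - z.2 : 'rV[R]_N))%:E =
   lambda%:E * \int[mu]_(x in Omega) (f (u x) * v x)%:E)%E.

End fractional_laplacian.

(* Main.v *)
Require Import Defs.
From HB Require Import structures.
From mathcomp Require Import all_boot all_order all_algebra.
From mathcomp Require Import all_classical all_reals all_analysis measurable_realfun.
From mathcomp Require Import ring lra.
Import Order.TTheory GRing.Theory Num.Theory.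
Import numFieldNormedType.Exports.
Set Implicit Arguments.
Unset Strict Implicit.
Unset Printing Implicit Defensive.
Local Open Scope classical_set_scope.
Local Open Scope ring_scope.

(** The larger solution v and the smaller one u are limits of orbits of one
    order preserving map. Put M = lambda M0 and h(t) = lambda (f(t) + M0 t),
    which is nondecreasing on [0,1] with h(0) = 0, h(1) = M. Given u, let S u
    solve (-Delta)^s z + M z = h(u). Comparison shows that S preserves the
    functions between 0 and b when b is the indicator of Omega or a solution,
    and by convexity of the primitive H of h the energy J drops by at least
    half of the squared distance from u to S u at each step; compactness gives
    fixed points as limits of orbits.
    - For lambda large J is negative at half of the truncated distance to the
      complement of Omega, so the orbit from there yields v with J(v) < 0.
    - On the interval [0, v] the functions of small energy and small J form a
      well around 0 that is invariant under S, since f is superlinear at 0.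
      The orbit of theta v enters it for theta = 0 and not for theta = 1; at
      the threshold the orbit never enters it, nor reaches J < 0, and yields
      u with u <> 0 and J(u) >= 0 > J(v).
    - Finally v - u >= 0 is a supersolution, so the strong maximum principle
      makes it positive in Omega. *)


(** A mountain pass between 0 and v would not by itself place the second solution below v. The
    iteration of S does: comparison keeps order intervals invariant, and J decreases at each step as
    along a gradient flow. Adding M u to both sides is what allows this: h becomes monotone, so S
    preserves order, and J becomes a quadratic convex functional minus a convex one; the shift
    cancels in the weak formulation. All iterates take values in [0,1], where h is bounded, so
    compactness in L^2 is enough to pass to the limit; it is derived from finitely many averages
    over small cubes. The threshold argument rests on two facts: each iterate depends continuously,
    in the energy norm, on the starting point, and the well is open. Order is kept everywhere and
    not only almost everywhere: representatives vanish exactly outside Omega, and solutions of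
    linear problems are corrected by functions of zero energy. With w0 half of the truncated
    distance and G a primitive of f on [0,1], the threshold for lambda is E(w0) / (2 int G(w0)) + 1:
    beyond it J(w0) < 0. *)

(** * Positive semidefinite forms on spaces of functions *)

Section bilinear_form.
Context (R : realType) (T : Type).
Implicit Types (c d e : R) (u v w : T -> R).

Definition lin c u d v : T -> R := fun x => c * u x + d * v x.

(** Linearity and positivity are asked on [X] only, because outside it the integrals are default
    values. The record serves three forms: the L^2 product, the energy [En], and the shifted energy
    [aform]. *)
Record psd_form (X : set (T -> R)) (a : (T -> R) -> (T -> R) -> R) : Prop := PsdForm {
  psd_lin : forall c u d v, X u -> X v -> X (lin c u d v);
  psd_linl : forall c u d v w, X u -> X v -> X w ->
    a (lin c u d v) w = c * a u w + d * a v w;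
  psd_sym : forall u v, a u v = a v u;
  psd_ge0 : forall u, X u -> 0 <= a u u }.

Variables (X : set (T -> R)) (a : (T -> R) -> (T -> R) -> R).
Hypothesis aF : psd_form X a.

Lemma psd_linr c u d v w : X u -> X v -> X w ->
  a w (lin c u d v) = c * a w u + d * a w v.
Proof.
by move=> Xu Xv Xw; rewrite (psd_sym aF) (psd_linl aF)// !(psd_sym aF w).
Qed.

Lemma psd_quad c u d v : X u -> X v -> a (lin c u d v) (lin c u d v) =
  c ^+ 2 * a u u + 2 * c * d * a u v + d ^+ 2 * a v v.
Proof.
move=> Xu Xv; have Xl := psd_lin aF c d Xu Xv.
by rewrite (psd_linl aF)// !psd_linr// (psd_sym aF v u); ring.
Qed.

Lemma psd_young e u v : 0 < e -> X u -> X v ->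
  2 * a u v <= e * a u u + e^-1 * a v v.
Proof.
move=> e0 Xu Xv; have := psd_ge0 aF (psd_lin aF 1 (- e^-1) Xu Xv).
rewrite psd_quad// => h; rewrite -subr_ge0.
have := mulr_ge0 (ltW e0) h; congr (_ <= _).
by field; rewrite gt_eqF.
Qed.

Lemma psd_CS u v : X u -> X v -> a u v ^+ 2 <= a u u * a v v.
Proof.
move=> Xu Xv.
have := psd_ge0 aF (psd_lin aF (a v v) (- a u v) Xu Xv).
have := psd_ge0 aF Xv; rewrite le_eqVlt => /predU1P[v0 _|v0].
  have h t : 0 <= a u u + 2 * t * a u v.
    have := psd_ge0 aF (psd_lin aF 1 t Xu Xv).
    by rewrite psd_quad// -v0; congr (_ <= _); ring.
  rewrite -v0 mulr0; have [->|uv0] := eqVneq (a u v) 0; first by rewrite expr0n.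
  (* Were [a u v] nonzero, this t would give the nonnegative affine expression the value -1. *)
  have := h (- (a u u + 1) / (2 * a u v)).
  have -> : 2 * (- (a u u + 1) / (2 * a u v)) * a u v = - (a u u + 1).
    by field; rewrite uv0.
  by lra.
rewrite psd_quad// => h; rewrite -subr_ge0 -(pmulr_rge0 _ v0).
by move: h; congr (_ <= _); ring.
Qed.

(** Functions are not identified when they agree almost everywhere, so a null vector of the form
    need not be 0; it can still be added to a solution without changing the equation. *)
Lemma psd_null u v : X u -> X v -> a u u <= 0 -> a u v = 0.
Proof.
move=> Xu Xv u0; have u00 : a u u = 0 by apply/le_anti; rewrite u0 (psd_ge0 aF Xu).
have := psd_CS Xu Xv; rewrite u00 mul0r => h.
by apply/eqP; rewrite -sqrf_eq0 eq_le h sqr_ge0.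
Qed.

Lemma psd_triangle u v w : X u -> X v -> X w ->
  a (lin 1 u (-1) w) (lin 1 u (-1) w) <=
  2 * a (lin 1 u (-1) v) (lin 1 u (-1) v) +
  2 * a (lin 1 v (-1) w) (lin 1 v (-1) w).
Proof.
move=> Xu Xv Xw.
have X1 := psd_lin aF 1 (-1) Xu Xv; have X2 := psd_lin aF 1 (-1) Xv Xw.
have -> : lin 1 u (-1) w = lin 1 (lin 1 u (-1) v) 1 (lin 1 v (-1) w).
  by apply/funext => x; rewrite /lin; ring.
have := psd_ge0 aF (psd_lin aF 1 (-1) X1 X2).
by rewrite !(psd_quad _ _ X1 X2); lra.
Qed.

Lemma psd_sub_le u v : X u -> X v ->
  a (lin 1 u (-1) v) (lin 1 u (-1) v) <= 2 * a u u + 2 * a v v.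
Proof.
move=> Xu Xv; have := psd_ge0 aF (psd_lin aF 1 1 Xu Xv).
by rewrite !(psd_quad _ _ Xu Xv); lra.
Qed.

End bilinear_form.

(** * Square integrable functions and the L^2 product *)

Section sqr_integrable_functions.
Context d (T : measurableType d) (R : realType) (m : {measure set T -> \bar R}).
Implicit Types (f g : T -> R).

Definition L2 : set (T -> R) := fun f => sqr_integrable m setT f.

Definition ip f g : R := \int[m]_x (f x * g x).

Lemma integrable_dominated f g : measurable_fun setT f ->
  m.-integrable setT (EFin \o g) -> (forall x, `|f x| <= g x) ->
  m.-integrable setT (EFin \o f).
Proof.
move=> mf ig fg; apply: (le_integrable measurableT _ _ ig).
  exact/measurable_EFinP.
move=> x _ /=; rewrite lee_fin (le_trans (fg x))//; exact: ler_norm.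
Qed.

Lemma integrable_lin c f d' g : m.-integrable setT (EFin \o f) ->
  m.-integrable setT (EFin \o g) -> m.-integrable setT (EFin \o lin c f d' g).
Proof.
move=> i1 i2.
have := integrableD measurableT (integrableZl measurableT c i1)
                                (integrableZl measurableT d' i2).
by apply: eq_integrable => // x _ /=; rewrite -!EFinM -EFinD.
Qed.

Lemma Rintegral_lin c f d' g : m.-integrable setT (EFin \o f) ->
  m.-integrable setT (EFin \o g) ->
  \int[m]_x lin c f d' g x = c * \int[m]_x f x + d' * \int[m]_x g x.
Proof.
have scale k h : m.-integrable setT (EFin \o h) ->
    m.-integrable setT (EFin \o (fun x => k * h x)).
  by move=> i; apply: eq_integrable (integrableZl measurableT k i).
by move=> i1 i2; rewrite RintegralD ?RintegralZl//; exact: scale.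
Qed.

Lemma L2_measurable f : L2 f -> measurable_fun setT f.
Proof. by case. Qed.

Lemma L2_integrable_prod f g : L2 f -> L2 g ->
  m.-integrable setT (EFin \o (fun x => f x * g x)).
Proof.
move=> [mf f2] [mg g2].
apply: (@integrable_dominated _ (fun x => f x ^+ 2 + g x ^+ 2)).
- exact: measurable_funM.
- by have := integrableD measurableT f2 g2; apply: eq_integrable.
- move=> x; rewrite ler_norml.
  have := sqr_ge0 (f x + g x); have := sqr_ge0 (f x - g x).
  have := sqr_ge0 (f x); have := sqr_ge0 (g x).
  by rewrite sqrrB sqrrD; lra.
Qed.

Lemma L2_lin c f d' g : L2 f -> L2 g -> L2 (lin c f d' g).
Proof.
move=> Lf Lg; have [mf f2] := Lf; have [mg g2] := Lg.
have ml : measurable_fun setT (lin c f d' g).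
  by apply: measurable_funD; apply: measurable_funM => //; exact: measurable_cst.
split => //.
have := integrable_lin 1 (2 * c * d') (integrable_lin (c ^+ 2) (d' ^+ 2) f2 g2)
  (L2_integrable_prod Lf Lg).
by apply: eq_integrable => // x _ /=; rewrite /lin; congr EFin; ring.
Qed.

Lemma L2_form : psd_form L2 ip.
Proof.
split.
- exact: L2_lin.
- move=> c u d' v w Lu Lv Lw; rewrite /ip /lin.
  rewrite -(Rintegral_lin c d' (L2_integrable_prod Lu Lw) (L2_integrable_prod Lv Lw)).
  by apply: eq_Rintegral => x _; rewrite /lin; ring.
- by move=> u v; apply: eq_Rintegral => x _; rewrite mulrC.
- by move=> u _; apply: Rintegral_ge0 => x _; rewrite -expr2 sqr_ge0.
Qed.

Lemma le_ip f g f' g' : L2 f -> L2 g -> L2 f' -> L2 g' ->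
  (forall x, f x * g x <= f' x * g' x) -> ip f g <= ip f' g'.
Proof.
by move=> *; apply: le_Rintegral => //; exact: L2_integrable_prod.
Qed.

Lemma L2_dominated f g : measurable_fun setT f -> L2 g ->
  (forall x, `|f x| <= `|g x|) -> L2 f.
Proof.
move=> mf [mg g2] fg; split => //.
apply: (@integrable_dominated (fun x => f x ^+ 2) (fun x => g x ^+ 2)) => //.
  exact: measurable_funX.
by move=> x; rewrite normrX -[leRHS]real_normK ?num_real// lerXn2r// nnegrE.
Qed.

Lemma ip_dominated f g : measurable_fun setT f -> L2 g ->
  (forall x, `|f x| <= `|g x|) -> ip f f <= ip g g.
Proof.
move=> mf Lg fg; have Lf := L2_dominated mf Lg fg; apply: le_ip => // x.
by rewrite -!expr2 -real_normK ?num_real// -[leRHS]real_normK ?num_real// lerXn2r// nnegrE.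
Qed.

Lemma ipE f : L2 f -> (\int[m]_x (f x ^+ 2)%:E = (ip f f)%:E)%E.
Proof.
move=> Lf; rewrite /ip /Rintegral fineK//.
exact: integrable_fin_num (L2_integrable_prod Lf Lf).
Qed.

Lemma eq_ip_ae f g f' g' : L2 f -> L2 g -> L2 f' -> L2 g' ->
  {ae m, forall x, f x = f' x} -> {ae m, forall x, g x = g' x} ->
  ip f g = ip f' g'.
Proof.
move=> Lf Lg Lf' Lg' ff gg; congr fine; apply: ae_eq_integral => //.
- exact: measurable_int (L2_integrable_prod Lf Lg).
- exact: measurable_int (L2_integrable_prod Lf' Lg').
- by apply: filterS2 ff gg => x /= -> ->.
Qed.

Lemma L2_indic (A : set T) : measurable A -> (m A < +oo)%E -> L2 \1_A.
Proof.
move=> mA Af; split; first exact: measurable_indic.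
apply/integrableP; split.
  by apply/measurable_EFinP; apply: measurable_funX; exact: measurable_indic.
rewrite (_ : (fun x => _) = (fun x => (\1_A x)%:E)); last first.
  apply/funext => x; rewrite /= indicE.
  by case: (_ \in _); rewrite ?expr1n ?expr0n /= ?normr0 ?normr1.
by rewrite integral_indic// setIT.
Qed.

Lemma ip_indic (A : set T) : measurable A -> (m A < +oo)%E ->
  ip \1_A \1_A = fine (m A).
Proof.
move=> mA Af; rewrite /ip /Rintegral.
rewrite (eq_integral (fun x => (\1_A x)%:E)) ?integral_indic ?setIT//.
by move=> x _; rewrite indicE; case: (_ \in _); rewrite ?mulr1 ?mulr0.
Qed.

End sqr_integrable_functions.

(** * Lebesgue measure of boxes and measurability of open sets *)

Section lebesgue_boxes.
Context (R : realType) (N : nat).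
Local Notation mu := (@lebesgue_rV R N).
Local Notation T := (lebesgue_space R N).
Implicit Types (x a b : 'rV[R]_N).

Lemma box_measurable o : measurable (box o : set T).
Proof. exact: lebesgue_outer_box. Qed.

Lemma lebesgue_box_le o : (mu (box o) <= box_vol o)%E.
Proof.
apply: ereal_inf_lbound; exists (fun j => if j == 0%N then o else None).
  by move=> x Bx; exists 0%N.
rewrite (nneseries_split _ 1); last by move=> *; exact: box_vol_ge0.
by rewrite big_mkord big_ord1 eseries0 ?adde0//; case.
Qed.

Let upd x (d : 'I_N) (t : R) : 'rV[R]_N :=
  \row_j (if j == d then t else x 0 j).

Let side (d : nat) a b x (i : 'I_N) : R :=
  if (i < d)%N then Num.max 0 (b 0 i - a 0 i)
  else \1_(`[a 0 i, b 0 i]%classic : set R) (x 0 i).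

(* The volume of a box in the first d coordinates, times the indicator of the
   box in the remaining ones. *)
Let pvol (d : nat) o x : \bar R :=
  if o is Some (a, b) then (\prod_i side d a b x i)%:E else 0%E.

Let side_ge0 d a b x i : 0 <= side d a b x i.
Proof. by rewrite /side; case: ifP => _; rewrite ?le_max ?lexx// indicE. Qed.

Let pvol_ge0 d o x : (0 <= pvol d o x)%E.
Proof.
by case: o => [[a b]|]//=; rewrite lee_fin; apply: prodr_ge0 => i _.
Qed.

Let pvol_step (d : 'I_N) o x :
  (\int[lebesgue_measure]_t pvol d o (upd x d t) = pvol d.+1 o x)%E /\
  measurable_fun setT (fun t : R => pvol d o (upd x d t)).
Proof.
case: o => [[a b]|]; last by rewrite /= integral0; split.
pose c : R := \prod_(i | i != d) side d.+1 a b x i.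
have c0 : 0 <= c by apply: prodr_ge0.
have E t : pvol d (Some (a, b)) (upd x d t) =
    (c%:E * (\1_(`[a 0%R d, b 0%R d]%classic : set R) t)%:E)%E.
  rewrite /= (bigD1 d)//= {1}/side ltnn mxE eqxx mulrC; congr (_ * _)%:E.
  apply: eq_bigr => i id; rewrite /side ltnS (leq_eqVlt i) val_eqE (negbTE id)/=.
  by rewrite mxE (negbTE id).
have mI : measurable_fun setT (fun t : R =>
    (\1_(`[a 0%R d, b 0%R d]%classic : set R) t : R)%:E).
  by apply/measurable_EFinP; apply: measurable_indic.
split; last first.
  rewrite (_ : (fun t => _) = fun t =>
    (c%:E * (\1_(`[a 0%R d, b 0%R d]%classic : set R) t)%:E)%E); last exact/funext.
  exact: emeasurable_funM.
under eq_integral do rewrite E.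
rewrite ge0_integralZl//.
rewrite integral_indic// setIT /= lebesgue_measure_itv /= lte_fin.
rewrite (bigD1 d)//= -/c {1}/side ltnSn EFinM muleC; congr (_ * _)%E.
by case: ltP => h; rewrite ?EFinB// -?EFinB; congr EFin;
  [rewrite max_r// subr_ge0 ltW|rewrite max_l// subr_le0].
Qed.

(** The nontrivial half of the volume formula: countably many boxes covering a box have at least its
    total volume. For d = 0 it compares indicators pointwise; each further d integrates out one
    coordinate, with sum and integral exchanged by monotone convergence; at d = N only volumes
    remain. *)
Let pvol_le (c : nat -> option ('rV[R]_N * 'rV[R]_N)) o (d : nat) :
  box o `<=` \bigcup_k box (c k) -> (d <= N)%N -> forall x,
  (pvol d o x <= \sum_(k <oo) pvol d (c k) x)%E.
Proof.
move=> oc; elim: d => [_ x|d IH dN x].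
  have pvol0 o' : pvol 0 o' x = (\1_(box o') x)%:E.
    case: o' => [[a b]|]/=; last by rewrite indicE in_set0.
    congr EFin; have [bx|/negP bx] := boolP (`[< forall i, a 0 i <= x 0 i <= b 0 i >]).
      move/asboolP in bx; rewrite indicE mem_set// big1// => i _.
      by rewrite /side ltn0 indicE mem_set//= in_itv; exact: bx.
    rewrite indicE memNset; last by move=> h; apply: bx; apply/asboolP.
    have /existsNP[i bi] : ~ forall i, a 0 i <= x 0 i <= b 0 i.
      by move=> h; apply: bx; apply/asboolP.
    rewrite (bigD1 i)//= {1}/side ltn0 indicE memNset ?mul0r//.
  rewrite pvol0; have [xo|xo] := pselect (box o x); last first.
    by rewrite indicE memNset//; apply: nneseries_ge0 => *; exact: pvol_ge0.
  have [k _ xk] := oc _ xo; rewrite indicE mem_set//.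
  apply: (@le_trans _ _ (pvol 0 (c k) x)); first by rewrite pvol0 indicE mem_set.
  rewrite (nneseries_split _ k.+1); last by move=> *; exact: pvol_ge0.
  rewrite /= add0n big_nat_recr//=; apply: (@le_trans _ _ (\sum_(0 <= i < k) pvol 0 (c i) x + pvol 0 (c k) x)%E).
    by rewrite leeDr//; apply: sume_ge0 => *; exact: pvol_ge0.
  by rewrite leeDl//; apply: nneseries_ge0 => *; exact: pvol_ge0.
have st o' := pvol_step (Ordinal dN) o' x.
rewrite -(st o).1; under eq_eseriesr do rewrite -(st _).1.
rewrite -integral_nneseries//; [|by move=> k; exact: (st _).2].
apply: ge0_le_integral => //.
- exact: (st o).2.
- apply: ge0_emeasurable_sum; first by move=> *; exact: pvol_ge0.
  by move=> k _; exact: (st _).2.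
- by move=> t _; exact: (IH (ltnW dN)).
Qed.

Lemma lebesgue_box_ge o : (box_vol o <= mu (box o))%E.
Proof.
have volE o' : pvol N o' 0 = box_vol o'.
  by case: o' => [[a b]|]//=; congr EFin; apply: eq_bigr => i _; rewrite /side ltn_ord.
apply: le_ereal_inf_tmp => _ [c oc <-].
by rewrite -volE; under eq_eseriesr do rewrite -volE; exact: pvol_le.
Qed.

Lemma lebesgue_box o : mu (box o) = box_vol o.
Proof. by apply/le_anti; rewrite lebesgue_box_le lebesgue_box_ge. Qed.

Lemma mxnorm_leP x (r : R) : 0 <= r ->
  (`|x| <= r) <-> (forall i, `|x 0 i| <= r).
Proof.
move=> r0; rewrite [`|x|]/Num.norm/= mx_normrE; split => h.
  by move=> i; apply: le_trans h; exact: (le_bigmax _ _ (0, i)).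
by apply/bigmax_leP; split => // -[i j] _ /=; rewrite ord1.
Qed.

Lemma coord_le_mxnorm x i : `|x 0 i| <= `|x|.
Proof. by have /mxnorm_leP := lexx `|x|; apply. Qed.

Lemma measurable_coord (i : 'I_N) : measurable_fun setT (fun x : T => x 0 i).
Proof.
apply: (measurability (@RGenCInfty.G R)); first exact: RGenCInfty.measurableE.
move=> _ [_ [r ->] <-]; rewrite setTI.
rewrite (_ : _ @^-1` _ = ~` [set x : 'rV[R]_N | x 0 i < r]); last first.
  apply/seteqP; split => x /=; rewrite in_itv/= andbT leNgt; first by move/negP.
  by move=> /negP.
apply: measurableC; apply: (@lebesgue_outer_halfspace _ _ i r) => x /=.
  exact: ltW.
by move/negP; rewrite -leNgt.
Qed.

(** An open set is the union of the closed cells it contains, taken from the grids of mesh 1/(n+1);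
    there are countably many of them. *)
Lemma open_lebesgue_measurable (O : set 'rV[R]_N) :
  open O -> measurable (O : set T).
Proof.
move=> oO.
pose B (nq : nat * {ffun 'I_N -> int}) : set 'rV[R]_N :=
  let: (n, q) := nq in box (Some (\row_i ((q i)%:~R / n.+1%:R),
                       \row_i (((q i)%:~R + 1) / n.+1%:R))).
have -> : O = \bigcup_nq (if `[< B nq `<=` O >] then B nq else set0).
  apply/seteqP; split => [x Ox|x [nq _]]; last first.
    by case: asboolP => // BO /BO.
  have /nbhs_ballP[e /= e0 be] := open_nbhs_nbhs (conj oO Ox).
  have [n en] : exists n : nat, n.+1%:R^-1 < e.
    exists (Num.truncn e^-1); rewrite invf_plt ?posrE// ?truncnS_gt//.
  have n0 : 0 < n.+1%:R :> R by [].
  pose q : {ffun 'I_N -> int} := [ffun i => Num.floor (x 0 i * n.+1%:R)].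
  have qx i : (q i)%:~R / n.+1%:R <= x 0 i < ((q i)%:~R + 1) / n.+1%:R.
    rewrite ler_pdivrMr// ltr_pdivlMr// ffunE floor_le_tmp /=.
    by rewrite -[1]/(1%:~R) -intrD floorD1_gt.
  exists (n, q) => //; case: asboolP => [_ /= i|[]].
    by rewrite !mxE; have /andP[-> /ltW ->] := qx i.
  move=> y /= By; apply: be => /=; rewrite -ball_normE /=.
  apply: le_lt_trans en; apply/mxnorm_leP => // i.
  rewrite !mxE; have := By i; have := qx i; rewrite !mxE mulrDl mul1r.
  rewrite ler_norml; move: (n.+1%:R^-1) (_ / _) (x 0 i) (y 0 i) => r p t t'.
  by move=> /andP[? ?] /andP[? ?]; apply/andP; split; lra.
apply: countable_bigcupT_measurable => // -[n q].
by case: asboolP => // _; exact: box_measurable.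
Qed.

Definition cball x (r : R) : set T := [set y : 'rV[R]_N | `|x - y| <= r].

Lemma lebesgue_cball_le x (r : R) : 0 <= r ->
  measurable (cball x r) /\
  (mu (cball x r) <= ((2 * r) ^+ N)%:E)%E.
Proof.
move=> r0; have E : cball x r = box (Some (x - const_mx r, x + const_mx r)).
  apply/seteqP; split => y /= => [/(mxnorm_leP _ r0) h i|h].
    by have := h i; rewrite !mxE ler_norml => /andP[? ?]; apply/andP; split; lra.
  apply/(mxnorm_leP _ r0) => i; have := h i; rewrite !mxE => /andP[? ?].
  by rewrite ler_norml; apply/andP; split; lra.
rewrite E; split; first exact: box_measurable.
rewrite lebesgue_box /= lee_fin.
under eq_bigr => i _.
  rewrite !mxE (_ : _ + _ - _ = 2 * r); last by ring.
  by rewrite max_r ?mulr_ge0//; over.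
by rewrite prodr_const card_ord.
Qed.

End lebesgue_boxes.

(** * Integrals and null sets for product measures *)

Section product_integrals.
Context d1 d2 (T1 : measurableType d1) (T2 : measurableType d2) (R : realType).
Variable m1 : {sigma_finite_measure set T1 -> \bar R}.
Variable m2 : {sigma_finite_measure set T2 -> \bar R}.
Implicit Types (f : T1 -> R) (g : T2 -> R).

Lemma measurable_comp_fst d (T : measurableType d) (f : T1 -> T) :
  measurable_fun setT f -> measurable_fun setT (fun z : T1 * T2 => f z.1).
Proof. by move=> mf; apply: (measurableT_comp mf); exact: measurable_fst. Qed.

Lemma measurable_comp_snd d (T : measurableType d) (g : T2 -> T) :
  measurable_fun setT g -> measurable_fun setT (fun z : T1 * T2 => g z.2).
Proof. by move=> mg; apply: (measurableT_comp mg); exact: measurable_snd. Qed.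

Lemma integrable_prod f g :
  m1.-integrable setT (EFin \o f) -> m2.-integrable setT (EFin \o g) ->
  (m1 \x m2)%E.-integrable setT (EFin \o (fun z => f z.1 * g z.2)).
Proof.
move=> fi gi.
have mf : measurable_fun setT f by apply/measurable_EFinP; exact: measurable_int fi.
have mg : measurable_fun setT g by apply/measurable_EFinP; exact: measurable_int gi.
apply/integrable12ltyP.
  apply/measurable_EFinP; apply: measurable_funM.
    exact: measurable_comp_fst.
  exact: measurable_comp_snd.
have /integrableP[_ fi'] := fi; have /integrableP[_ gi'] := gi.
rewrite (eq_integral (fun x => `|(f x)%:E| * (\int[m2]_y `|(g y)%:E|))%E); last first.
  move=> x _; rewrite -ge0_integralZl//.
    by apply: eq_integral => y _ /=; rewrite -EFinM normrM.
  by apply/measurable_EFinP; exact: measurableT_comp.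
rewrite ge0_integralZr//.
- by rewrite lte_mul_pinfty// ?ge0_fin_numE ?integral_ge0.
- by apply/measurable_EFinP; exact: measurableT_comp.
- exact: integral_ge0.
Qed.

Lemma Rintegral_prod f g :
  m1.-integrable setT (EFin \o f) -> m2.-integrable setT (EFin \o g) ->
  \int[(m1 \x m2)%E]_z (f z.1 * g z.2) = \int[m1]_x f x * \int[m2]_y g y.
Proof.
move=> fi gi; rewrite /Rintegral -(integral12_prod_meas1 (integrable_prod fi gi)).
rewrite -fineM ?(integrable_fin_num _ fi) ?(integrable_fin_num _ gi)//.
rewrite -(fineK (integrable_fin_num measurableT gi)) -integralZr//.
congr fine; apply: eq_integral => x _ /=; rewrite /fubini_F /=.
rewrite fineK ?(integrable_fin_num _ gi)// -integralZl//.
Qed.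

Lemma ae_prod1 (P : set T1) :
  {ae m1, forall x, P x} -> {ae (m1 \x m2)%E, forall z, P z.1}.
Proof.
move=> [A [mA A0 PA]]; exists (A `*` setT); split.
- exact: measurableX.
- apply: (etrans (product_measure1E m1 m2 mA measurableT)).
  by move: A0 => /= ->; rewrite mul0e.
- by move=> z /= nP; split => //; apply: PA.
Qed.

Lemma ae_prod2 (P : set T2) :
  {ae m2, forall x, P x} -> {ae (m1 \x m2)%E, forall z, P z.2}.
Proof.
move=> [A [mA A0 PA]]; exists (setT `*` A); split.
- exact: measurableX.
- apply: (etrans (product_measure1E m1 m2 measurableT mA)).
  by move: A0 => /= ->; rewrite mule0.
- by move=> z /= nP; split => //; apply: PA.
Qed.

End product_integrals.

(** * The fractional energy, its space and truncations *)

Section fractional_energy.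
Context (R : realType) (s : R) (N : nat) (Omega : set 'rV[R]_N).
Local Notation mu := (@lebesgue_rV R N).
Local Notation mu2 := (mu \x mu)%E.
Local Notation T := (lebesgue_space R N).
Implicit Types (u v w : T -> R) (x y h : 'rV[R]_N).

Definition kern (z : T * T) : R := frac_kernel s (z.1 - z.2 : 'rV[R]_N).

Lemma kern_ge0 z : 0 <= kern z.
Proof. exact: powR_ge0. Qed.

Lemma enorm_gt0 h : h != 0 -> 0 < enorm h.
Proof.
move=> h0; rewrite /enorm sqrtr_gt0 lt_neqAle sumr_ge0 ?andbT; last first.
  by move=> i _; exact: sqr_ge0.
apply/negP => /eqP/esym E; move/negP: h0; apply; apply/eqP/rowP => i; rewrite mxE.
apply/eqP; rewrite -sqrf_eq0.
by move/eqP: E; rewrite psumr_eq0 => [/allP/(_ i)|j _]; rewrite ?sqr_ge0// mem_index_enum => /(_ isT).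
Qed.

Lemma mxnorm_le_enorm h : `|h| <= enorm h.
Proof.
apply/mxnorm_leP => [|i]; first exact: sqrtr_ge0.
rewrite -sqrtr_sqr /enorm ler_wsqrtr// (bigD1 i)//= lerDl.
by apply: sumr_ge0 => j _; exact: sqr_ge0.
Qed.

Lemma enorm_le h r : `|h| <= r -> enorm h <= Num.sqrt N%:R * r.
Proof.
move=> hr; have r0 : 0 <= r by exact: le_trans hr.
rewrite -[X in _ * X](ger0_norm r0) -sqrtr_sqr -sqrtrM ?ler0n// /enorm ler_wsqrtr//.
rewrite mulr_natl -[N in leRHS]card_ord -sumr_const; apply: ler_sum => i _.
rewrite -real_normK ?num_real// lerXn2r ?nnegrE//.
by have /mxnorm_leP := hr; apply.
Qed.

Lemma kernN x y : kern (x, y) = kern (y, x).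
Proof.
rewrite /kern /frac_kernel /enorm /=; congr (Num.sqrt _ `^ _).
by apply: eq_bigr => i _; rewrite !mxE; ring.
Qed.

Lemma kern_gt0 x y : x <> y -> 0 < kern (x, y).
Proof.
by move=> xy; apply/powR_gt0/enorm_gt0; rewrite subr_eq0; apply/eqP.
Qed.

Lemma measurable_sqrt : measurable_fun setT (@Num.sqrt R).
Proof. by apply: continuous_measurable_fun; exact: sqrt_continuous. Qed.

Lemma measurable_enorm_sub :
  measurable_fun setT (fun z : T * T => enorm (z.1 - z.2 : 'rV[R]_N)).
Proof.
apply: (measurableT_comp measurable_sqrt).
apply: measurable_sum => i; apply: measurable_funX.
rewrite (_ : (fun _ => _) = fun z : T * T => z.1 0 i - z.2 0 i); last first.
  by apply/funext => z; rewrite !mxE.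
apply: measurable_funB.
- exact: (measurableT_comp (measurable_coord i) measurable_fst).
- exact: (measurableT_comp (measurable_coord i) measurable_snd).
Qed.

Lemma measurable_kern : measurable_fun setT kern.
Proof. exact: (measurableT_comp (measurable_powR _) measurable_enorm_sub). Qed.

Hypothesis s0 : 0 < s.

(** The points must differ because the kernel has value 0, not infinity, on the diagonal. *)
Lemma kern_ge x y r : x <> y -> `|x - y| <= r ->
  (Num.sqrt N%:R * r) `^ (- (N%:R + 2 * s)) <= kern (x, y).
Proof.
move=> xy xyr; rewrite /kern /frac_kernel /= !powRN.
have e0 : 0 < enorm (x - y) by apply: enorm_gt0; rewrite subr_eq0; apply/eqP.
have er := enorm_le xyr.
have q0 : 0 <= N%:R + 2 * s by rewrite addr_ge0// mulr_ge0// ltW.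
by rewrite lef_pV2 ?posrE ?powR_gt0//; [apply: ge0_ler_powR; rewrite ?nnegrE// ltW// (lt_le_trans e0)|exact: lt_le_trans er].
Qed.

Lemma kern_le x y r : 0 < r -> r <= enorm (x - y) ->
  kern (x, y) <= r `^ (- (N%:R + 2 * s)).
Proof.
move=> r0 er; rewrite /kern /frac_kernel /= !powRN.
have q0 : 0 <= N%:R + 2 * s by rewrite addr_ge0// mulr_ge0// ltW.
by rewrite lef_pV2 ?posrE ?powR_gt0//; [apply: ge0_ler_powR; rewrite ?nnegrE// ltW// (lt_le_trans r0)|exact: lt_le_trans er].
Qed.

(** Splitting the kernel into two square roots turns the energy into an L^2 product over pairs of
    points, so its bilinearity and its Cauchy-Schwarz inequality come from [L2_form]. *)
Definition du u (z : T * T) : R := (u z.1 - u z.2) * Num.sqrt (kern z).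

Lemma measurable_du u : measurable_fun setT u -> measurable_fun setT (du u).
Proof.
move=> mu_; apply: measurable_funM.
  by apply: measurable_funB; [exact: measurable_comp_fst|exact: measurable_comp_snd].
exact: (measurableT_comp measurable_sqrt measurable_kern).
Qed.

Lemma du_mul u v z : du u z * du v z = (u z.1 - u z.2) * (v z.1 - v z.2) * kern z.
Proof.
rewrite -[kern z in RHS]sqr_sqrtr ?kern_ge0// /du expr2; ring.
Qed.

(* The functions of X_0^s that vanish everywhere, not only almost everywhere,
   outside Omega. *)
Definition Xz : set (T -> R) := [set u : T -> R | [/\ measurable_fun setT u,
  (forall x, ~ Omega x -> u x = 0), L2 mu u & L2 mu2 (du u)]].

Definition En u v : R := ip mu2 (du u) (du v) / 2.

Lemma du_lin c u d v : du (lin c u d v) = lin c (du u) d (du v).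
Proof. by apply/funext => z; rewrite /du /lin; ring. Qed.

Lemma Xz_lin c u d v : Xz u -> Xz v -> Xz (lin c u d v).
Proof.
move=> [mu_ u0 Lu Ldu] [mv v0 Lv Ldv]; have Ll := L2_lin c d Lu Lv.
split => //; first by case: Ll.
- by move=> x Ox; rewrite /lin u0// v0// !mulr0 addr0.
- by rewrite du_lin; exact: L2_lin.
Qed.

Lemma Xz0 : Xz (cst 0).
Proof.
have L0 d (T' : measurableType d) (m : {measure set T' -> \bar R}) :
    L2 m (cst 0 : T' -> R).
  split => //; apply: eq_integrable (@integrable0 _ _ _ m setT) => // t _.
  by rewrite /= expr0n.
split => //.
by rewrite (_ : du _ = cst 0); [exact: L0|apply/funext => z; rewrite /du subrr mul0r].
Qed.

Lemma En_form : psd_form Xz En.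
Proof.
split; first exact: Xz_lin.
- move=> c u d v w [_ _ _ Lu] [_ _ _ Lv] [_ _ _ Lw].
  by rewrite /En du_lin (psd_linl (L2_form _))//; ring.
- by move=> u v; rewrite /En (psd_sym (L2_form _)).
- by move=> u [_ _ _ Lu]; rewrite /En divr_ge0// (psd_ge0 (L2_form _)).
Qed.

Lemma le_En u v u' v' : Xz u -> Xz v -> Xz u' -> Xz v' ->
  (forall x y, (u x - u y) * (v x - v y) <= (u' x - u' y) * (v' x - v' y)) ->
  En u v <= En u' v'.
Proof.
move=> [_ _ _ ?] [_ _ _ ?] [_ _ _ ?] [_ _ _ ?] h; rewrite ler_pM2r//.
by apply: le_ip => // z; rewrite !du_mul ler_wpM2r ?kern_ge0.
Qed.

(** Positive parts, truncations and the quotient of the maximum principle enter the space this way.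
    Two dominating functions are needed for the quotient, whose increments split into two terms. *)
Lemma Xz_dominated u v w : Xz u -> Xz v -> measurable_fun setT w ->
  (forall x, ~ Omega x -> w x = 0) ->
  (forall x, `|w x| <= `|u x| + `|v x|) ->
  (forall x y, `|w x - w y| <= `|u x - u y| + `|v x - v y|) -> Xz w.
Proof.
move=> [mu_ u0 Lu Ldu] [mv v0 Lv Ldv] mw w0 wuv dwuv.
have abs d (T' : measurableType d) (m : {measure set T' -> \bar R}) f :
    L2 m f -> L2 m (fun t => `|f t|).
  move=> Lf; have [mf _] := Lf; apply: (L2_dominated _ Lf).
    exact: measurableT_comp.
  by move=> t; rewrite normr_id.
split => //.
- apply: (L2_dominated mw (L2_lin 1 1 (abs _ _ _ _ Lu) (abs _ _ _ _ Lv))) => x.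
  by rewrite /lin !mul1r [leRHS]ger0_norm ?addr_ge0.
- apply: (L2_dominated (measurable_du mw) (L2_lin 1 1 (abs _ _ _ _ Ldu) (abs _ _ _ _ Ldv))) => z.
  rewrite /lin !mul1r [leRHS]ger0_norm ?addr_ge0// /du !normrM -mulrDl.
  exact: ler_wpM2r.
Qed.

Definition pos u : T -> R := fun x => Num.max (u x) 0.

Lemma pos_lipschitz (a b : R) : `|Num.max a 0 - Num.max b 0| <= `|a - b|.
Proof.
have [] := leP a 0 => ha; have [] := leP b 0 => hb; rewrite ?subrr ?normr0 ?sub0r ?subr0//.
- by rewrite normrN ler_norml; have := ler_norm (b - a); rewrite distrC; lra.
- by rewrite ler_norml; have := ler_norm (a - b); lra.
Qed.

Lemma Xz_pos u : Xz u -> Xz (pos u).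
Proof.
move=> Xu; have [mu_ u0 _ _] := Xu.
apply: (Xz_dominated Xu Xz0).
- exact: measurable_maxr.
- by move=> x Ox; rewrite /pos u0// maxxx.
- move=> x; rewrite normr0 addr0; have := pos_lipschitz (u x) 0.
  by rewrite maxxx !subr0.
- by move=> x y; rewrite subrr normr0 addr0; exact: pos_lipschitz.
Qed.

Lemma pos_monotone (a b : R) :
  (Num.max a 0 - Num.max b 0) ^+ 2 <= (a - b) * (Num.max a 0 - Num.max b 0).
Proof.
have [] := leP a 0 => ha; have [] := leP b 0 => hb; rewrite ?subrr ?sub0r ?subr0; last by rewrite expr2.
- by rewrite expr0n mulr0.
- by rewrite sqrrN expr2; nra.
- by rewrite expr2; nra.
Qed.

Definition aform (M : R) u v : R := En u v + M * ip mu u v.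

Lemma aform_form (M : R) : 0 <= M -> psd_form Xz (aform M).
Proof.
move=> M0; split; first exact: Xz_lin.
- move=> c u d v w Xu Xv Xw; rewrite /aform (psd_linl En_form)//.
  case: Xu Xv Xw => [_ _ Lu _] [_ _ Lv _] [_ _ Lw _].
  by rewrite (psd_linl (L2_form _))//; ring.
- by move=> u v; rewrite /aform (psd_sym En_form) (psd_sym (L2_form _)).
- move=> u Xu; have [_ _ Lu _] := Xu.
  apply: addr_ge0; first exact: (psd_ge0 En_form).
  by apply: mulr_ge0 => //; exact: (psd_ge0 (L2_form _)).
Qed.

(** The nonlocal energy gives an inequality only: pairs with u(x) > 0 > u(y) contribute more on the
    right. It has the direction that comparison arguments need. *)
Lemma aform_pos (M : R) u : 0 <= M -> Xz u -> aform M (pos u) (pos u) <= aform M u (pos u).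
Proof.
move=> M0 Xu; have Xp := Xz_pos Xu; apply: lerD.
  by apply: le_En => // x y; rewrite -expr2; exact: pos_monotone.
rewrite ler_wpM2l//; case: Xu Xp => [_ _ Lu _] [_ _ Lp _].
apply: le_ip => // x; rewrite /pos; have [] := leP (u x) 0 => // ?; rewrite ?mulr0//.
Qed.

Lemma ip_le_aform (M : R) u : 0 <= M -> Xz u -> M * ip mu u u <= aform M u u.
Proof. by move=> M0 Xu; rewrite lerDr (psd_ge0 En_form). Qed.

Lemma En_le_aform (M : R) u : 0 <= M -> Xz u -> En u u <= aform M u u.
Proof.
by move=> M0 [_ _ Lu _]; rewrite lerDl mulr_ge0// (psd_ge0 (L2_form _)).
Qed.

End fractional_energy.

(** * Integrability of min(1, |z|^2) against the kernel *)

Section kernel_moment.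
Context (R : realType).

Lemma le_nneseries_term (u : nat -> \bar R) k :
  (forall n, 0 <= u n)%E -> (u k <= \sum_(n <oo) u n)%E.
Proof.
move=> u0; rewrite (nneseries_split _ k.+1)// add0n big_nat_recr//=.
apply: (@le_trans _ _ (\sum_(0 <= i < k) u i + u k)%E).
  by rewrite leeDr// sume_ge0.
by rewrite leeDl// nneseries_ge0.
Qed.

Lemma geometric_sum_le (r : R) n : 0 <= r < 1 -> \sum_(0 <= k < n) r ^+ k <= (1 - r)^-1.
Proof.
move=> /andP[r0 r1]; have r1' : 0 < 1 - r by rewrite subr_gt0.
rewrite -(ler_pM2l r1') mulfV ?gt_eqF//.
have -> : (1 - r) * (\sum_(0 <= k < n) r ^+ k) = 1 - r ^+ n.
  elim: n => [|n IH]; first by rewrite big_geq// mulr0 expr0 subrr.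
  by rewrite big_nat_recr//= mulrDr IH exprS; ring.
by rewrite gerBl exprn_ge0.
Qed.

Lemma geometric_nneseries_le (A r : R) : 0 <= A -> 0 <= r < 1 ->
  (\sum_(k <oo) (A * r ^+ k)%:E <= (A / (1 - r))%:E)%E.
Proof.
move=> A0 r01; have /andP[r0 r1] := r01; apply: lime_le.
  by apply: is_cvg_nneseries => n _ _; rewrite lee_fin mulr_ge0// exprn_ge0.
near=> n; rewrite sumEFin lee_fin -mulr_sumr ler_wpM2l//.
exact: geometric_sum_le.
Unshelve. all: by end_near. Qed.

Lemma exp2_unbounded (M : R) : exists k : nat, M < 2 ^+ k.
Proof.
exists (Num.truncn M).+1; apply: lt_trans (truncnS_gt M) _.
by rewrite -natrX ltr_nat ltn_expl.
Qed.

Lemma dyadic_below (r : R) : 0 < r <= 1 ->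
  exists k : nat, 2 `^ (- k.+1%:R) < r <= 2 `^ (- k%:R).
Proof.
move=> /andP[r0 r1].
have E k : (2 `^ (- k%:R) < r) = (r^-1 < 2 ^+ k).
  by rewrite powRN powR_mulrn// invf_plt ?posrE ?exprn_gt0.
have ex : exists k : nat, 2 `^ (- k.+1%:R) < r.
  have [k hk] := exp2_unbounded r^-1; exists k; rewrite E (lt_le_trans hk)//.
  by rewrite exprS ler_peMl ?exprn_ge0// ler1n.
case: (ex_minnP ex) => k hk mink; exists k; rewrite hk /=.
case: k hk mink => [|k] hk mink; first by rewrite oppr0 powRr0.
by rewrite leNgt; apply/negP => /mink; rewrite ltnn.
Qed.

Lemma dyadic_above (r : R) : 1 <= r ->
  exists k : nat, 2 `^ k%:R <= r < 2 `^ k.+1%:R.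
Proof.
move=> r1; have ex : exists k : nat, r < 2 `^ k.+1%:R.
  have [k hk] := exp2_unbounded r; exists k; rewrite powR_mulrn// (lt_le_trans hk)//.
  by rewrite exprS ler_peMl ?exprn_ge0// ler1n.
case: (ex_minnP ex) => k hk mink; exists k; rewrite hk andbT.
case: k hk mink => [|k] hk mink; first by rewrite powRr0.
by rewrite leNgt; apply/negP => /mink; rewrite ltnn.
Qed.

Context (s : R) (N : nat).
Hypothesis s01 : 0 < s < 1.
Local Notation mu := (@lebesgue_rV R N).
Local Notation mu2 := (mu \x mu)%E.
Local Notation T := (lebesgue_space R N).

Definition kap (z : T * T) : R :=
  Num.min 1 (enorm (z.1 - z.2 : 'rV[R]_N) ^+ 2) * kern s z.

Lemma kap_ge0 z : 0 <= kap z.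
Proof. by rewrite mulr_ge0 ?kern_ge0// le_min ler01 sqr_ge0. Qed.

Lemma enormB (x y : 'rV[R]_N) : enorm (x - y) = enorm (y - x).
Proof. by rewrite /enorm; congr Num.sqrt; apply: eq_bigr => i _; rewrite !mxE; ring. Qed.

Lemma kapN (x y : T) : kap (x, y) = kap (y, x).
Proof. by rewrite /kap kernN /= enormB. Qed.

Lemma measurable_kap : measurable_fun setT kap.
Proof.
apply: measurable_funM; last exact: measurable_kern.
by apply: measurable_minr => //; apply: measurable_funX; exact: measurable_enorm_sub.
Qed.

Let s0 : 0 < s. Proof. by case/andP: s01. Qed.
Let q := N%:R + 2 * s.
(** [c k] bounds the integrand on the shell 2^-(k+1) < |x - y| <= 2^-k, and [d k] bounds it on 2^k
    <= |x - y| < 2^(k+1). Shells are Euclidean but are covered by sup norm balls, since the sup norm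
    is the smaller one. *)
Let c (k : nat) := (2 `^ (- k%:R)) ^+ 2 * (2 `^ (- k.+1%:R)) `^ (- q).
Let d (k : nat) := (2 `^ k%:R) `^ (- q).
Let c0 k : 0 <= c k.
Proof. by rewrite mulr_ge0 ?powR_ge0// exprn_ge0// powR_ge0. Qed.
Let d0 k : 0 <= d k. Proof. exact: powR_ge0. Qed.
Let t (x y : T) k : \bar R := ((c k)%:E * (\1_(cball x (2 `^ (- k%:R))) y)%:E +
  (d k)%:E * (\1_(cball x (2 `^ k.+1%:R)) y)%:E)%E.
Let t0 x y k : (0 <= t x y k)%E.
Proof. by rewrite adde_ge0// mule_ge0// lee_fin// indicE. Qed.

Let kap_le_series (x y : T) : ((kap (x, y))%:E <= \sum_(k <oo) t x y k)%E.
Proof.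
have [->|xy] := eqVneq x y.
  rewrite (_ : kap _ = 0); first exact: nneseries_ge0.
  by rewrite /kap /= /kern /frac_kernel /= subrr [X in X `^ _](_ : _ = 0) ?powR0 ?mulr0//;
    [rewrite oppr_eq0 gt_eqF// ltr_wpDl// mulr_gt0
    |rewrite /enorm big1 ?sqrtr0// => i _; rewrite mxE expr0n].
have r0 : 0 < enorm (x - y : 'rV[R]_N) by rewrite enorm_gt0// subr_eq0.
have xyr : `|x - y : 'rV[R]_N| <= enorm (x - y : 'rV[R]_N) by exact: mxnorm_le_enorm.
have [r1|r1] := leP (enorm (x - y : 'rV[R]_N)) 1.
  have [|k /andP[k1 k2]] := @dyadic_below (enorm (x - y : 'rV[R]_N)); first by rewrite r0.
  apply: le_trans (le_nneseries_term k (t0 x y)).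
  apply: (@le_trans _ _ ((c k)%:E * (\1_(cball x (2 `^ (- k%:R))) y)%:E)%E); last first.
    by rewrite /t leeDl// mule_ge0// lee_fin// indicE.
  rewrite indicE mem_set ?mule1 ?lee_fin; last exact: le_trans k2.
  rewrite /kap /= ler_pM ?kern_ge0//.
  - by rewrite le_min ler01 sqr_ge0.
  - by rewrite ge_min lerXn2r ?orbT// ?nnegrE ?powR_ge0// ltW.
  - by apply: kern_le => //; exact: ltW.
have [k /andP[k1 k2]] := @dyadic_above (enorm (x - y : 'rV[R]_N)) (ltW r1).
apply: le_trans (le_nneseries_term k (t0 x y)).
apply: (@le_trans _ _ ((d k)%:E * (\1_(cball x (2 `^ k.+1%:R)) y)%:E)%E); last first.
  by rewrite /t leeDr// mule_ge0// lee_fin// indicE.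
rewrite indicE mem_set; last exact: le_trans xyr (ltW k2).
rewrite mule1 lee_fin /kap /= -[leRHS]mul1r ler_pM ?kern_ge0//.
- by rewrite le_min ler01 sqr_ge0.
- by rewrite ge_min lexx.
- by apply: kern_le; rewrite ?powR_gt0.
Qed.

Let mt x k : measurable_fun setT (fun y => t x y k).
Proof.
have mB (r : R) : 0 <= r -> measurable_fun setT (fun y : T => (\1_(cball x r) y : R)%:E).
  by move=> r0; apply/measurable_EFinP/measurable_indic; have [] := lebesgue_cball_le x r0.
by apply: emeasurable_funD; apply: emeasurable_funM => //; apply: mB; exact: powR_ge0.
Qed.

(** Shell bound times ball volume gives two geometric series: the ratio 2^(2s-2) near the diagonal
    is below 1 since s < 1, the ratio 2^(-2s) at infinity since s > 0. *)
Let integral_t x k : (\int[mu]_y t x y k <=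
  (2 `^ (q + N%:R) * (2 `^ (2 * s - 2)) ^+ k)%:E +
  (2 `^ (2 * N%:R) * (2 `^ (- (2 * s))) ^+ k)%:E)%E.
Proof.
have mB (r : R) : 0 <= r -> measurable_fun setT (fun y : T => (\1_(cball x r) y : R)%:E).
  by move=> r0; apply/measurable_EFinP/measurable_indic; have [] := lebesgue_cball_le x r0.
have piece (e r : R) : 0 <= e -> 0 <= r ->
    (\int[mu]_y (e%:E * (\1_(cball x r) y)%:E) <= (e * (2 * r) ^+ N)%:E)%E.
  move=> e0 r0; have [mb lb] := lebesgue_cball_le x r0.
  rewrite ge0_integralZl//; last exact: mB.
  by rewrite integral_indic// setIT EFinM lee_wpmul2l.
have pos (e r : R) y : 0 <= e -> (0 <= e%:E * (\1_(cball x r) y)%:E)%E.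
  by move=> e0; rewrite mule_ge0// lee_fin// indicE.
have mM (e r : R) : 0 <= r -> measurable_fun setT (fun y => e%:E * (\1_(cball x r) y)%:E)%E.
  by move=> r0; apply: emeasurable_funM => //; exact: mB.
rewrite ge0_integralD//; try by [apply: mM; exact: powR_ge0|move=> y _; exact: pos].
have two0 : (2 : R) != 0 by [].
have pX (a : R) n : (2 `^ a) ^+ n = 2 `^ (a * n%:R).
  by rewrite -powR_mulrn ?powR_ge0// powRrM.
have p2 (a : R) : 2 * 2 `^ a = 2 `^ (1 + a).
  by rewrite powRD ?two0 ?implybT// powRr1.
apply: leeD; apply: (le_trans (piece _ _ _ _)); rewrite ?powR_ge0//.
  rewrite lee_fin /c !p2 !pX -!powRrM -!powRD ?two0 ?implybT//.
  by rewrite le_eqVlt; apply/orP; left; apply/eqP; congr powR; rewrite /q -natr1; ring.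
rewrite lee_fin /d !p2 !pX -!powRrM -!powRD ?two0 ?implybT//.
by rewrite le_eqVlt; apply/orP; left; apply/eqP; congr powR; rewrite /q -natr1; ring.
Qed.

Lemma kap_integral : exists2 C : R, 0 <= C &
  forall x, (\int[mu]_y (kap (x, y))%:E <= C%:E)%E.
Proof.
have lt1 (e : R) : 0 < e -> 0 <= 2 `^ (- e) < 1.
  move=> e0; rewrite powR_ge0 /= powRN invf_lt1 ?powR_gt0//.
  have := @gt0_ltr_powR R e e0 1 2; rewrite powR1 !nnegrE.
  by apply => //; rewrite ltr1n.
have r1 : 0 <= 2 `^ (2 * s - 2) < 1 by rewrite -opprB lt1//; case/andP: s01; lra.
have r2 : 0 <= 2 `^ (- (2 * s)) < 1 by rewrite lt1// mulr_gt0.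
exists (2 `^ (q + N%:R) / (1 - 2 `^ (2 * s - 2)) + 2 `^ (2 * N%:R) / (1 - 2 `^ (- (2 * s)))).
  case/andP: r1 => _ r1; case/andP: r2 => _ r2.
  by rewrite addr_ge0// divr_ge0 ?powR_ge0// subr_ge0 ltW.
move=> x; apply: (@le_trans _ _ (\int[mu]_y \sum_(k <oo) t x y k)%E).
  apply: ge0_le_integral; [exact: measurableT| | | |by move=> y _; exact: kap_le_series].
  - by move=> y _; rewrite lee_fin kap_ge0.
  - by apply/measurable_EFinP; exact: measurable_fun_pair2 measurable_kap.
  - by apply: ge0_emeasurable_sum => //; move=> *; exact: t0.
rewrite integral_nneseries//.
apply: (@le_trans _ _ (\sum_(k <oo) ((2 `^ (q + N%:R) * (2 `^ (2 * s - 2)) ^+ k)%:E +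
  (2 `^ (2 * N%:R) * (2 `^ (- (2 * s))) ^+ k)%:E))%E).
  by apply: lee_nneseries => [k _ _|k _]; [exact: integral_ge0|exact: integral_t].
rewrite nneseriesD; first last.
- by move=> k _; rewrite lee_fin mulr_ge0 ?powR_ge0// exprn_ge0// powR_ge0.
- by move=> k _; rewrite lee_fin mulr_ge0 ?powR_ge0// exprn_ge0// powR_ge0.
by rewrite EFinD; apply: leeD; apply: geometric_nneseries_le => //; exact: powR_ge0.
Qed.

End kernel_moment.

(** * The truncated distance to the complement of Omega *)

Section distance_cutoff.
Context (R : realType) (s : R) (N : nat) (Omega : set 'rV[R]_N).
Local Notation mu := (@lebesgue_rV R N).
Local Notation mu2 := (mu \x mu)%E.
Local Notation T := (lebesgue_space R N).
Implicit Types x y : 'rV[R]_N.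

(** This is min(1, dist(x, complement of Omega)); the element 1 both truncates and keeps the set
    nonempty. *)
Definition cutoff x : R :=
  inf [set r | r = 1 \/ exists2 y, ~ Omega y & r = `|x - y|].

Let cutoff_has_inf x : has_inf [set r | r = 1 \/ exists2 y, ~ Omega y & r = `|x - y|].
Proof. by split; [exists 1; left|exists 0 => _ [->|[y _ ->]]]. Qed.

Lemma cutoff_ge0 x : 0 <= cutoff x.
Proof.
by apply: lb_le_inf; [exists 1; left|move=> _ [->|[y _ ->]]].
Qed.

Lemma cutoff_le1 x : cutoff x <= 1.
Proof. by apply: ge_inf; [have [] := cutoff_has_inf x|left]. Qed.

Lemma cutoff_le x y : ~ Omega y -> cutoff x <= `|x - y|.
Proof. by move=> Oy; apply: ge_inf; [have [] := cutoff_has_inf x|right; exists y]. Qed.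

Lemma cutoff_eq0 x : ~ Omega x -> cutoff x = 0.
Proof.
move=> Ox; apply/le_anti; rewrite cutoff_ge0 andbT.
by rewrite (le_trans (cutoff_le _ Ox))// subrr normr0.
Qed.

Lemma cutoff_lipschitz x y : cutoff x - cutoff y <= `|x - y|.
Proof.
rewrite lerBlDr addrC -lerBlDr; apply: lb_le_inf; first by exists 1; left.
move=> _ [->|[z Oz ->]]; rewrite lerBlDr.
  by rewrite (le_trans (cutoff_le1 x))// lerDl.
rewrite (le_trans (cutoff_le x Oz))// [leRHS]addrC.
by rewrite (_ : x - z = (x - y) + (y - z)) ?ler_normD// subrKA.
Qed.

Lemma cutoff_norm_lipschitz x y : `|cutoff x - cutoff y| <= `|x - y|.
Proof.
by rewrite ler_norml cutoff_lipschitz andbT lerNl opprB distrC cutoff_lipschitz.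
Qed.

Lemma cutoff_gt0 x : open Omega -> Omega x -> 0 < cutoff x.
Proof.
move=> oO Ox; have /nbhs_ballP[e /= e0 be] := open_nbhs_nbhs (conj oO Ox).
apply: (@lt_le_trans _ _ (Num.min 1 e)); first by rewrite lt_min ltr01.
apply: lb_le_inf; first by exists 1; left.
move=> _ [->|[y Oy ->]]; first by rewrite ge_min lexx.
rewrite ge_min; apply/orP; right; rewrite leNgt; apply/negP => h.
by apply: Oy; apply: be; rewrite -ball_normE.
Qed.

Lemma measurable_cutoff : measurable_fun setT (cutoff : T -> R).
Proof.
apply: (measurability (@RGenCInfty.G R)); first exact: RGenCInfty.measurableE.
move=> _ [_ [r ->] <-]; rewrite setTI.
rewrite (_ : _ @^-1` _ = ~` [set x : 'rV[R]_N | cutoff x < r]); last first.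
  apply/seteqP; split => x /=; rewrite in_itv/= andbT leNgt; first by move/negP.
  by move=> /negP.
apply: measurableC; apply: open_lebesgue_measurable; rewrite openE => x /= Ux.
apply/nbhs_ballP; exists (r - cutoff x) => /=; first by rewrite subr_gt0.
move=> y; rewrite -ball_normE /= => h; have := cutoff_lipschitz y x; rewrite distrC.
by lra.
Qed.

Hypothesis s01 : 0 < s < 1.
Hypothesis mO : measurable (Omega : set T).
Hypothesis Of : (mu Omega < +oo)%E.

(** The squared increment is at most min(1, |x - y|^2) and vanishes unless x or y lies in Omega. The
    energy is thus bounded by two integrals of [kap] over strips above Omega, finite by the uniform
    bound [kap_integral]. *)
Lemma Xz_cutoff : Xz s Omega cutoff.
Proof.
split; first exact: measurable_cutoff.
- exact: cutoff_eq0.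
- apply: (L2_dominated measurable_cutoff (L2_indic mO Of)) => x.
  rewrite indicE; have [Ox|Ox] := pselect (Omega x).
    by rewrite mem_set// normr1 ger0_norm ?cutoff_ge0// cutoff_le1.
  by rewrite cutoff_eq0// normr0.
have mdu := measurable_du s measurable_cutoff.
split => //.
have [C C0 kC] := kap_integral N s01.
have mI : measurable_fun setT (fun x : T => (\1_Omega x : R)) by exact: measurable_indic.
have i0 x : 0 <= (\1_Omega x : R) by rewrite indicE.
have k0 := @kap_ge0 R s N.
have mk := @measurable_kap R s N.
have half : (\int[mu]_x \int[mu]_y `|((\1_Omega x : R) * kap s (x, y))%:E| < +oo)%E.
  apply: (@le_lt_trans _ _ (\int[mu]_x ((\1_Omega x : R)%:E * C%:E))%E); last first.
    rewrite ge0_integralZr//; last exact/measurable_EFinP.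
    rewrite integral_indic// setIT; apply: lte_mul_pinfty; rewrite ?ltry ?measure_ge0//.
    by rewrite ge0_fin_numE ?measure_ge0.
  apply: ge0_le_integral; [exact: measurableT| | | |].
  - by move=> x _; exact: integral_ge0.
  - apply: (@measurable_fun_fubini_tonelli_F _ _ _ _ _ _ (fun z : T * T => `|((\1_Omega z.1 : R) * kap s z)%:E|%E)) => //.
    apply: measurableT_comp => //; apply/measurable_EFinP; apply: measurable_funM => //.
    exact: measurable_comp_fst.
  - by apply: emeasurable_funM => //; exact/measurable_EFinP.
  move=> x _; rewrite (eq_integral (fun y : T => (\1_Omega x : R)%:E * (kap s (x, y))%:E)%E); last first.
    by move=> y _; rewrite gee0_abs ?lee_fin 1?mulr_ge0.
  rewrite ge0_integralZl//; first by rewrite lee_wpmul2l.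
    by apply/measurable_EFinP; exact: measurable_fun_pair2 mk.
  by move=> y _; rewrite lee_fin.
have m1 : measurable_fun setT (fun z : T * T => (\1_Omega z.1 : R) * kap s z).
  by apply: measurable_funM => //; exact: measurable_comp_fst.
have m2 : measurable_fun setT (fun z : T * T => (\1_Omega z.2 : R) * kap s z).
  by apply: measurable_funM => //; exact: measurable_comp_snd.
have i1 : mu2.-integrable setT (EFin \o (fun z : T * T => (\1_Omega z.1 : R) * kap s z)).
  by apply/integrable12ltyP; [exact/measurable_EFinP|exact: half].
have i2 : mu2.-integrable setT (EFin \o (fun z : T * T => (\1_Omega z.2 : R) * kap s z)).
  apply/integrable21ltyP; first exact/measurable_EFinP.
  under eq_integral => y _ do under eq_integral => x _ do rewrite /= kapN.
  exact: half.
apply: (integrable_dominated _ (integrable_lin 1 1 i1 i2)).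
  exact: measurable_funX.
move=> z; rewrite /lin !mul1r -mulrDl ger0_norm ?sqr_ge0// expr2 du_mul -expr2.
rewrite /kap [leRHS]mulrA ler_wpM2r ?kern_ge0//.
have h1 : (cutoff z.1 - cutoff z.2) ^+ 2 <= Num.min 1 (enorm (z.1 - z.2 : 'rV[R]_N) ^+ 2).
  rewrite -real_normK ?num_real// le_min; apply/andP; split.
    rewrite expr_le1// ler_norml; have := cutoff_ge0 z.1; have := cutoff_ge0 z.2.
    by have := cutoff_le1 z.1; have := cutoff_le1 z.2; lra.
  rewrite lerXn2r ?nnegrE ?sqrtr_ge0// (le_trans (cutoff_norm_lipschitz _ _))//.
  exact: mxnorm_le_enorm.
have [h2|h2] := pselect (Omega z.1).
  by rewrite !indicE (mem_set h2) (le_trans h1)// ler_peMl ?(le_trans _ h1) ?sqr_ge0// lerDl.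
have [h3|h3] := pselect (Omega z.2).
  by rewrite !indicE (mem_set h3) (le_trans h1)// ler_peMl ?(le_trans _ h1) ?sqr_ge0// lerDr.
rewrite !cutoff_eq0// subrr expr0n /= mulr_ge0 ?addr_ge0//.
by rewrite le_min ler01 sqr_ge0.
Qed.

End distance_cutoff.

(** * Poincare inequality and control by finitely many averages *)

Section poincare.
Context (R : realType) (s : R) (N : nat) (Omega : set 'rV[R]_N).
Local Notation mu := (@lebesgue_rV R N).
Local Notation mu2 := (mu \x mu)%E.
Local Notation T := (lebesgue_space R N).
Implicit Types (u : T -> R) (D : set T).

Lemma Rintegral_sum d (T' : measurableType d) (m : {measure set T' -> \bar R})
    (I : Type) (r : seq I) (F : I -> T' -> R) :
  (forall i, m.-integrable setT (EFin \o F i)) ->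
  m.-integrable setT (EFin \o (fun x => \sum_(i <- r) F i x)) /\
  \int[m]_x (\sum_(i <- r) F i x) = \sum_(i <- r) \int[m]_x F i x.
Proof.
move=> iF; elim: r => [|i r [IH1 IH2]].
  split; last by under eq_Rintegral do rewrite big_nil; rewrite big_nil Rintegral_cst// mul0r.
  by apply: eq_integrable (@integrable0 _ _ _ m setT) => // x _; rewrite /= big_nil.
have E : (fun x => \sum_(j <- i :: r) F j x) =
    lin 1 (F i) 1 (fun x => \sum_(j <- r) F j x).
  by apply/funext => x; rewrite big_cons /lin !mul1r.
by rewrite E; split; [exact: integrable_lin|rewrite Rintegral_lin// IH2 big_cons !mul1r].
Qed.

Hypothesis s0 : 0 < s.

Definition cutset D u : T -> R := fun x => \1_D x * u x.

Lemma L2_cutset D u : measurable D -> L2 mu u -> L2 mu (cutset D u).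
Proof.
move=> mD Lu; have [m_u _] := Lu; apply: (L2_dominated _ Lu).
  by apply: measurable_funM => //; exact: measurable_indic.
by move=> x; rewrite /cutset indicE; case: (_ \in _); rewrite ?mul1r// mul0r normr0.
Qed.

Lemma sqr_ip_indic D u : measurable D -> (mu D < +oo)%E -> L2 mu u ->
  ip mu \1_D u ^+ 2 <= fine (mu D) * ip mu u u.
Proof.
move=> mD Df Lu; have LD := L2_indic mD Df.
by have := psd_CS (L2_form mu) LD Lu; rewrite ip_indic.
Qed.

Let gD D u (z : T * T) := \1_D z.1 * \1_D z.2 * du s u z ^+ 2.

Let integrable_gD D u : measurable D -> Xz s Omega u ->
  mu2.-integrable setT (EFin \o gD D u).
Proof.
move=> mD [m_u _ _ [mdu idu]].
have mI : measurable_fun setT (fun x : T => (\1_D x : R)) by exact: measurable_indic.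
apply: (integrable_dominated _ idu) => [|z].
  apply: measurable_funM; last exact: measurable_funX.
  by apply: measurable_funM; [exact: measurable_comp_fst|exact: measurable_comp_snd].
rewrite /gD !indicE; case: (_ \in _); case: (_ \in _);
  by rewrite ?mul1r ?mul0r ?normr0 ?sqr_ge0// ger0_norm ?sqr_ge0.
Qed.

(* The variance identity on D, with the double integral of (u x - u y)^2
   bounded through a lower bound of the kernel on D * D. *)
Lemma variance_le D u c : measurable D -> (mu D < +oo)%E -> Xz s Omega u ->
  0 < c -> (forall x y, D x -> D y -> x <> y -> c <= kern s (x, y)) ->
  fine (mu D) * ip mu (cutset D u) (cutset D u) <=
  ip mu \1_D u ^+ 2 + c^-1 / 2 * \int[mu2]_z gD D u z.
Proof.
move=> mD Df Xu c0 kc; have [m_u _ Lu _] := Xu.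
have Lw := L2_cutset mD Lu; have LD := L2_indic mD Df.
set w := cutset D u.
have i1 := L2_integrable_prod Lw Lw.
have i2 := L2_integrable_prod LD LD.
have i3 := L2_integrable_prod LD Lu.
have A1 := integrable_prod i1 i2; have A2 := integrable_prod i2 i1.
have A3 := integrable_prod i3 i3.
have P1 := Rintegral_prod i1 i2; have P2 := Rintegral_prod i2 i1.
have P3 := Rintegral_prod i3 i3.
rewrite -ip_indic//.
have iA12 := integrable_lin 1 1 A1 A2; have iA := integrable_lin 1 (-2) iA12 A3.
have iG := integrable_gD mD Xu.
have iZ := @integrable0 _ _ R mu2 setT.
have iG' := integrable_lin c^-1 0 iG iG.
have h : \int[mu2]_z lin 1 (lin 1 (fun z => w z.1 * w z.1 * (\1_D z.2 * \1_D z.2))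
    1 (fun z => \1_D z.1 * \1_D z.1 * (w z.2 * w z.2))) (-2)
    (fun z => \1_D z.1 * u z.1 * (\1_D z.2 * u z.2)) z <=
    \int[mu2]_z lin c^-1 (gD D u) 0 (gD D u) z.
  apply: le_Rintegral => // -[x y] _; rewrite /lin /gD /w /cutset /= mul0r addr0.
  rewrite !indicE; have [Dx|Dx] := boolP (x \in D); have [Dy|Dy] := boolP (y \in D);
    rewrite ?(mul0r, mulr0, mul1r, mulr1, addr0)//.
  have -> : u x * u x + u y * u y + -2 * (u x * u y) = (u x - u y) ^+ 2 by ring.
  rewrite [du _ _ _ ^+ 2]expr2 du_mul -expr2 /=; have [->|xy] := eqVneq x y.
    by rewrite subrr expr0n /= mul0r mulr0.
  rewrite mulrCA ler_peMr ?sqr_ge0// ler_pdivlMl// mulr1.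
  by apply: kc; [exact: set_mem|exact: set_mem|exact/eqP].
move: h; rewrite !Rintegral_lin// P1 P2 P3 /ip => h.
by rewrite expr2; move: h; set a := \int[mu]_x _; set b := \int[mu]_x _; set g := \int[mu2]_z _; set e := \int[mu]_x _; lra.
Qed.

(** Summation of the variance bound over the cells. The squares D_i x D_i are disjoint, so the local
    energies add up to at most the full double integral. *)
Lemma ip_partition_le (I : finType) (D : I -> set T) u c m :
  (forall i, measurable (D i)) -> (forall i, (mu (D i) < +oo)%E) ->
  (forall x, Omega x -> exists i, D i x) ->
  (forall i j x, D i x -> D j x -> i = j) ->
  Xz s Omega u -> 0 < c -> 0 < m ->
  (forall i x y, D i x -> D i y -> x <> y -> c <= kern s (x, y)) ->
  (forall i, m <= fine (mu (D i))) ->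
  ip mu u u <= (c * m)^-1 * En s u u + m^-1 * \sum_i ip mu \1_(D i) u ^+ 2.
Proof.
move=> mD Df cov triv Xu c0 m0 kc Dm; have [m_u u0 Lu Ldu] := Xu.
have h1 : ip mu u u <= \sum_i ip mu (cutset (D i) u) (cutset (D i) u).
  have [iS <-] := Rintegral_sum (index_enum I) (fun i =>
    L2_integrable_prod (L2_cutset (mD i) Lu) (L2_cutset (mD i) Lu)).
  apply: le_Rintegral => //; first exact: L2_integrable_prod.
  move=> x _; have [Ox|Ox] := pselect (Omega x); last first.
    rewrite u0// mul0r sumr_ge0// => i _.
    by rewrite -expr2 sqr_ge0.
  have [i Di] := cov x Ox; rewrite (bigD1 i)//= {1 2}/cutset indicE mem_set// !mul1r.
  by rewrite lerDl sumr_ge0// => j _; rewrite -expr2 sqr_ge0.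
have h2 : \sum_i \int[mu2]_z gD (D i) u z <= 2 * En s u u.
  have [iS <-] := Rintegral_sum (index_enum I) (fun i => integrable_gD (mD i) Xu).
  rewrite /En mulrC divfK// /ip; apply: le_Rintegral => //; first exact: L2_integrable_prod.
  move=> [x y] _ /=; rewrite -expr2 -mulr_suml ler_piMl ?sqr_ge0//.
  have [[i Di]|nD] := pselect (exists i, D i x).
    rewrite (bigD1 i)//= big1 ?addr0 => [|j ji].
      by rewrite !indicE mulr_ile1//; case: (_ \in _).
    rewrite !indicE memNset ?mul0r// => Dj; move/eqP: ji; apply.
    exact: triv Dj Di.
  rewrite big1// => i _; rewrite indicE memNset ?mul0r// => Di.
  by apply: nD; exists i.
apply: (le_trans h1); rewrite invfM.
have h3 i : ip mu (cutset (D i) u) (cutset (D i) u) <=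
    m^-1 * ip mu \1_(D i) u ^+ 2 + c^-1 / 2 * m^-1 * \int[mu2]_z gD (D i) u z.
  have := variance_le (mD i) (Df i) Xu c0 (kc i) => h.
  rewrite -(ler_pM2l m0) mulrDr mulVKf ?gt_eqF//.
  apply: le_trans (_ : _ <= fine (mu (D i)) * ip mu (cutset (D i) u) (cutset (D i) u)) _.
    by rewrite ler_wpM2r// (psd_ge0 (L2_form mu))//; exact: L2_cutset.
  apply: (le_trans h); rewrite lerD2l le_eqVlt; apply/orP; left; apply/eqP.
  by field; rewrite !gt_eqF.
apply: le_trans (ler_sum _ (fun i _ => h3 i)) _.
rewrite big_split /= -!mulr_sumr addrC lerD2r.
apply: (@le_trans _ _ (c^-1 / 2 * m^-1 * (2 * En s u u))).
  by rewrite ler_wpM2l// mulr_ge0 ?divr_ge0 ?invr_ge0// ltW.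
rewrite le_eqVlt; apply/orP; left; apply/eqP; field.
by rewrite !gt_eqF.
Qed.

Variable L : R.
Hypothesis L0 : 0 < L.
Hypothesis OL : forall x, Omega x -> `|x| < L.
Hypothesis N0 : (0 < N)%N.

Let sN0 : 0 < Num.sqrt N%:R :> R. Proof. by rewrite sqrtr_gt0 ltr0n. Qed.

(** The cube [2L, 3L]^N does not meet Omega, so u vanishes on it, and its points are within sup
    distance 4L of Omega. The part of the energy carried by pairs in Omega x cube already dominates
    the L^2 norm. *)
Lemma poincare : exists2 C : R, 0 < C & forall u, Xz s Omega u -> ip mu u u <= C * En s u u.
Proof.
pose l2 : R := 2 * L; pose l3 : R := 3 * L.
pose D : set T := box (Some (const_mx l2, const_mx l3) : option ('rV[R]_N * 'rV[R]_N)).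
have mD : measurable D by exact: box_measurable.
have muD : mu D = (L ^+ N)%:E.
  rewrite lebesgue_box /=; congr EFin; under eq_bigr => i _.
    rewrite !mxE (_ : _ - _ = L); last by rewrite /l2 /l3; ring.
    by rewrite max_r ?ltW//; over.
  by rewrite prodr_const card_ord.
have Df : (mu D < +oo)%E by rewrite muD ltry.
pose k := (Num.sqrt N%:R * (4 * L)) `^ (- (N%:R + 2 * s)).
have k0 : 0 < k by rewrite powR_gt0// mulr_gt0// mulr_gt0.
have ipD : ip mu \1_D \1_D = L ^+ N.
  by apply: (etrans (ip_indic mD Df)); exact: (congr1 fine muD).
have LN : 0 < L ^+ N by rewrite exprn_gt0.
have DO x : D x -> ~ Omega x.
  move=> Dx /OL; have := Dx (Ordinal N0); rewrite !mxE => /andP[h _].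
  apply/negP; rewrite -leNgt; apply: le_trans (coord_le_mxnorm x (Ordinal N0)).
  have Ll2 : L <= l2 by rewrite /l2; move: L0; lra.
  by apply: le_trans (ler_norm _); exact: le_trans h.
exists (2 * (k * L ^+ N)^-1) => [|u Xu]; first by rewrite mulr_gt0// invr_gt0 mulr_gt0.
have [_ u0 Lu Ldu] := Xu.
have i1 := L2_integrable_prod Lu Lu; have LD := L2_indic mD Df.
have i2 := L2_integrable_prod LD LD.
have i3 := L2_integrable_prod Ldu Ldu.
have h : \int[mu2]_z (u z.1 * u z.1 * (\1_D z.2 * \1_D z.2)) <=
    \int[mu2]_z lin k^-1 (fun z => du s u z * du s u z) 0 (fun z => du s u z * du s u z) z.
  apply: le_Rintegral => //; first exact: integrable_prod i1 i2.
    exact: (integrable_lin _ _ i3 i3).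
  move=> [x y] _; rewrite /lin mul0r addr0 /= indicE.
  have [Dy|Dy] := boolP (y \in D); last first.
    by rewrite !mulr0 mulr_ge0 ?invr_ge0 ?(ltW k0)// -expr2 sqr_ge0.
  move/set_mem in Dy; rewrite !mulr1 du_mul /= (u0 y (DO y Dy)) subr0.
  have [Ox|Ox] := pselect (Omega x); last by rewrite u0// !mul0r mulr0.
  rewrite mulrCA ler_peMr -?expr2 ?sqr_ge0// ler_pdivlMl// mulr1 /k.
  apply: kern_ge => //; first by move=> xy; apply: (DO y Dy); rewrite -xy.
  apply/mxnorm_leP => [|i]; first by rewrite mulr_ge0// ltW.
  have := coord_le_mxnorm x i; have := OL Ox; have := Dy i; rewrite !mxE /l2 /l3 => /andP[? ?] ?.
  by rewrite !ler_norml => ?; lra.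
move: h; rewrite (Rintegral_prod i1 i2) (Rintegral_lin _ _ i3 i3).
rewrite mul0r addr0 -/(ip mu u u) -/(ip mu \1_D \1_D) ipD -/(ip mu2 _ _) => h.
rewrite -(ler_pM2r LN); apply: (le_trans h); rewrite /En le_eqVlt; apply/orP; left; apply/eqP.
by field; rewrite !gt_eqF.
Qed.

(** Compactness of the embedding into L^2 in quantitative form: on cubes of side d the variance
    costs a constant times d^(2s) times the energy, which is below [e] for small d, and only the
    finitely many averages are left. *)
Lemma finite_rank (e : R) : 0 < e -> exists (I : finType) (D : I -> set T) (C : R),
  [/\ 0 <= C, (forall i, measurable (D i)), (forall i, (mu (D i) < +oo)%E) &
  forall u, Xz s Omega u ->
    ip mu u u <= e * En s u u + C * \sum_i ip mu \1_(D i) u ^+ 2].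
Proof.
move=> e0; pose q := N%:R + 2 * s.
(* [A * d^(2s)] is the inverse of the kernel bound [(sqrt N * d)^-q] times the volume bound
   [(d/2)^N]; [d0] is the side for which it equals [e]. *)
pose A := Num.sqrt N%:R `^ q * 2 ^+ N.
have A0 : 0 < A by rewrite mulr_gt0// ?powR_gt0// exprn_gt0.
pose d0 := (e / A) `^ (2 * s)^-1.
have d00 : 0 < d0 by rewrite powR_gt0// divr_gt0.
have [n hn] : exists n : nat, 2 * L / d0 < n.+1%:R.
  by exists (Num.truncn (2 * L / d0)); exact: truncnS_gt.
pose d := 2 * L / n.+1%:R.
have nn0 : 0 < n.+1%:R :> R by [].
have d_gt0 : 0 < d by rewrite divr_gt0// mulr_gt0.
have dd0 : d <= d0.
  by rewrite ltW// ltr_pdivrMr// [ltRHS]mulrC -ltr_pdivrMr.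
pose lo (j : {ffun 'I_N -> 'I_n.+1}) i : R := - L + (j i)%:R * d.
pose D j : set T := [set x : 'rV[R]_N | forall i, lo j i <= x 0 i < lo j i + d].
have Sd (k : nat) : k.+1%:R * d = k%:R * d + d by rewrite -natr1 mulrDl mul1r.
have mD j : measurable (D j).
  rewrite (_ : D j = ~` \bigcup_(i in [set: 'I_N])
      ~` (setT `&` (fun x : T => x 0 i) @^-1` `[lo j i, lo j i + d[%classic)); last first.
    apply/seteqP; split => x.
      by move=> Dx [i _]; apply; split => //=; rewrite in_itv /=; exact: Dx.
    move=> nx i; apply: contrapT => h; apply: nx; exists i => //= -[_].
    by rewrite in_itv.
  apply: measurableC; apply: countable_bigcupT_measurable => // i.
  by apply: measurableC; exact: (measurable_coord i measurableT (measurable_itv _)).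
(* The cells are half-open to be disjoint; closed boxes of side d/2 and d bracket their measure. *)
have Dlo j : box (Some (\row_i lo j i, \row_i (lo j i + d / 2))) `<=` D j.
  move=> x bx i; have := bx i; rewrite !mxE => /andP[-> /= h].
  by apply: (le_lt_trans h); rewrite ltrD2l; lra.
have Dhi j : D j `<=` box (Some (\row_i lo j i, \row_i (lo j i + d))).
  by move=> x Dx i; have := Dx i; rewrite !mxE => /andP[-> /= /ltW].
have vol (r : R) j : 0 <= r ->
    mu (box (Some (\row_i lo j i, \row_i (lo j i + r)))) = (r ^+ N)%:E.
  move=> r0; rewrite lebesgue_box /=; congr EFin; under eq_bigr => i _.
    rewrite !mxE (_ : _ + _ - _ = r); last by ring.
    by rewrite max_r//; over.
  by rewrite prodr_const card_ord.
have Df j : (mu (D j) < +oo)%E.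
  apply: (@le_lt_trans _ _ (d ^+ N)%:E); last exact: ltry.
  by rewrite -(vol _ j) ?(ltW d_gt0)//; apply: le_outer_measure; exact: Dhi.
exists _, D, ((d / 2) ^+ N)^-1; split => //.
  by rewrite invr_ge0 exprn_ge0// divr_ge0// ltW.
move=> u Xu; have [_ u0 Lu Ldu] := Xu.
pose c := (Num.sqrt N%:R * d) `^ (- q).
have c0 : 0 < c by rewrite powR_gt0// mulr_gt0.
have m0 : 0 < (d / 2) ^+ N by rewrite exprn_gt0// divr_gt0.
have := @ip_partition_le _ D u c ((d / 2) ^+ N) mD Df _ _ Xu c0 m0 _ _ => h.
apply: le_trans (h _ _ _ _) _.
- move=> x Ox; have idx (i : 'I_N) : (Num.truncn ((x 0 i + L) / d)%R < n.+1)%N.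
    rewrite -(ltr_nat R); apply: (@le_lt_trans _ _ ((x 0 i + L) / d)).
      rewrite truncn_le//.
      have := OL Ox; have := coord_le_mxnorm x i; rewrite ler_norml => /andP[? ?] ?.
      by rewrite divr_ge0 ?(ltW d_gt0)//; lra.
    rewrite ltr_pdivrMr// /d mulrC divfK ?gt_eqF//.
    have := OL Ox; have := coord_le_mxnorm x i; rewrite ler_norml => /andP[? ?] ?.
    by lra.
  exists [ffun i => Ordinal (idx i)] => i; rewrite /lo ffunE /=.
  have xL : 0 <= (x 0 i + L) / d.
    have := OL Ox; have := coord_le_mxnorm x i; rewrite ler_norml => /andP[? ?] ?.
    by rewrite divr_ge0 ?(ltW d_gt0)//; lra.
  have := truncn_itv xL; rewrite ler_pdivlMr// ltr_pdivrMr// Sd.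
  by move: (_%:R * d) => r /andP[? ?]; apply/andP; split; lra.
- move=> j j' x Dj Dj'; apply/ffunP => i; apply/val_inj => /=.
  have tr (k : {ffun 'I_N -> 'I_n.+1}) : D k x -> Num.truncn ((x 0 i + L) / d) = k i :> nat.
    move=> Dk; apply: truncn_def; rewrite ler_pdivlMr// ltr_pdivrMr// Sd.
    have := Dk i; rewrite /lo; move: (_%:R * d) => r /andP[? ?].
    by apply/andP; split; lra.
  by rewrite -(tr j)// -(tr j').
- move=> j x y Dx Dy xy; apply: kern_ge => //; apply/mxnorm_leP => [|i]; first exact: ltW.
  have := Dx i; have := Dy i; rewrite !mxE => /andP[? ?] /andP[? ?].
  by rewrite ler_norml; apply/andP; split; lra.
- move=> j; rewrite -lee_fin fineK; last by rewrite ge0_fin_numE// measure_ge0.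
  have d20 : 0 <= d / 2 by rewrite divr_ge0// ltW.
  by rewrite -(vol _ j d20); apply: le_outer_measure; exact: Dlo.
rewrite lerD2r ler_wpM2r ?(psd_ge0 (En_form s Omega))//.
have dN : d ^+ N = d `^ N%:R by rewrite powR_mulrn// ltW.
have -> : (c * (d / 2) ^+ N)^-1 = A * d `^ (2 * s).
  rewrite /c powRN invfM invrK powRM ?(ltW sN0) ?(ltW d_gt0)// exprMn dN invfM exprVn invrK.
  have -> : d `^ q = d `^ N%:R * d `^ (2 * s).
    by rewrite /q powRD// (gt_eqF d_gt0) implybT.
  have dN0 : d `^ N%:R != 0 by rewrite gt_eqF// powR_gt0.
  rewrite /A; move: (d `^ N%:R) dN0 (d `^ (2 * s)) (_ `^ q) (2 ^+ N) => a a0 b c' f.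
  by field.
rewrite mulrC -ler_pdivlMr//.
have s20 : 0 < 2 * s by rewrite mulr_gt0.
have -> : e / A = d0 `^ (2 * s).
  by rewrite /d0 -powRrM mulVf ?gt_eqF// powRr1// ltW// divr_gt0.
by apply: (ge0_ler_powR (ltW s20)) => //; rewrite nnegrE ltW.
Qed.

End poincare.

(** * Fatou, almost everywhere limits and completeness of L^2 *)

Section L2_limits.
Context d (T : measurableType d) (R : realType) (m : {measure set T -> \bar R}).
Implicit Types (f : nat -> T -> R) (g : T -> R).

Lemma fatou_L2 f g (C : R) : (forall n, L2 m (f n)) ->
  (forall n, ip m (f n) (f n) <= C) -> measurable_fun setT g ->
  {ae m, forall x, f^~ x @ \oo --> g x} -> L2 m g /\ ip m g g <= C.
Proof.
move=> Lf fC mg fg.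
pose F n x := ((f n x) ^+ 2)%:E.
have mF n : measurable_fun setT (F n).
  by apply/measurable_EFinP; apply: measurable_funX; case: (Lf n).
have F0 n x : setT x -> (0 <= F n x)%E by rewrite lee_fin sqr_ge0.
have := fatou m measurableT mF F0.
have mg2 : measurable_fun setT (fun x => (g x ^+ 2)%:E).
  by apply/measurable_EFinP; exact: measurable_funX.
have -> : (\int[m]_x limn_einf (F^~ x) = \int[m]_x (g x ^+ 2)%:E)%E.
  apply: ge0_ae_eq_integral => //.
  - rewrite (_ : (fun x => _) = fun x => (- limn_esup (fun n => - F n x))%E); last first.
      by apply/funext => x; rewrite -[X in limn_esup X]/(-%E \o (F^~ x)) limn_esupN oppeK.
    apply: measurableT_comp => //; apply: measurable_fun_limn_esup => n.
    exact: measurableT_comp.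
  - move=> x _; rewrite limn_einf_lim; apply: lime_ge; first exact: is_cvg_einfs.
    by near=> n; apply: le_ereal_inf_tmp => _ [k _ <-]; rewrite lee_fin sqr_ge0.
  - by move=> x _; rewrite lee_fin sqr_ge0.
  apply: filterS fg => x fx _; apply: (cvg_limn_einf_sup _).1.
  apply/fine_cvgP; split; first by near=> n.
  rewrite [X in X @ _ --> _](_ : _ = fun n => f n x * f n x).
    by rewrite expr2; exact: cvgM.
  by apply/funext => n; rewrite /= expr2.
move=> h; have {}h : (\int[m]_x (g x ^+ 2)%:E <= C%:E)%E.
  apply: (le_trans h); rewrite limn_einf_lim; apply: lime_le; first exact: is_cvg_einfs.
  near=> n; apply: ge_ereal_inf; exists (\int[m]_x F n x)%E; first by exists n => /=.
  by rewrite ipE// lee_fin.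
have Lg : L2 m g.
  split => //; apply/integrableP; split => //.
  under eq_integral do rewrite gee0_abs ?lee_fin ?sqr_ge0//.
  by rewrite (le_lt_trans h)// ltry.
by split => //; rewrite -lee_fin -ipE.
Unshelve. all: by end_near. Qed.

(** The rate 16^-n leaves room for a weight 4^n: the weighted sum of the squared increments has
    finite integral, hence is finite almost everywhere, and there the increments are O(2^-n) and the
    sequence converges. *)
Lemma ae_limit f (C : R) : (forall n, L2 m (f n)) ->
  (forall n, ip m (lin 1 (f n.+1) (-1) (f n)) (lin 1 (f n.+1) (-1) (f n))
     <= C * 16^-1 ^+ n) ->
  exists g, [/\ measurable_fun setT g, {ae m, forall x, f^~ x @ \oo --> g x} &
    forall x, (forall n, f n x = 0) -> g x = 0].
Proof.
move=> Lf fC; pose df n := lin 1 (f n.+1) (-1) (f n).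
have Ld n : L2 m (df n) by exact: L2_lin.
pose S x := (\sum_(n <oo) (4 ^+ n * df n x ^+ 2)%:E)%E.
have mt n : measurable_fun setT (fun x => (4 ^+ n * df n x ^+ 2)%:E).
  apply/measurable_EFinP; apply: measurable_funM => //.
  by apply: measurable_funX; case: (Ld n).
have t0 n x : (0 <= (4 ^+ n * df n x ^+ 2)%:E)%E.
  by rewrite lee_fin mulr_ge0 ?sqr_ge0 ?exprn_ge0.
have C0 : 0 <= C.
  have := le_trans (psd_ge0 (L2_form m) (Ld 0%N)) (fC 0%N).
  by rewrite expr0 mulr1.
have S_lty : (\int[m]_x `|S x| < +oo)%E.
  under eq_integral do rewrite gee0_abs ?nneseries_ge0//.
  rewrite integral_nneseries//.
  apply: (@le_lt_trans _ _ (\sum_(n <oo) (C * 4^-1 ^+ n)%:E)%E).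
    apply: lee_nneseries => [n _ _|n _]; first exact: integral_ge0.
    under eq_integral do rewrite EFinM.
    have md : measurable_fun setT (fun x => (df n x ^+ 2)%:E).
      by apply/measurable_EFinP; apply: measurable_funX; case: (Ld n).
    rewrite ge0_integralZl//; try by [rewrite lee_fin exprn_ge0|move=> x _; rewrite lee_fin sqr_ge0].
    rewrite ipE// -EFinM lee_fin; apply: (@le_trans _ _ (4 ^+ n * (C * 16^-1 ^+ n))).
      by apply: ler_wpM2l; [exact: exprn_ge0|exact: fC].
    by rewrite mulrCA -exprMn (_ : 4 * 16^-1 = 4^-1 :> R)//; field.
  apply: le_lt_trans (geometric_nneseries_le C0 _) _; last exact: ltry.
  by apply/andP; split; lra.
have Sfin : {ae m, forall x, S x \is a fin_num}.
  have iS : m.-integrable setT S.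
    apply/integrableP; split => //.
    by apply: ge0_emeasurable_sum => // n x _ _; exact: t0.
  by apply: filterS (integrable_ae measurableT iS) => x /(_ I).
(* The upper limit is measurable, is defined at every point, and is exactly 0 where all [f n]
   vanish, as [Xz] requires outside Omega. *)
exists (fun x => fine (limn_esup (fun n => (f n x)%:E))); split.
- apply: (measurableT_comp (f := fine)) => //.
  by apply: measurable_fun_limn_esup => n; apply/measurable_EFinP; case: (Lf n).
- apply: filterS Sfin => x Sx.
  have dfS n : `|df n x| <= Num.sqrt (fine (S x)) * 2^-1 ^+ n.
    have h : df n x ^+ 2 <= fine (S x) * 4^-1 ^+ n.
      rewrite exprVn -ler_pdivrMr ?invr_gt0 ?exprn_gt0// invrK mulrC.
      by rewrite -lee_fin fineK//; exact: (le_nneseries_term n (t0^~ x)).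
    have S0 : 0 <= fine (S x) by rewrite fine_ge0// nneseries_ge0.
    rewrite -sqrtr_sqr; apply: le_trans (ler_wsqrtr h) _.
    rewrite sqrtrM// ler_wpM2l ?sqrtr_ge0//.
    have -> : 4^-1 ^+ n = (2^-1 ^+ n) ^+ 2 :> R.
      by rewrite -exprM mulnC exprM (_ : 2^-1 ^+ 2 = 4^-1)// expr2 -invfM -natrM.
    by rewrite sqrtr_sqr ger0_norm// exprn_ge0.
  have cd : cvgn (series (df^~ x)).
    apply: normed_cvg; apply: (series_le_cvg _ _ dfS).
    - by move=> n; exact: normr_ge0.
    - by move=> n; apply: mulr_ge0; [exact: sqrtr_ge0|exact: exprn_ge0].
    by apply: (@is_cvg_geometric_series R); rewrite ger0_norm//; lra.
  have cf : cvgn (f^~ x).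
    have -> : f^~ x = fun n => f 0%N x + series (df^~ x) n.
      apply/funext; elim=> [|n IH]; first by rewrite /series /= big_geq ?addr0.
      rewrite /series /= big_nat_recr//= addrA -[_ + \sum_(0 <= k < n) _]IH.
      by rewrite /df /lin; ring.
    by apply: is_cvgD => //; exact: is_cvg_cst.
  have fl : f^~ x @ \oo --> (limn (f^~ x) : R) := cf.
  have h : ((f n x)%:E @[n --> \oo] --> (limn (f^~ x) : R)%:E)%classic.
    by apply/fine_cvgP; split => //; near=> n.
  by rewrite (cvg_limn_einf_sup h).2.
- move=> x f0; have h : ((f n x)%:E @[n --> \oo] --> (0 : R)%:E)%classic.
    by under eq_fun do rewrite f0; exact: cvg_cst.
  by rewrite (cvg_limn_einf_sup h).2.
Unshelve. all: by end_near. Qed.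

Lemma L2_complete f (C : R) : (forall n, L2 m (f n)) ->
  (forall n k, (n <= k)%N ->
    ip m (lin 1 (f k) (-1) (f n)) (lin 1 (f k) (-1) (f n)) <= C * 16^-1 ^+ n) ->
  exists g, [/\ L2 m g, {ae m, forall x, f^~ x @ \oo --> g x},
    forall x, (forall n, f n x = 0) -> g x = 0 &
    forall n, ip m (lin 1 g (-1) (f n)) (lin 1 g (-1) (f n)) <= C * 16^-1 ^+ n].
Proof.
move=> Lf fC; have [g [mg fg g0]] := ae_limit Lf (fun n => fC n n.+1 (leqnSn n)).
have dist n : L2 m (lin 1 g (-1) (f n)) /\
    ip m (lin 1 g (-1) (f n)) (lin 1 g (-1) (f n)) <= C * 16^-1 ^+ n.
  apply: (@fatou_L2 (fun k => lin 1 (f (n + k)%N) (-1) (f n))).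
  - by move=> k; exact: L2_lin.
  - by move=> k; apply: fC; exact: leq_addr.
  - have [mf _] := Lf n.
    by apply: measurable_funD; apply: measurable_funM => //; exact: measurable_cst.
  apply: filterS fg => x fx; rewrite /lin; apply: cvgD; last exact: cvg_cst.
  apply: cvgM; first exact: cvg_cst.
  by rewrite -(cvg_shiftn n) in fx; under eq_fun do rewrite addnC.
exists g; split => //; last by move=> n; have [] := dist n.
have -> : g = lin 1 (lin 1 g (-1) (f 0%N)) 1 (f 0%N).
  by apply/funext => x; rewrite /lin; ring.
by apply: L2_lin => //; have [] := dist 0%N.
Qed.

End L2_limits.

(** * Completeness of the energy space and Riesz representation *)

Section energy_completeness.
Context (R : realType) (s : R) (N : nat) (Omega : set 'rV[R]_N).
Local Notation mu := (@lebesgue_rV R N).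
Local Notation mu2 := (mu \x mu)%E.
Local Notation T := (lebesgue_space R N).
Local Notation Xz := (Xz s Omega).
Implicit Types (u v z : T -> R) (M C : R).

Lemma pow16_null (x C : R) : (forall n, x <= C * 16^-1 ^+ n) -> x <= 0.
Proof.
move=> h; rewrite leNgt; apply/negP => x0.
have [n hn] := exp2_unbounded (C / x).
have := h n; rewrite exprVn ler_pdivlMr ?exprn_gt0// leNgt => /negP; apply.
rewrite mulrC -ltr_pdivrMr// (lt_le_trans hn)// lerXn2r ?nnegrE//.
by rewrite ler_nat.
Qed.

(** Fatou is applied separately to the double integral and to the L^2 part; each contributes at most
    16^-n, whence the factor 2. *)
Lemma Xz_complete M (z : nat -> T -> R) : 0 < M -> (forall n, Xz (z n)) ->
  (forall n k, (n <= k)%N ->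
    aform s M (lin 1 (z k) (-1) (z n)) (lin 1 (z k) (-1) (z n)) <= 16^-1 ^+ n) ->
  exists2 w, Xz w & forall n,
    aform s M (lin 1 w (-1) (z n)) (lin 1 w (-1) (z n)) <= 2 * 16^-1 ^+ n.
Proof.
move=> M0 Xzn zC.
have Lz n : L2 mu (z n) by case: (Xzn n).
have Lzl n k : Xz (lin 1 (z k) (-1) (z n)) by exact: Xz_lin.
have b1 n k : (n <= k)%N ->
    ip mu (lin 1 (z k) (-1) (z n)) (lin 1 (z k) (-1) (z n)) <= M^-1 * 16^-1 ^+ n.
  move=> nk; rewrite ler_pdivlMl//; apply: le_trans (zC n k nk).
  exact: ip_le_aform (ltW M0) (Lzl n k).
have [w [Lw zw w0 wC]] := L2_complete Lz b1.
have mw : measurable_fun setT w by case: Lw.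
have dw n : L2 mu2 (du s (lin 1 w (-1) (z n))) /\
    ip mu2 (du s (lin 1 w (-1) (z n))) (du s (lin 1 w (-1) (z n))) <= 2 * 16^-1 ^+ n.
  apply: (@fatou_L2 _ _ _ _ (fun k => du s (lin 1 (z (n + k)%N) (-1) (z n)))).
  - by move=> k; case: (Lzl n (n + k)%N).
  - move=> k; have := le_trans (En_le_aform (ltW M0) (Lzl n (n + k)%N)) (zC _ _ (leq_addr k n)).
    by rewrite /En ler_pdivrMr// mulrC.
  - apply: measurable_du; have [mz _] := Lz n.
    by apply: measurable_funD; apply: measurable_funM => //; exact: measurable_cst.
  have c1 := ae_prod1 mu zw; have c2 := ae_prod2 mu zw.
  apply: filterS2 c1 c2 => -[x y] /= zx zy.
  rewrite /du /lin /=.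
  have sh (t : T) : z^~ t @ \oo --> w t -> z (n + k)%N t @[k --> \oo] --> w t.
    by rewrite -(cvg_shiftn n) => zt; under eq_fun do rewrite addnC.
  apply: cvgM; last exact: cvg_cst.
  by apply: cvgB; (apply: cvgD; last exact: cvg_cst); apply: cvgM; try exact: cvg_cst; exact: sh.
have Xl n : Xz (lin 1 w (-1) (z n)).
  have [mz zO Lzn _] := Xzn n; split.
  - by apply: measurable_funD; apply: measurable_funM => //; exact: measurable_cst.
  - move=> x Ox; rewrite /lin (zO x Ox) w0 ?mulr0 ?addr0// => k.
    by have [_ zk _ _] := Xzn k; exact: zk.
  - exact: L2_lin.
  - by have [] := dw n.
exists w.
  have -> : w = lin 1 (lin 1 w (-1) (z 0%N)) 1 (z 0%N).
    by apply/funext => x; rewrite /lin; ring.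
  exact: Xz_lin.
move=> n; rewrite /aform mulrDl mul1r; apply: lerD.
  by rewrite /En ler_pdivrMr// mulrC; have [] := dw n.
by rewrite -ler_pdivlMl//; exact: wC.
Qed.

(* The minimizing sequences of z |-> a(z,z) - 2 <g,z> are Cauchy by the
   parallelogram identity. *)
Lemma riesz M g : 0 < M -> L2 mu g ->
  exists2 z, Xz z & forall phi, Xz phi -> aform s M z phi = ip mu g phi.
Proof.
move=> M0 Lg; have aF := aform_form s Omega (ltW M0); have LF := L2_form mu.
have XL z : Xz z -> L2 mu z by case.
pose F z := aform s M z z - 2 * ip mu g z.
pose S := [set r | exists2 z, Xz z & r = F z].
have F_lb z : Xz z -> - (M^-1 * ip mu g g) <= F z.
  move=> Xzz; have := psd_young LF M0 (XL _ Xzz) Lg; rewrite (psd_sym LF z g).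
  have := ip_le_aform (ltW M0) Xzz; rewrite /F.
  by move: (ip mu g z) (aform _ _ _ _) (M * _) (M^-1 * _) => a b c d; lra.
have S_inf : has_inf S.
  split; first by exists (F (cst 0)), (cst 0) => //; exact: Xz0.
  by exists (- (M^-1 * ip mu g g)) => _ [z Xzz ->]; exact: F_lb.
(* With this tolerance the parallelogram identity bounds the squared distance of [z k] and [z n] by
   (16^-k + 16^-n) / 2, which is at most 16^-n for n <= k. *)
have e0 n : 0 < 16^-1 ^+ n / 4 :> R by rewrite divr_gt0 ?exprn_gt0.
have ex n : exists z, Xz z /\ F z < inf S + 16^-1 ^+ n / 4.
  by have [_ [z Xzz ->] Fz] := inf_adherent (e0 n) S_inf; exists z.
have [z hz] := choice ex.
have Xzn n : Xz (z n) by have [] := hz n.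
have zF n : F (z n) < inf S + 16^-1 ^+ n / 4 by have [] := hz n.
have infF w : Xz w -> inf S <= F w.
  by move=> Xw; apply: ge_inf; [have [] := S_inf|exists w].
have Flin c u e v : Xz u -> Xz v -> F (lin c u e v) = c ^+ 2 * aform s M u u +
    2 * c * e * aform s M u v + e ^+ 2 * aform s M v v - 2 * (c * ip mu g u + e * ip mu g v).
  move=> Xu Xv; rewrite /F (psd_quad aF)// (psd_linr LF)//; exact: XL.
have zC n k : (n <= k)%N ->
    aform s M (lin 1 (z k) (-1) (z n)) (lin 1 (z k) (-1) (z n)) <= 16^-1 ^+ n.
  move=> nk; rewrite (psd_quad aF)//.
  have := infF _ (Xz_lin 2^-1 2^-1 (Xzn k) (Xzn n)); rewrite Flin//.
  have := zF n; have := zF k; rewrite /F.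
  have : 16^-1 ^+ k <= 16^-1 ^+ n :> R.
    by apply: ler_wiXn2l => //; lra.
  move: (aform s M (z k) (z k)) (aform s M (z n) (z n)) (aform s M (z k) (z n)) => A B D.
  move: (ip mu g (z k)) (ip mu g (z n)) (inf S) (16^-1 ^+ k) (16^-1 ^+ n) => a b i p q.
  by lra.
have [w Xw wC] := Xz_complete M0 Xzn zC.
exists w => // phi Xphi; apply/eqP; rewrite -subr_eq0 -sqrf_eq0 eq_le sqr_ge0 andbT.
pose A := aform s M phi phi + 1.
have A0 : 0 < A by rewrite /A ltr_wpDl// (psd_ge0 aF).
apply: (@pow16_null _ (6 * A)) => n.
have h1 : (aform s M w phi - aform s M (z n) phi) ^+ 2 <= 2 * 16^-1 ^+ n * A.
  have -> : aform s M w phi - aform s M (z n) phi = aform s M (lin 1 w (-1) (z n)) phi.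
    by rewrite (psd_linl aF)//; ring.
  have Xl := Xz_lin 1 (-1) Xw (Xzn n).
  apply: le_trans (psd_CS aF Xl Xphi) _.
  by apply: ler_pM; rewrite ?(psd_ge0 aF)// /A lerDl.
have h2 : (aform s M (z n) phi - ip mu g phi) ^+ 2 <= 16^-1 ^+ n * A.
  have q0 := e0 n.
  (* Moving from [z n] to [z n + t phi] changes F by at most 2 t D + t^2 A. This t minimizes the
     bound, and near minimality of [z n] then makes D^2 of order 16^-n. *)
  set D := _ - _; pose t := - D / A.
  have := infF _ (Xz_lin 1 t (Xzn n) Xphi); rewrite Flin//.
  have := zF n; rewrite /F => h3 h4.
  have tA : t * A = - D by rewrite /t divfK ?gt_eqF.
  have h5 : t ^+ 2 * aform s M phi phi <= t ^+ 2 * A.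
    by rewrite ler_wpM2l ?sqr_ge0// /A lerDl.
  have h6 : t ^+ 2 * A = - t * D by rewrite expr2 -mulrA tA; ring.
  have h7 : 0 <= 2 * t * D - t * D + 16^-1 ^+ n / 4.
    move: h3 h4 h5; rewrite h6 /D.
    move: (aform s M (z n) (z n)) (aform s M (z n) phi) (ip mu g (z n)) (ip mu g phi) (inf S) => a1 a2 a3 a4 a5.
    move: (_ / 4) (t ^+ 2 * _) => q b; nra.
  have h8 : D ^+ 2 = - t * D * A by rewrite !mulNr mulrAC tA; ring.
  rewrite h8 ler_wpM2r ?(ltW A0)//.
  have q1 : 0 < 16^-1 ^+ n :> R by rewrite exprn_gt0.
  by move: h7 q1; move: (16^-1 ^+ n) (t) => q t'; lra.
move: h1 h2; move: (aform s M w phi) (aform s M (z n) phi) (ip mu g phi) => a b c h1 h2.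
have : (a - c) ^+ 2 <= 2 * (a - b) ^+ 2 + 2 * (b - c) ^+ 2.
  by have := sqr_ge0 (a + c - 2 * b); rewrite !expr2; lra.
move: h1 h2; move: ((a - b) ^+ 2) ((b - c) ^+ 2) ((a - c) ^+ 2) => x y x'.
by rewrite -!mulrA (mulrC A) ; move: (_ * A) => r; lra.
Qed.

End energy_completeness.

(** * Compactness of energy-bounded sequences in L^2 *)

Section compactness.
Context (R : realType) (s : R) (N : nat) (Omega : set 'rV[R]_N).
Local Notation mu := (@lebesgue_rV R N).
Local Notation T := (lebesgue_space R N).
Local Notation Xz := (Xz s Omega).

(** Along an ultrafilter every bounded real sequence converges. All averages, for all cell sizes,
    thus converge along the same ultrafilter, without diagonal extraction. *)
Lemma ultra_bounded_cluster (U : set_system nat) (x : nat -> R) (K : R) :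
  UltraFilter U -> (forall n, `|x n| <= K) ->
  exists c : R, forall e : R, 0 < e -> U [set n | `|x n - c| < e].
Proof.
move=> uU xK; have pU : ProperFilter U by exact: ultra_proper.
have UK : U (x @^-1` `[- K, K]%classic).
  by apply: filterS filterT => n _ /=; rewrite in_itv /= -ler_norml; exact: xK.
have [c [_ cl]] := @segment_compact R (- K) K (x @ U) (fmap_proper_filter x pU) UK.
exists c => e e0; have [//|nU] := in_ultra_setVsetC [set n | `|x n - c| < e] uU.
have V : U (x @^-1` [set x n | n in ~` [set n | `|x n - c| < e]]).
  by apply: filterS nU => n nn; exists n.
have [_ [[n nc <-] h]] := cl _ _ V (nbhsx_ballx (c : R) e e0).
by case: nc; move: h; rewrite -ball_normE /= distrC.
Qed.

Lemma filter_all (T' : Type) (F : set_system T') (I : eqType) (r : seq I) (A : I -> set T') :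
  Filter F -> (forall i, F (A i)) -> F [set x | forall i, i \in r -> A i x].
Proof.
move=> FF FA; elim: r => [|i r IH]; first by apply: filterS filterT.
apply: filterS2 (FA i) IH => x Ax rx j; rewrite in_cons => /orP[/eqP ->//|].
exact: rx.
Qed.

Hypothesis s0 : 0 < s.
Variable L : R.
Hypothesis L0 : 0 < L.
Hypothesis OL : forall x, Omega x -> `|x| < L.
Hypothesis N0 : (0 < N)%N.

Lemma ultra_cauchy (U : set_system nat) (u : nat -> T -> R) (B e : R) :
  UltraFilter U -> (forall n, Xz (u n)) -> (forall n, En s (u n) (u n) <= B) ->
  0 < e -> exists2 A, U A & forall n k, A n -> A k ->
    ip mu (lin 1 (u k) (-1) (u n)) (lin 1 (u k) (-1) (u n)) <= e.
Proof.
move=> uU Xu uB e0; have pU : ProperFilter U by exact: ultra_proper.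
have B0 : 0 <= B by apply: le_trans (uB 0%N); exact: psd_ge0 (En_form s Omega) _ (Xu _).
have Lu n : L2 mu (u n) by case: (Xu n).
have [Cp Cp0 CpP] := poincare s0 L0 OL N0.
have e1 : 0 < e / 2 / (4 * B + 1) by rewrite !divr_gt0// ltr_wpDl// mulr_ge0.
have [I [D [C [C0 mD Df h]]]] := finite_rank s0 L0 OL N0 e1.
(* Averages within [sqrt d] of their limit differ by at most [2 * sqrt d], so the finite rank term
   is at most 4 C |I| d <= e/2. The other half of e is left to the energy term, through [e1] and the
   bound 4 B on the energy of a difference. *)
pose d := e / (8 * (C * #|I|%:R + 1)).
have CI0 : 0 <= C * #|I|%:R by rewrite mulr_ge0.
have d0 : 0 < d by rewrite divr_gt0// mulr_gt0// ltr_wpDl.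
have bx i n : `|ip mu \1_(D i) (u n)| <= Num.sqrt (fine (mu (D i)) * (Cp * B)).
  rewrite -sqrtr_sqr ler_wsqrtr//; apply: le_trans (sqr_ip_indic (mD i) (Df i) (Lu n)) _.
  rewrite ler_wpM2l// ?fine_ge0 ?measure_ge0//; apply: le_trans (CpP _ (Xu n)) _.
  by rewrite ler_wpM2l// ltW.
have /choice[c hc] : forall i, exists c : R, forall e : R, 0 < e ->
    U [set n | `|ip mu \1_(D i) (u n) - c| < e].
  by move=> i; exact: ultra_bounded_cluster uU (bx i).
exists [set n | forall i, i \in enum I -> `|ip mu \1_(D i) (u n) - c i| < Num.sqrt d].
  apply: (@filter_all _ _ _ _ (fun i => [set n | `|ip mu \1_(D i) (u n) - c i| < Num.sqrt d])) => i.
  by apply: hc; rewrite sqrtr_gt0.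
move=> n k An Ak; have Xl := Xz_lin 1 (-1) (Xu k) (Xu n).
apply: le_trans (h _ Xl) _.
have En4 : En s (lin 1 (u k) (-1) (u n)) (lin 1 (u k) (-1) (u n)) <= 4 * B + 1.
  apply: le_trans (psd_sub_le (En_form s Omega) (Xu k) (Xu n)) _.
  by have := uB k; have := uB n; lra.
have S4 : \sum_i ip mu \1_(D i) (lin 1 (u k) (-1) (u n)) ^+ 2 <= #|I|%:R * (4 * d).
  rewrite mulr_natl -sumr_const; apply: ler_sum => i _.
  rewrite (psd_linr (L2_form mu))//; last exact: (L2_indic (mD i) (Df i)).
  have := An i (mem_enum _ i); have := Ak i (mem_enum _ i); rewrite !ltr_norml.
  have q0 : 0 <= Num.sqrt d by rewrite sqrtr_ge0.
  have -> : 4 * d = (2 * Num.sqrt d) ^+ 2 by rewrite exprMn sqr_sqrtr ?ltW//; ring.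
  move: (Num.sqrt d) q0 (ip _ _ _) (ip _ _ _) (c i) => q q0 a b c' /andP[? ?] /andP[? ?].
  rewrite -real_normK ?num_real// lerXn2r// ?nnegrE//; first by rewrite mulr_ge0.
  by rewrite ler_norml; apply/andP; split; lra.
have t1 : e / 2 / (4 * B + 1) * En s (lin 1 (u k) (-1) (u n)) (lin 1 (u k) (-1) (u n)) <= e / 2.
  apply: (@le_trans _ _ (e / 2 / (4 * B + 1) * (4 * B + 1))); first by rewrite ler_wpM2l// ltW.
  by rewrite divfK// gt_eqF// ltr_wpDl// mulr_ge0.
have t2 : C * \sum_i ip mu \1_(D i) (lin 1 (u k) (-1) (u n)) ^+ 2 <= e / 2.
  apply: le_trans (ler_wpM2l C0 S4) _; rewrite (mulrA C).
  have -> : e / 2 = (C * #|I|%:R + 1) * (4 * d).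
    by rewrite /d; field; rewrite gt_eqF// ltr_wpDl.
  by apply: ler_wpM2r; [rewrite mulr_ge0// ltW|rewrite lerDl].
by move: t1 t2; move: (_ * En _ _ _) (C * _) => a b; lra.
Qed.

(** An index in the first n+1 sets of the ultrafilter is picked at each stage, which gives a fast
    Cauchy subsequence. The cluster point is claimed in L^2 only; finite energy will be recovered by
    applying S to it. *)
Lemma energy_compact (u : nat -> T -> R) (B : R) :
  (forall n, Xz (u n)) -> (forall n, En s (u n) (u n) <= B) ->
  exists w, [/\ L2 mu w, (forall x, ~ Omega x -> w x = 0) &
    forall e, 0 < e -> forall n0, exists2 n, (n0 <= n)%N &
      ip mu (lin 1 (u n) (-1) w) (lin 1 (u n) (-1) w) <= e].
Proof.
move=> Xu uB; have [U [uU ooU]] := ultraFilterLemma (eventually_filter : ProperFilter eventually).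
have pU : ProperFilter U by exact: ultra_proper.
have e0 n : 0 < 16^-1 ^+ n :> R by rewrite exprn_gt0.
have Ae n : exists A, U A /\ forall i k, A i -> A k ->
    ip mu (lin 1 (u k) (-1) (u i)) (lin 1 (u k) (-1) (u i)) <= 16^-1 ^+ n.
  by have [A UA hA] := ultra_cauchy uU Xu uB (e0 n); exists A.
have [A hA] := choice Ae.
have pick n : exists k, (n <= k)%N /\ forall j, (j <= n)%N -> A j k.
  have UB : U [set x | forall j, j \in iota 0 n.+1 -> A j x].
    by apply: filter_all => j; have [] := hA j.
  have Un : U [set k | (n <= k)%N] by apply: ooU; exact: nbhs_infty_ge.
  have [k [kB kn]] := filter_ex (filterI UB Un).
  by exists k; split => // j jn; apply: kB; rewrite mem_iota add0n ltnS jn.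
have [k hk] := choice pick.
have Lu n : L2 mu (u (k n)) by case: (Xu (k n)).
have fast n m : (n <= m)%N -> ip mu (lin 1 (u (k m)) (-1) (u (k n)))
    (lin 1 (u (k m)) (-1) (u (k n))) <= 1 * 16^-1 ^+ n.
  by move=> nm; rewrite mul1r; apply: (hA n).2; [exact: (hk n).2|exact: (hk m).2].
have [w [Lw _ w0 wC]] := L2_complete Lu fast.
exists w; split => //.
  by move=> x Ox; apply: w0 => n; have [_ uO _ _] := Xu (k n); exact: uO.
move=> e e_gt0 n0; apply: contrapT => hn.
suff : e <= 0 by rewrite leNgt e_gt0.
apply: (@pow16_null _ _ 1) => n; pose n1 := maxn n n0.
apply: (@le_trans _ _ (1 * 16^-1 ^+ n1)); last first.
  rewrite !mul1r; apply: ler_wiXn2l; rewrite ?leq_maxl//; by lra.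
rewrite leNgt; apply/negP => h; apply: hn; exists (k n1).
  by apply: leq_trans (hk n1).1; exact: leq_maxr.
apply: ltW; apply: le_lt_trans h; apply: le_trans (wC n1).
rewrite le_eqVlt; apply/orP; left; apply/eqP; apply: eq_Rintegral => x _.
by rewrite /lin; ring.
Qed.

End compactness.

(** * Moduli of continuity *)

Lemma heine_modulus (R : realType) (h : R -> R) (e : R) : continuous h -> 0 < e ->
  exists2 d : R, 0 < d & forall t t', 0 <= t <= 1 -> 0 <= t' <= 1 ->
    `|t - t'| < d -> `|h t - h t'| < e.
Proof.
move=> ch e0; apply: contrapT => nd.
have ex n : exists p : R * R, [/\ 0 <= p.1 <= 1, 0 <= p.2 <= 1,
    `|p.1 - p.2| < n.+1%:R^-1 & e <= `|h p.1 - h p.2|].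
  apply: contrapT => np; apply: nd; exists n.+1%:R^-1 => // t t' t1 t'1 tt'.
  rewrite ltNge; apply/negP => h1; apply: np; by exists (t, t').
have [p hp] := choice ex.
have [U [uU ooU]] := ultraFilterLemma (eventually_filter : ProperFilter eventually).
have pU : ProperFilter U by exact: ultra_proper.
have [n|c hc] := ultra_bounded_cluster (x := fun n => (p n).1) (K := 1) uU.
  by have [/andP[? ?] _ _ _] := hp n; rewrite ger0_norm.
have /cvgrPdist_lt/(_ (e / 2)) := ch c.
rewrite divr_gt0// => /(_ isT)/nbhs_ballP[d /= d0 bd].
have d2 : 0 < d / 2 by rewrite divr_gt0.
have Un : U [set n | (Num.truncn (d / 2)^-1 <= n)%N] by apply: ooU; exact: nbhs_infty_ge.
have [n [n1 n2]] := filter_ex (filterI (hc _ d2) Un).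
have [_ _ p12 ep] := hp n.
have p12' : `|(p n).1 - (p n).2| < d / 2.
  apply: (lt_le_trans p12); rewrite invf_ple ?posrE// ltW//.
  by apply: (lt_le_trans (truncnS_gt _)); rewrite ler_nat.
have b1 : `|h c - h (p n).1| < e / 2.
  by apply: bd; rewrite -ball_normE /= distrC (lt_trans n1)//; lra.
have b2 : `|h c - h (p n).2| < e / 2.
  apply: bd; rewrite -ball_normE /=.
  have := ler_distD (p n).1 c (p n).2; rewrite (distrC c (p n).1); move: n1 p12' => /=.
  move: (`|(p n).1 - c|) (`|(p n).1 - (p n).2|) (`|c - (p n).2|) => x y z; lra.
have := ler_distD (h c) (h (p n).1) (h (p n).2); rewrite (distrC (h (p n).1) (h c)).
move: b1 b2 ep; move: (`|h c - h (p n).1|) (`|h c - h (p n).2|) (`|h (p n).1 - h (p n).2|) => x y z.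
by lra.
Qed.

(** Young's inequality for both signs of the cross term. The right-hand side involves only [w] and
    the distance, so it yields continuity at [w]. *)
Lemma psd_close (R : realType) (T : Type) (X : set (T -> R))
    (B : (T -> R) -> (T -> R) -> R) (k : R) (u w : T -> R) :
  psd_form X B -> 0 < k -> X u -> X w -> `|B u u - B w w| <=
  k * B w w + (1 + k^-1) * B (lin 1 u (-1) w) (lin 1 u (-1) w).
Proof.
move=> BF k0 Xu Xw; set z := lin 1 u (-1) w; have Xzz : X z by exact: psd_lin BF _ _ _ _ Xu Xw.
have -> : B u u = B w w + 2 * B w z + B z z.
  have -> : u = lin 1 w 1 z by apply/funext => x; rewrite /z /lin; ring.
  have Xl : X (lin 1 w 1 z) by exact: psd_lin BF _ _ _ _ Xw Xzz.
  by rewrite (psd_quad BF)//; ring.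
have h1 := psd_young BF k0 Xw Xzz.
have h2 := psd_young BF k0 Xw (psd_lin BF (-1) 0 Xzz Xzz).
have E1 : B (lin (-1) z 0 z) (lin (-1) z 0 z) = B z z by rewrite (psd_quad BF)//; ring.
have E2 : B w (lin (-1) z 0 z) = - B w z by rewrite (psd_linr BF)//; ring.
have z0 := psd_ge0 BF Xzz.
move: h1 h2 z0; rewrite E1 E2 (mulrDl 1 k^-1) mul1r.
move: (B w w) (B w z) (B z z) (k * _) (k^-1 * _) => x y t p q h1 h2 t0.
by rewrite ler_norml; apply/andP; split; lra.
Qed.

(** The order of choices after Young's inequality: k first makes [k * A] small, and d is then
    adapted to [C k], which may be large. *)
Lemma small_combination (R : realType) (A e : R) (C : R -> R) : 0 <= A -> 0 < e ->
  exists k d : R, [/\ 0 < k, 0 < d & forall D, 0 <= D <= d -> k * A + C k * D <= e].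
Proof.
move=> A0 e0; pose k := e / (2 * (A + 1)); pose d := e / (2 * (`|C k| + 1)).
have A1 : 0 < A + 1 by rewrite ltr_wpDl.
have C1 : 0 < `|C k| + 1 by rewrite ltr_wpDl.
have k0 : 0 < k by rewrite divr_gt0// mulr_gt0.
exists k, d; split => // [|D /andP[D0 Dd]]; first by rewrite divr_gt0// mulr_gt0.
have kA : k * A <= e / 2.
  have -> : e / 2 = k * (A + 1) by rewrite /k; field; rewrite gt_eqF.
  by rewrite ler_wpM2l ?(ltW k0)// lerDl.
have CD : C k * D <= e / 2.
  have -> : e / 2 = (`|C k| + 1) * d by rewrite /d; field; rewrite gt_eqF.
  apply: (@le_trans _ _ ((`|C k| + 1) * D)); last by rewrite ler_wpM2l// ltW.
  by rewrite ler_wpM2r// (le_trans (ler_norm _))// lerDl.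
by move: kA CD; move: (k * A) (C k * D) => x y; lra.
Qed.

(** * The order preserving map S, its orbits and their limits *)

Section dynamics.
Context (R : realType) (s : R) (N : nat) (Omega : set 'rV[R]_N).
Local Notation mu := (@lebesgue_rV R N).
Local Notation T := (lebesgue_space R N).
Local Notation Xz := (Xz s Omega).
Implicit Types (u v w z b phi g : T -> R) (t e c : R).

Hypothesis s0 : 0 < s.
Variable L : R.
Hypothesis L0 : 0 < L.
Hypothesis OL : forall x, Omega x -> `|x| < L.
Hypothesis N0 : (0 < N)%N.
Hypothesis mO : measurable (Omega : set T).
Hypothesis Of : (mu Omega < +oo)%E.

Variables (M : R) (h H : R -> R).
Hypothesis M0 : 0 < M.
Hypothesis ch : continuous h.
Hypothesis h0 : h 0 = 0.
Hypothesis h1 : h 1 = M.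
Hypothesis h_mono : forall t t' : R, 0 <= t -> t <= t' -> t' <= 1 -> h t <= h t'.
Hypothesis mH : measurable_fun setT H.
Hypothesis H0 : H 0 = 0.
Hypothesis H_convex : forall t t' : R, 0 <= t <= 1 -> 0 <= t' <= 1 ->
  h t * (t' - t) <= H t' - H t.

Let aF := aform_form s Omega (ltW M0).
Let LF := L2_form mu.
Local Notation a := (@aform R s N M).
Definition dist2 u w := a (lin 1 u (-1) w) (lin 1 u (-1) w).
Local Notation m := (fine (mu Omega)).

Let m_ge0 : 0 <= m. Proof. by rewrite fine_ge0. Qed.

Let h_ge0 t : 0 <= t <= 1 -> 0 <= h t.
Proof. by move=> /andP[? ?]; rewrite -h0; exact: h_mono. Qed.

Let h_leM t : 0 <= t <= 1 -> h t <= M.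
Proof. by move=> /andP[? ?]; rewrite -h1; exact: h_mono. Qed.

Let H_lipschitz t t' : 0 <= t <= 1 -> 0 <= t' <= 1 -> `|H t - H t'| <= M * `|t - t'|.
Proof.
move=> t1 t'1; wlog tt : t t' t1 t'1 / t <= t'.
  move=> w; have [|/ltW] := leP t t'; first exact: w.
  by rewrite distrC [X in _ <= _ * X]distrC; exact: w.
have c1 := H_convex t1 t'1; have c2 := H_convex t'1 t1.
have p1 := h_ge0 t1; have p2 := h_leM t'1.
have d0 : 0 <= t' - t by rewrite subr_ge0.
rewrite distrC [X in _ <= _ * X]distrC !ger0_norm//.
  by apply: (@le_trans _ _ (h t' * (t' - t))); [move: c2; lra|exact: ler_wpM2r].
by apply: le_trans c1; exact: mulr_ge0.
Qed.

Let H_bounds t : 0 <= t <= 1 -> 0 <= H t <= M.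
Proof.
move=> t1; have z1 : 0 <= (0 : R) <= 1 by rewrite lexx ler01.
have := H_convex z1 t1; rewrite h0 H0 mul0r subr0 => ->/=.
have := H_lipschitz t1 z1; rewrite H0 !subr0 => /(le_trans (ler_norm _)) Ht.
apply: (le_trans Ht); case/andP: t1 => ? ?; rewrite ger0_norm//.
by rewrite ler_piMr// ltW.
Qed.

Section order_interval.
Variable b : T -> R.
Hypothesis mb : measurable_fun setT b.
Hypothesis b01 : forall x, 0 <= b x <= 1.
Hypothesis b0 : forall x, ~ Omega x -> b x = 0.

Definition Kb : set (T -> R) :=
  [set u : T -> R | measurable_fun setT u /\ forall x, 0 <= u x <= b x].

Let K01 u x : Kb u -> 0 <= u x <= 1.
Proof.
move=> [_ /(_ x)/andP[-> ub]]; case/andP: (b01 x) => _ b1.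
exact: le_trans b1.
Qed.

Let K0 u x : Kb u -> ~ Omega x -> u x = 0.
Proof.
move=> [_ /(_ x)ub] /b0 bx; apply/le_anti.
by move: ub; rewrite bx andbC.
Qed.

Let L2_bounded g c : measurable_fun setT g ->
  (forall x, ~ Omega x -> g x = 0) -> (forall x, `|g x| <= c) ->
  L2 mu g /\ ip mu g g <= c ^+ 2 * m.
Proof.
move=> mg g0 gc; have LI := L2_indic mO Of; have Lc := L2_lin c 0 LI LI.
have gI x : `|g x| <= `|lin c \1_Omega 0 \1_Omega x|.
  rewrite /lin mul0r addr0 indicE; have [Ox|Ox] := pselect (Omega x).
    by rewrite mem_set// mulr1 (le_trans (gc x))// ler_norm.
  by rewrite g0// normr0.
split; first exact: L2_dominated gI.
apply: le_trans (ip_dominated mg Lc gI) _.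
rewrite (psd_quad LF)// ip_indic// !mulr0 mul0r expr0n /= mul0r !addr0.
exact: lexx.
Qed.

Let L2_K u : Kb u -> L2 mu u.
Proof.
move=> Ku; have [] // := @L2_bounded u 1 (proj1 Ku) (fun x => K0 Ku) _.
by move=> x; have /andP[? ?] := K01 x Ku; rewrite ger0_norm.
Qed.

Let L2_hK u : Kb u -> L2 mu (h \o u) /\ ip mu (h \o u) (h \o u) <= M ^+ 2 * m.
Proof.
move=> Ku; apply: L2_bounded.
- by apply: measurableT_comp; [exact: continuous_measurable_fun|case: Ku].
- by move=> x Ox; rewrite /= (K0 Ku Ox).
- by move=> x; rewrite /= ger0_norm ?h_ge0 ?h_leM ?K01.
Qed.

Let LhK u : Kb u -> L2 mu (h \o u). Proof. by move=> /L2_hK[]. Qed.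

Let integrable_bounded g c : measurable_fun setT g ->
  (forall x, ~ Omega x -> g x = 0) -> (forall x, `|g x| <= c) ->
  mu.-integrable setT (EFin \o g) /\ \int[mu]_x g x <= c * m.
Proof.
move=> mg g0 gc; have LI := L2_indic mO Of; have II := L2_integrable_prod LI LI.
have gI x : `|g x| <= lin c (fun x => \1_Omega x * \1_Omega x) 0 (fun x => \1_Omega x * \1_Omega x) x.
  rewrite /lin mul0r addr0 indicE; have [Ox|Ox] := pselect (Omega x).
    by rewrite mem_set// !mulr1.
  by rewrite g0// normr0 memNset// !mulr0.
have Ic := integrable_lin c 0 II II.
have Ig : mu.-integrable setT (EFin \o g) by exact: integrable_dominated Ic gI.
split => //; apply: (@le_trans _ _ (\int[mu]_x lin c (fun x => \1_Omega x * \1_Omega x) 0 (fun x => \1_Omega x * \1_Omega x) x)).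
  by apply: le_Rintegral => // x _; exact: le_trans (ler_norm _) (gI x).
rewrite Rintegral_lin// mul0r addr0 -/(ip mu \1_Omega \1_Omega) ip_indic//.
Qed.

Let HK u : Kb u -> mu.-integrable setT (EFin \o (H \o u)) /\
  0 <= \int[mu]_x H (u x) <= M * m.
Proof.
move=> Ku; have p1 : measurable_fun setT (H \o u) by apply: measurableT_comp => //; case: Ku.
have p2 x : ~ Omega x -> (H \o u) x = 0 by move=> Ox; rewrite /= (K0 Ku Ox).
have p3 x : `|(H \o u) x| <= M.
  by have /andP[? ?] := H_bounds (K01 x Ku); rewrite /= ger0_norm.
have [iH hI] := integrable_bounded p1 p2 p3.
split => //; apply/andP; split => //; apply: Rintegral_ge0 => x _.
by have /andP[] := H_bounds (K01 x Ku).
Qed.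

Definition solves u z :=
  [/\ Xz z, Kb z & forall phi, Xz phi -> a z phi = ip mu (h \o u) phi].

(** For b in the space this follows from a(b, phi) >= <h(b), phi> with phi = (z - b)^+, since a(z -
    b, phi) >= a(phi, phi). In this form a is never evaluated at b, so b may be the indicator of
    Omega, whose energy need not be finite. *)
Definition supersolution := forall z, Xz z -> (forall x, 0 <= z x) ->
  Xz (pos (lin 1 z (-1) b)) /\
  ip mu (h \o b) (pos (lin 1 z (-1) b)) +
    a (pos (lin 1 z (-1) b)) (pos (lin 1 z (-1) b)) <= a z (pos (lin 1 z (-1) b)).

Let Kbb : Kb b.
Proof. by split=> // x; have /andP[-> _] := b01 x; rewrite lexx. Qed.

(** The Riesz solution lies between 0 and b only almost everywhere. Adding its negative part and
    then subtracting the excess over b restores the bounds everywhere; both corrections have zero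
    energy by comparison, so by [psd_null] the equation is unaffected. *)
Lemma resolvent u : supersolution -> Kb u -> exists z, solves u z.
Proof.
move=> sup Ku; have Lhu := LhK Ku; have XL z : Xz z -> L2 mu z by case.
have [z0 Xz0 z0E] := riesz s Omega M0 Lhu.
pose mz := lin (-1) z0 0 z0; have Xmz : Xz mz by exact: Xz_lin.
pose psi := pos mz; have Xpsi : Xz psi by exact: Xz_pos.
have psi0 x : 0 <= psi x by rewrite /psi /pos le_max lexx orbT.
have hu0 x : 0 <= (h \o u) x by rewrite /= h_ge0// K01.
have psi_null : a psi psi <= 0.
  apply: le_trans (aform_pos (ltW M0) Xmz) _; rewrite /mz (psd_linl aF)// mul0r addr0 mulN1r.
  by rewrite oppr_le0 z0E//; apply: Rintegral_ge0 => x _; exact: mulr_ge0.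
pose z1 := lin 1 z0 1 psi; have Xz1 : Xz z1 by exact: Xz_lin.
have z1_ge0 x : 0 <= z1 x.
  rewrite /z1 /psi /pos /mz /lin; move: (z0 x) => t.
  by have [] := leP (-1 * t + 0 * t) 0; lra.
have z1E phi : Xz phi -> a z1 phi = ip mu (h \o u) phi.
  by move=> Xp; rewrite (psd_linl aF)// (psd_null aF Xpsi Xp psi_null) mulr0 addr0 mul1r z0E.
have [Xphi supz] := sup z1 Xz1 z1_ge0; set phi := pos _ in Xphi supz.
have phi0 x : 0 <= phi x by rewrite /phi /pos le_max lexx orbT.
have phi_null : a phi phi <= 0.
  have : ip mu (h \o u) phi <= ip mu (h \o b) phi.
    apply: le_ip; [exact: LhK|exact: XL|exact: LhK|exact: XL|move=> x].
    rewrite ler_wpM2r//=.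
    have [_ /(_ x)/andP[? ?]] := Ku; apply: h_mono => //.
    by have /andP[] := b01 x.
  by move: supz; rewrite z1E//; move: (ip mu (h \o b) phi) (ip mu (h \o u) phi) (a phi phi) => p q r; lra.
exists (lin 1 z1 (-1) phi); split.
- exact: Xz_lin.
- split; first by have [] := Xz_lin 1 (-1) Xz1 Xphi.
  move=> x; rewrite /phi /pos /lin; have := z1_ge0 x; have /andP[] := b01 x.
  move: (z1 x) (b x) => t t' t'0 t'1 t0.
  by have [] := leP (1 * t + -1 * t') 0 => ?; apply/andP; split; lra.
- move=> f Xf; rewrite (psd_linl aF)// (psd_null aF Xphi Xf phi_null).
  by rewrite mulr0 addr0 mul1r z1E.
Qed.

Lemma solves_lipschitz u w z y : Kb u -> Kb w -> solves u z -> solves w y ->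
  dist2 z y <= M^-1 * ip mu (lin 1 (h \o u) (-1) (h \o w)) (lin 1 (h \o u) (-1) (h \o w)).
Proof.
move=> Ku Kw [Xzz _ zE] [Xy _ yE]; have Xd := Xz_lin 1 (-1) Xzz Xy.
have Ld : L2 mu (lin 1 z (-1) y) by case: Xd.
have Lh := L2_lin 1 (-1) (LhK Ku) (LhK Kw).
have := psd_young LF M0 Ld Lh; have := ip_le_aform (ltW M0) Xd.
have -> : ip mu (lin 1 z (-1) y) (lin 1 (h \o u) (-1) (h \o w)) = dist2 z y.
  have LU := LhK Ku; have LW := LhK Kw.
  rewrite (psd_sym LF) (psd_linl LF)//.
  by rewrite /dist2 (psd_linl aF)// zE// yE.
by rewrite /dist2; move: (a _ _) (M * _) (M^-1 * _) => p q r; lra.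
Qed.

(** h is merely continuous, so an additive error is unavoidable: where |u - w| < d uniform
    continuity applies, elsewhere |h(u) - h(w)| <= M <= (M/d) |u - w|. *)
Lemma h_modulus (e : R) : 0 < e -> exists2 C, 0 <= C & forall u w, Kb u -> Kb w ->
  ip mu (lin 1 (h \o u) (-1) (h \o w)) (lin 1 (h \o u) (-1) (h \o w)) <=
  e + C * ip mu (lin 1 u (-1) w) (lin 1 u (-1) w).
Proof.
move=> e0; pose q := Num.sqrt (e / (m + 1)).
have m1 : 0 < m + 1 by rewrite ltr_wpDl.
have q0 : 0 < q by rewrite sqrtr_gt0 divr_gt0.
have q2 : q ^+ 2 = e / (m + 1) by rewrite sqr_sqrtr// ltW// divr_gt0.
have [d d0 hd] := heine_modulus ch q0.
exists ((M / d) ^+ 2) => [|u w Ku Kw]; first exact: sqr_ge0.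
have LI := L2_indic mO Of.
have Lu := L2_lin 1 (-1) (L2_K Ku) (L2_K Kw).
have Lh := L2_lin 1 (-1) (LhK Ku) (LhK Kw).
have II := L2_integrable_prod LI LI; have Iu := L2_integrable_prod Lu Lu.
apply: (@le_trans _ _ (\int[mu]_x lin (q ^+ 2) (fun x => \1_Omega x * \1_Omega x) ((M / d) ^+ 2)
    (fun x => lin 1 u (-1) w x * lin 1 u (-1) w x) x)).
  apply: le_Rintegral => //; [exact: L2_integrable_prod|exact: integrable_lin|].
  move=> x _; rewrite {1 2 3}/lin; have [Ox|Ox] := pselect (Omega x); last first.
    rewrite /lin /= (K0 Ku Ox) (K0 Kw Ox) indicE memNset// h0 !(mulr0, addr0).
    exact: lexx.
  rewrite indicE mem_set// !mulr1 -!expr2 /lin /= !mul1r !mulN1r.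
  have [tt|tt] := ltP `|u x - w x| d.
    have := hd _ _ (K01 x Ku) (K01 x Kw) tt => hh.
    rewrite -[leLHS]real_normK ?num_real//.
    apply: (@le_trans _ _ (q ^+ 2)); first by rewrite lerXn2r ?nnegrE// ltW.
    by rewrite lerDl mulr_ge0// sqr_ge0.
  rewrite -exprMn -[leLHS]real_normK ?num_real// -[X in _ <= _ + X]real_normK ?num_real//.
  apply: (@le_trans _ _ (M ^+ 2)).
    rewrite lerXn2r ?nnegrE ?(ltW M0)//.
    have := h_ge0 (K01 x Ku); have := h_ge0 (K01 x Kw).
    have := h_leM (K01 x Ku); have := h_leM (K01 x Kw).
    by rewrite ler_norml; move: (h (u x)) (h (w x)) => p r; lra.
  rewrite -[leLHS]add0r lerD ?sqr_ge0// lerXn2r ?nnegrE ?(ltW M0)//.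
  rewrite normrM [X in X * _]gtr0_norm ?divr_gt0// mulrAC -mulrA ler_peMr ?(ltW M0)//.
  by rewrite ler_pdivlMr// mul1r.
rewrite Rintegral_lin// -/(ip mu \1_Omega \1_Omega) ip_indic// q2 lerD2r.
by rewrite mulrAC ler_pdivrMr// ler_wpM2l ?(ltW e0)// lerDl.
Qed.

Definition J u : R := a u u / 2 - \int[mu]_x H (u x).

Lemma J_ge u : Xz u -> Kb u -> a u u / 2 <= J u + M * m.
Proof. by move=> Xu Ku; have [_ /andP[_]] := HK Ku; rewrite /J; lra. Qed.

(* The map u |-> z is a step of the minimizing movement of J: by convexity of
   H the linearization of J at u bounds J from above, and z minimizes it. *)
Lemma J_segment u z t : Xz u -> Kb u -> solves u z -> 0 <= t <= 1 ->
  Xz (lin (1 - t) u t z) /\ Kb (lin (1 - t) u t z) /\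
  J (lin (1 - t) u t z) <= J u - (t - t ^+ 2 / 2) * dist2 z u.
Proof.
move=> Xu Ku [Xzz Kz zE] /andP[t0 t1]; set w := lin (1 - t) u t z.
have Xw : Xz w by exact: Xz_lin.
have Kw : Kb w.
  split; first by case: Xw.
  move=> x; have [_ /(_ x)/andP[? ?]] := Ku; have [_ /(_ x)/andP[? ?]] := Kz.
  rewrite /w /lin; apply/andP; split; first by rewrite addr_ge0// mulr_ge0// subr_ge0.
  have -> : b x = (1 - t) * b x + t * b x by ring.
  by rewrite lerD// ler_wpM2l// subr_ge0.
split => //; split => //.
have [iHu _] := HK Ku; have [iHw _] := HK Kw.
have XL y : Xz y -> L2 mu y by case.
have Ld : L2 mu (lin 1 z (-1) u) by apply/XL/Xz_lin.
have ih := L2_integrable_prod (LhK Ku) Ld.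
have key : \int[mu]_x lin t (fun x => (h \o u) x * lin 1 z (-1) u x) 1 (H \o u) x <=
    \int[mu]_x H (w x).
  apply: le_Rintegral => //; first exact: integrable_lin.
  move=> x _; have := H_convex (K01 x Ku) (K01 x Kw); rewrite /w /lin /=.
  by move: (h (u x)) (u x) (z x) (H (u x)) (H _) => p q r H1 H2; nra.
move: key; rewrite Rintegral_lin// -/(ip mu (h \o u) (lin 1 z (-1) u)) -zE; last exact: Xz_lin.
rewrite /J /dist2 /w !(psd_quad aF)// (psd_linr aF)// (psd_sym aF z u).
rewrite mul1r; move: (aform s M u u) (aform s M u z) (aform s M z z) => A B C.
have -> : \int[mu]_x (H \o u) x = \int[mu]_x H (u x) by [].
move: (\int[mu]_x H (u x)) (\int[mu]_x H _) => I1 I2.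
by rewrite !expr2; nra.
Qed.

Lemma J_decrease u z : Xz u -> Kb u -> solves u z -> J z <= J u - dist2 z u / 2.
Proof.
move=> Xu Ku uz; have i1 : 0 <= (1 : R) <= 1 by rewrite ler01 lexx.
have [_ [_]] := J_segment Xu Ku uz i1.
have -> : lin (1 - 1) u 1 z = z by apply/funext => x; rewrite /lin; ring.
by rewrite expr1n; move: (J _) (J _) (dist2 _ _) => p q r; lra.
Qed.

Lemma dist2_ge0 u w : Xz u -> Xz w -> 0 <= dist2 u w.
Proof. by move=> Xu Xw; apply/(psd_ge0 aF)/Xz_lin. Qed.

Lemma dist2C u w : Xz u -> Xz w -> dist2 u w = dist2 w u.
Proof.
by move=> Xu Xw; rewrite /dist2 !(psd_quad aF)// (psd_sym aF u w); ring.
Qed.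

Lemma ip_le_dist2 u w : Xz u -> Xz w ->
  ip mu (lin 1 u (-1) w) (lin 1 u (-1) w) <= M^-1 * dist2 u w.
Proof.
by move=> Xu Xw; rewrite ler_pdivlMl//; exact: (ip_le_aform (ltW M0) (Xz_lin 1 (-1) Xu Xw)).
Qed.

Lemma En_continuous w e : Xz w -> 0 < e -> exists2 d : R, 0 < d &
  forall u, Xz u -> dist2 u w <= d -> `|En s u u - En s w w| <= e.
Proof.
move=> Xw e0; have EF := En_form s Omega.
have [k [d [k0 d0 kd]]] := small_combination (fun k => 1 + k^-1) (psd_ge0 EF Xw) e0.
exists d => // u Xu ud; apply: le_trans (psd_close EF k0 Xu Xw) _.
apply: kd; rewrite (psd_ge0 EF) ?(le_trans _ ud)//; last exact: Xz_lin.
exact: (En_le_aform (ltW M0) (Xz_lin 1 (-1) Xu Xw)).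
Qed.

Let H_close u w k : 0 < k -> Kb u -> Kb w -> \int[mu]_x H (u x) - \int[mu]_x H (w x) <=
  M / 2 * (k * m + k^-1 * ip mu (lin 1 u (-1) w) (lin 1 u (-1) w)).
Proof.
move=> k0 Ku Kw; have [iu _] := HK Ku; have [iw _] := HK Kw.
have LI := L2_indic mO Of; have II := L2_integrable_prod LI LI.
have Ld := L2_lin 1 (-1) (L2_K Ku) (L2_K Kw); have Id := L2_integrable_prod Ld Ld.
have : \int[mu]_x lin 1 (H \o u) (-1) (H \o w) x <= \int[mu]_x lin (M / 2 * k)
    (fun x => \1_Omega x * \1_Omega x) (M / 2 * k^-1)
    (fun x => lin 1 u (-1) w x * lin 1 u (-1) w x) x.
  apply: le_Rintegral => //; [exact: integrable_lin|exact: integrable_lin|].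
  move=> x _; rewrite {1 2}/lin; have [Ox|Ox] := pselect (Omega x); last first.
    rewrite /lin /= (K0 Ku Ox) (K0 Kw Ox) indicE memNset// H0 !(mulr0, addr0).
    exact: lexx.
  rewrite indicE mem_set// !mulr1 -expr2 /lin /= !mul1r !mulN1r.
  apply: le_trans (ler_norm _) _; apply: le_trans (H_lipschitz (K01 x Ku) (K01 x Kw)) _.
  apply: (@le_trans _ _ (M * (2^-1 * (k + k^-1 * `|u x - w x| ^+ 2)))); last first.
    by rewrite real_normK ?num_real// le_eqVlt; apply/orP; left; apply/eqP; ring.
  rewrite ler_wpM2l ?(ltW M0)//.
  move: `|u x - w x| => t; rewrite -(ler_pM2l k0).
  have -> : k * (2^-1 * (k + k^-1 * t ^+ 2)) = 2^-1 * (k ^+ 2 + t ^+ 2).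
    by field; rewrite gt_eqF.
  by have := sqr_ge0 (k - t); rewrite sqrrB; move: (k ^+ 2) (t ^+ 2) => a1 a2; rewrite -mulr_natr; lra.
rewrite !Rintegral_lin// -/(ip mu \1_Omega \1_Omega) ip_indic// mul1r mulN1r.
by move=> hle; apply: (le_trans hle); rewrite mulrDr !mulrA.
Qed.

Lemma J_continuous w e : Xz w -> Kb w -> 0 < e -> exists2 d : R, 0 < d &
  forall u, Xz u -> Kb u -> dist2 u w <= d -> `|J u - J w| <= e.
Proof.
move=> Xw Kw e0.
have A0 : 0 <= a w w / 2 + M / 2 * m.
  rewrite addr_ge0 ?divr_ge0 ?(psd_ge0 aF)//.
  by rewrite mulr_ge0// divr_ge0// ltW.
have [k [d [k0 d0 kd]]] := small_combination
  (fun k => (1 + k^-1) / 2 + M / 2 * (k^-1 * M^-1)) A0 e0.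
exists d => // u Xu Ku ud; have D0 := dist2_ge0 Xu Xw.
apply: le_trans (kd (dist2 u w) _); last by rewrite D0 ud.
have g1 := psd_close aF k0 Xu Xw.
have g2 := H_close k0 Ku Kw; have g3 := H_close k0 Kw Ku.
have ipd : ip mu (lin 1 u (-1) w) (lin 1 u (-1) w) <= M^-1 * dist2 u w by exact: ip_le_dist2.
have ipd' : ip mu (lin 1 w (-1) u) (lin 1 w (-1) u) <= M^-1 * dist2 u w.
  by rewrite dist2C//; exact: ip_le_dist2.
have M2 : 0 <= M / 2 by rewrite divr_ge0// ltW.
have kV : 0 <= k^-1 by rewrite invr_ge0 ltW.
have up (X : R) : X <= M^-1 * dist2 u w ->
    M / 2 * (k * m + k^-1 * X) <= M / 2 * (k * m + k^-1 * (M^-1 * dist2 u w)).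
  by move=> hX; rewrite ler_wpM2l// lerD2l ler_wpM2l.
have {}g2 := le_trans g2 (up _ ipd); have {}g3 := le_trans g3 (up _ ipd').
rewrite /J; move: g1; rewrite -/(dist2 u w) ler_norml => /andP[g1 g1'].
have -> : k * (a w w / 2 + M / 2 * m) + ((1 + k^-1) / 2 + M / 2 * (k^-1 * M^-1)) * dist2 u w =
  (k * a w w + (1 + k^-1) * dist2 u w) / 2 + M / 2 * (k * m + k^-1 * (M^-1 * dist2 u w)) by ring.
move: g1 g1' g2 g3; move: (a u u) (a w w) (k * a w w + _) (M / 2 * _) => x y q p.
move: (\int[mu]_x H (u x)) (\int[mu]_x H (w x)) => p' q' g1 g1' g2 g3.
by rewrite ler_norml; apply/andP; split; lra.
Qed.

Variable S : (T -> R) -> T -> R.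
Hypothesis SP : forall u, Kb u -> solves u (S u).

Lemma S_modulus e : 0 < e -> exists2 d : R, 0 < d & forall u w, Xz u -> Kb u ->
  Xz w -> Kb w -> dist2 u w <= d -> dist2 (S u) (S w) <= e.
Proof.
move=> e0; have e1 : 0 < M * e / 2 by rewrite divr_gt0// mulr_gt0.
have [C C0 hC] := h_modulus e1.
have C1 : 0 < C + 1 by rewrite ltr_wpDl.
exists (M * (M * e / 2) / (C + 1)) => [|u w Xu Ku Xw Kw uw].
  by rewrite divr_gt0// mulr_gt0.
apply: le_trans (solves_lipschitz Ku Kw (SP Ku) (SP Kw)) _.
rewrite ler_pdivrMl//; apply: le_trans (hC _ _ Ku Kw) _.
have i0 : 0 <= ip mu (lin 1 u (-1) w) (lin 1 u (-1) w).
  by apply: (psd_ge0 LF); apply: L2_lin; exact: L2_K.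
have : C * ip mu (lin 1 u (-1) w) (lin 1 u (-1) w) <= M * e / 2.
  apply: (@le_trans _ _ ((C + 1) * (M^-1 * (M * (M * e / 2) / (C + 1))))).
    apply: ler_pM => //; first by rewrite lerDl.
    apply: le_trans (ip_le_dist2 Xu Xw) _.
    by rewrite ler_wpM2l ?invr_ge0 ?(ltW M0).
  by rewrite le_eqVlt; apply/orP; left; apply/eqP; field; rewrite !gt_eqF.
by move: (C * _) => p; lra.
Qed.

Lemma iter_XK u n : Xz u -> Kb u -> Xz (iter n S u) /\ Kb (iter n S u).
Proof. by move=> Xu Ku; elim: n => [//|n [IX IK]]; have [] := SP IK. Qed.

Lemma iter_modulus n e : 0 < e -> exists2 d : R, 0 < d & forall u w, Xz u -> Kb u ->
  Xz w -> Kb w -> dist2 u w <= d -> dist2 (iter n S u) (iter n S w) <= e.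
Proof.
elim: n e => [|n IH] e e0; first by exists e.
have [d d0 hd] := S_modulus e0; have [d' d'0 hd'] := IH d d0.
exists d' => // u w Xu Ku Xw Kw uw /=.
have [? ?] := iter_XK n Xu Ku; have [? ?] := iter_XK n Xw Kw.
by apply: hd => //; exact: hd'.
Qed.

Lemma J_iter u n k : Xz u -> Kb u -> (n <= k)%N -> J (iter k S u) <= J (iter n S u).
Proof.
move=> Xu Ku; elim: k => [|k IH]; first by rewrite leqn0 => /eqP ->.
rewrite leq_eqVlt => /orP[/eqP -> //|/IH hJ].
have [Xk Kk] := iter_XK k Xu Ku; have := J_decrease Xk Kk (SP Kk).
have [XS _ _] := SP Kk; have := dist2_ge0 XS Xk.
by rewrite /=; move: hJ; move: (J _) (J _) (J _) (dist2 _ _) => p q r t; lra.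
Qed.

Lemma steps_small u e : Xz u -> Kb u -> 0 < e -> exists n0, forall n, (n0 <= n)%N ->
  dist2 (iter n.+1 S u) (iter n S u) <= e.
Proof.
move=> Xu Ku e0; pose E := [set r | exists n, r = J (iter n S u)].
have E_inf : has_inf E.
  split; first by exists (J u), 0%N.
  exists (- (M * m)) => _ [n ->]; have [Xn Kn] := iter_XK n Xu Ku.
  by have := J_ge Xn Kn; have := psd_ge0 aF Xn; lra.
have e2 : 0 < e / 2 by rewrite divr_gt0.
have [_ [n0 ->] n0P] := inf_adherent e2 E_inf.
exists n0 => n nn; have [Xn Kn] := iter_XK n Xu Ku.
have := J_decrease Xn Kn (SP Kn); have := J_iter Xu Ku nn.
have : inf E <= J (S (iter n S u)) by apply: ge_inf; [have [] := E_inf|exists n.+1].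
by rewrite /=; move: n0P; move: (J _) (J _) (J _) (dist2 _ _) (inf E) => p q r t i; lra.
Qed.

(** The steps of the orbit tend to 0 and S is continuous from L^2 to the energy norm, so at late
    times near an L^2 cluster point y the orbit is close in energy to S y. The fixed point is S y
    and not y, of which no energy is known. *)
Lemma orbit_limit u : Xz u -> Kb u -> exists2 w, solves w w &
  forall e, 0 < e -> exists n, dist2 (iter n S u) w <= e.
Proof.
move=> Xu Ku; have XK n := iter_XK n Xu Ku.
have EB n : En s (iter n S u) (iter n S u) <= 2 * (J u + M * m).
  have [Xn Kn] := XK n; apply: le_trans (En_le_aform (ltW M0) Xn) _.
  by have := J_ge Xn Kn; have := J_iter Xu Ku (leq0n n) => /=; lra.
have [w0 [Lw0 w0O cl]] := energy_compact s0 L0 OL N0 (fun n => (XK n).1) EB.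
(* Clamping the cluster point to [0, b] only brings it nearer to the iterates, which lie in that
   interval. *)
pose y : T -> R := fun x => Num.min (Num.max (w0 x) 0) (b x).
have Ky : Kb y.
  split.
    apply: measurable_minr; last exact: mb.
    by apply: measurable_maxr; [case: Lw0|exact: measurable_cst].
  move=> x; rewrite /y le_min ge_min le_max !lexx !orbT /= andbT.
  by have /andP[] := b01 x.
have close n : ip mu (lin 1 (iter n S u) (-1) y) (lin 1 (iter n S u) (-1) y) <=
    ip mu (lin 1 (iter n S u) (-1) w0) (lin 1 (iter n S u) (-1) w0).
  have [Xn [mn Kn]] := XK n; have Ln : L2 mu (iter n S u) by case: Xn.
  apply: ip_dominated; [|exact: L2_lin|].
    by have [] := L2_lin 1 (-1) Ln (L2_K Ky).
  move=> x; have /andP[n0 nb] := Kn x; rewrite /lin /y !mul1r !mulN1r.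
  move: (iter n S u x) (w0 x) (b x) n0 nb => t t' t'' t0 tt.
  have [lt'|lt'] := leP t' 0; first by rewrite min_l; [rewrite !ger0_norm; lra|lra].
  by have [lt''|lt''] := leP t' t'' => //; rewrite !ler0_norm; lra.
have near e : 0 < e -> exists n, [/\
    ip mu (lin 1 (iter n S u) (-1) y) (lin 1 (iter n S u) (-1) y) <= e &
    dist2 (iter n S u) (S y) <= e].
  move=> e0; have e4 : 0 < M * (e / 8) by rewrite mulr_gt0// divr_gt0.
  have [C C0 hC] := h_modulus e4.
  have C1 : 0 < C + 1 by rewrite ltr_wpDl.
  have e8 : 0 < e / 8 by rewrite divr_gt0.
  have [n0 n0P] := steps_small Xu Ku e8.
  have c0 : 0 < Num.min e (M * (e / 8) / (C + 1)) by rewrite lt_min e0 divr_gt0.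
  have [n nn /(le_trans (close n))] := cl _ c0 n0.
  rewrite le_min => /andP[ne nC]; have [Xn Kn] := XK n; exists n; split => //.
  have [XSy _ _] := SP Ky; have [XSn _ _] := SP Kn.
  apply: le_trans (psd_triangle aF Xn XSn XSy) _.
  have t1 := n0P n nn; rewrite dist2C//= in t1.
  have t2 := solves_lipschitz Kn Ky (SP Kn) (SP Ky).
  have t3 : M^-1 * ip mu (lin 1 (h \o iter n S u) (-1) (h \o y)) (lin 1 (h \o iter n S u) (-1) (h \o y)) <= e / 4.
    rewrite ler_pdivrMl//; apply: le_trans (hC _ _ Kn Ky) _.
    have -> : M * (e / 4) = M * (e / 8) + M * (e / 8) by field.
    rewrite lerD2l; move: nC; rewrite ler_pdivlMr// => nC; apply: le_trans nC.
    rewrite mulrC ler_wpM2l ?lerDl//; apply: (psd_ge0 LF).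
    by apply: L2_lin; exact: L2_K.
  have {}t3 := le_trans t2 t3.
  by rewrite -!/(dist2 _ _); move: t1 t3; move: (dist2 _ _) (dist2 _ _) => p q; lra.
have [XSy KSy SyE] := SP Ky.
(* S y and y are L^2 limits of the same iterates, hence at L^2 distance 0; then so are h(S y) and
   h(y), and the equation of S y becomes a fixed point equation. *)
have wy : ip mu (lin 1 (S y) (-1) y) (lin 1 (S y) (-1) y) <= 0.
  rewrite leNgt; apply/negP => d0; set d := ip _ _ _ in d0.
  have d5 : 0 < d / 5 by rewrite divr_gt0.
  have e0 : 0 < Num.min (d / 5) (M * (d / 5)) by rewrite lt_min d5 mulr_gt0.
  have [n [n1 n2]] := near _ e0; have [Xn Kn] := XK n.
  have Ln := L2_K Kn; have Ly := L2_K Ky; have LSy := L2_K KSy.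
  have t := psd_triangle LF LSy Ln Ly.
  have t' : ip mu (lin 1 (S y) (-1) (iter n S u)) (lin 1 (S y) (-1) (iter n S u)) <= d / 5.
    apply: le_trans (ip_le_dist2 XSy Xn) _; rewrite ler_pdivrMl// dist2C//.
    by apply: (le_trans n2); rewrite ge_min lexx orbT.
  have {}n1 : ip mu (lin 1 (iter n S u) (-1) y) (lin 1 (iter n S u) (-1) y) <= d / 5.
    by apply: (le_trans n1); rewrite ge_min lexx.
  move: t t' n1; rewrite -/d; move: (ip _ _ _) (ip _ _ _) => p q; lra.
have hwy : ip mu (lin 1 (h \o S y) (-1) (h \o y)) (lin 1 (h \o S y) (-1) (h \o y)) <= 0.
  rewrite leNgt; apply/negP => d0; set d := ip _ _ _ in d0.
  have d2 : 0 < d / 2 by rewrite divr_gt0.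
  have [C C0 hC] := h_modulus d2; have := hC _ _ KSy Ky; rewrite -/d.
  by have := mulr_ge0_le0 C0 wy; move: (C * _) => p; lra.
exists (S y); last by move=> e e0; have [n [_ ?]] := near e e0; exists n.
split => // phi Xphi; rewrite SyE//; have Lphi : L2 mu phi by case: Xphi.
have LhS := LhK KSy; have Lhy := LhK Ky.
have := psd_null LF (L2_lin 1 (-1) LhS Lhy) Lphi hwy.
by rewrite (psd_linl LF)//; move: (ip _ _ _) (ip _ _ _) => p q; lra.
Qed.

Variable rho : R.
Hypothesis rho0 : 0 < rho.
Hypothesis well : forall u, Xz u -> Kb u -> En s u u <= rho -> En s u u / 4 <= J u.

(** The level rho/4 is the lower bound for J that [well] gives on the sphere En = rho. *)
Let W u := En s u u < rho /\ J u < rho / 4.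

Let W_J_ge0 u : Xz u -> Kb u -> W u -> 0 <= J u.
Proof.
move=> Xu Ku [/ltW Eu _]; apply: le_trans (well Xu Ku Eu).
by rewrite divr_ge0// (psd_ge0 (En_form s Omega)).
Qed.

(* J is below rho/4 on the segment from u to S u, hence this segment cannot
   cross the sphere En = rho. *)
Let W_step u : Xz u -> Kb u -> W u -> W (S u).
Proof.
move=> Xu Ku [Eu Ju]; have uz := SP Ku; have [Xzz Kz _] := uz; set z := S u in uz Xzz Kz *.
have EF := En_form s Omega; have D0 := dist2_ge0 Xzz Xu.
split; last first.
  by have := J_decrease Xu Ku uz; move: Ju D0; move: (J _) (J _) (dist2 _ _) => p q r; lra.
rewrite ltNge; apply/negP => Ez.
pose A := En s u u; pose B := En s u z; pose C := En s z z.
(* The energy along the segment, minus rho, as a polynomial in t, for the intermediate value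
   theorem. *)
pose p : {poly R} := (1 - 'X) ^+ 2 * A%:P + 2%:P * (1 - 'X) * 'X * B%:P + 'X ^+ 2 * C%:P - rho%:P.
have pE t : p.[t] = En s (lin (1 - t) u t z) (lin (1 - t) u t z) - rho.
  by rewrite (psd_quad EF)// /p !hornerE.
have [t t01 /rootP] : exists2 t, t \in `[0, 1] & root p t.
  have [||t t01 rt] := @poly_ivt R p 0 1; first exact: ler01.
    by rewrite !pE (psd_quad EF)// (psd_quad EF)// -/A -/B -/C; move: Eu Ez; rewrite -/A -/C => ? ?; apply/andP; split; lra.
  by exists t.
rewrite pE => /eqP; rewrite subr_eq0 => /eqP Et.
rewrite in_itv /= in t01; have [Xw [Kw Jw]] := J_segment Xu Ku uz t01.
have := well Xw Kw; rewrite Et lexx => /(_ isT) Jw'.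
have : 0 <= (t - t ^+ 2 / 2) * dist2 z u.
  by apply: mulr_ge0 => //; case/andP: t01 => ? ?; rewrite expr2; nra.
by move: Jw Jw' Ju; move: (J _) (J _) (_ * _) => x y r; lra.
Qed.

Let W_iter u n k : Xz u -> Kb u -> (n <= k)%N -> W (iter n S u) -> W (iter k S u).
Proof.
move=> Xu Ku; elim: k => [|k IH]; first by rewrite leqn0 => /eqP ->.
rewrite leq_eqVlt => /orP[/eqP -> //|nk /(IH nk) Wk].
by have [Xk Kk] := iter_XK k Xu Ku; exact: W_step.
Qed.

Let W_open w : Xz w -> Kb w -> W w -> exists2 d : R, 0 < d &
  forall u, Xz u -> Kb u -> dist2 u w <= d -> W u.
Proof.
move=> Xw Kw [Ew Jw].
have e1 : 0 < (rho - En s w w) / 2 by rewrite divr_gt0// subr_gt0.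
have e2 : 0 < (rho / 4 - J w) / 2 by rewrite divr_gt0// subr_gt0.
have [d1 d10 D1] := En_continuous Xw e1.
have [d2 d20 D2] := J_continuous Xw Kw e2.
exists (Num.min d1 d2) => [|u Xu Ku]; first by rewrite lt_min d10.
rewrite le_min => /andP[/(D1 u Xu) E1 /(D2 u Xu Ku) E2]; move: E1 E2; rewrite !ler_norml.
by move=> /andP[_ E1] /andP[_ E2]; split; move: E1 E2 Ew Jw;
  move: (En _ _ _) (En _ _ _) (J _) (J _) => p q x y; lra.
Qed.

Lemma unstable_solution v : Xz v -> Kb v -> J v < 0 ->
  exists u, [/\ solves u u, 0 <= J u & ~ a u u <= 0].
Proof.
move=> Xv Kv Jv; pose ray t : T -> R := lin t v 0 v.
have Xr t : Xz (ray t) by exact: Xz_lin.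
have Kr t : 0 <= t <= 1 -> Kb (ray t).
  move=> /andP[t0 t1]; split; first by case: (Xr t).
  move=> x; have [_ /(_ x)/andP[v0 vb]] := Kv; rewrite /ray /lin mul0r addr0.
  by rewrite mulr_ge0//= (le_trans _ vb)// ler_piMl.
have rd t t' : dist2 (ray t) (ray t') = (t - t') ^+ 2 * a v v.
  rewrite /dist2; have -> : lin 1 (ray t) (-1) (ray t') = lin (t - t') v 0 v.
    by apply/funext => x; rewrite /ray /lin; ring.
  by rewrite (psd_quad aF)//; ring.
have ray_close d : 0 < d -> exists2 e : R, 0 < e &
    forall t t', `|t - t'| <= e -> dist2 (ray t) (ray t') <= d.
  move=> d0; have A1 : 0 < a v v + 1 by rewrite ltr_wpDl// (psd_ge0 aF).
  exists (Num.sqrt (d / (a v v + 1))) => [|t t' tt]; first by rewrite sqrtr_gt0 divr_gt0.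
  rewrite rd; apply: (@le_trans _ _ (d / (a v v + 1) * (a v v + 1))); last by rewrite divfK// gt_eqF.
  apply: ler_pM; rewrite ?sqr_ge0 ?(psd_ge0 aF)// ?lerDl//.
  have q0 : 0 <= d / (a v v + 1) by rewrite ltW// divr_gt0.
  by rewrite -real_normK ?num_real// -(sqr_sqrtr q0) lerXn2r ?nnegrE ?sqrtr_ge0.
have it n t : 0 <= t <= 1 -> Xz (iter n S (ray t)) /\ Kb (iter n S (ray t)).
  by move=> /Kr K; exact: iter_XK.
have near n t d : 0 <= t <= 1 -> 0 < d -> exists2 e : R, 0 < e & forall t', 0 <= t' <= 1 ->
    `|t' - t| <= e -> dist2 (iter n S (ray t')) (iter n S (ray t)) <= d.
  move=> t01 d0; have [d' d'0 D] := iter_modulus n d0.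
  have [e e0 he] := ray_close _ d'0; exists e => // t' t'01 tt.
  by apply: D => //; [exact: Kr|exact: Kr|exact: he].
pose Th := [set t | 0 <= t <= 1 /\ forall n, ~ W (iter n S (ray t))].
have Th1 : Th 1.
  split; first by rewrite ler01 lexx.
  have r1 : ray 1 = v by apply/funext => x; rewrite /ray /lin; ring.
  move=> n Wn; have [Xn Kn] := iter_XK n Xv Kv; move: Wn; rewrite r1 => /(W_J_ge0 Xn Kn).
  move=> J0; have hJ := J_iter Xv Kv (leq0n n).
  by have := le_lt_trans (le_trans J0 hJ) Jv; rewrite ltxx.
have Th_inf : has_inf Th by split; [exists 1|exists 0 => t [/andP[]]].
pose t0 := inf Th.
have t01 : 0 <= t0 <= 1.
  apply/andP; split; first by apply: lb_le_inf; [exists 1|move=> t [/andP[]]].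
  by apply: ge_inf => //; have [] := Th_inf.
(* For each n the parameters whose n-th iterate is in the well form an open set, so the infimum
   itself belongs to [Th]. *)
have Tht0 : Th t0.
  split=> // n Wn; have [Xn Kn] := it n t0 t01.
  have [d d0 hd] := W_open Xn Kn Wn; have [e e0 he] := near n t0 d t01 d0.
  have [t [tt nt] te] := inf_adherent e0 Th_inf.
  have [Xt Kt] := it n t tt; apply: (nt n); apply: hd => //; apply: he => //.
  have : t0 <= t by apply: ge_inf; [have [] := Th_inf|].
  by move: te; rewrite -/t0 => ? ?; rewrite ler_norml; apply/andP; split; lra.
have ray0 : ray 0 = cst 0 by apply/funext => x; rewrite /ray /lin /=; ring.
have t0_gt0 : 0 < t0.
  rewrite lt_neqAle; case/andP: (t01) => -> _; rewrite andbT; apply/negP => /eqP E.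
  have [_ /(_ 0%N)] := Tht0; apply; rewrite -E /=; split.
    by rewrite /ray (psd_quad (En_form s Omega))// !(mul0r, mulr0, expr0n, addr0).
  have [|_ /andP[I0 _]] := HK (u := ray 0); first by apply: Kr; rewrite lexx ler01.
  rewrite /J {1 2}/ray (psd_quad aF)// !(mul0r, mulr0, expr0n, addr0) sub0r.
  by apply: (@le_lt_trans _ _ 0); [rewrite oppr_le0|rewrite divr_gt0].
(* Below the threshold the orbit enters the well at some time n: afterwards it stays there, where J
   >= 0, and before time n J was larger still. *)
have below t m' : 0 <= t -> t < t0 -> 0 <= J (iter m' S (ray t)).
  move=> tge0 tlt; have t1 : 0 <= t <= 1.
    by rewrite tge0 (le_trans (ltW tlt))//; case/andP: t01.
  have [n Wn] : exists n, W (iter n S (ray t)).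
    apply: contrapT => nW; have : t0 <= t.
      apply: ge_inf; first by have [] := Th_inf.
      by split=> // n Wn; apply: nW; exists n.
    by rewrite leNgt tlt.
  have Kt := Kr _ t1; have [mn|nm] := leqP n m'.
    have [Xm Km] := it m' t t1; apply: W_J_ge0 => //; exact: W_iter mn Wn.
  have [Xn Kn] := it n t t1; apply: le_trans (W_J_ge0 Xn Kn Wn) _.
  exact: J_iter (ltnW nm).
(* A negative value of J at the threshold would persist for slightly smaller parameters, by
   continuity of the n-th iterate. *)
have Jn n : 0 <= J (iter n S (ray t0)).
  rewrite leNgt; apply/negP => Jneg; have [Xn Kn] := it n t0 t01.
  have e1 : 0 < - J (iter n S (ray t0)) / 2 by rewrite divr_gt0// oppr_gt0.
  have [d d0 hd] := J_continuous Xn Kn e1; have [e e0 he] := near n t0 d t01 d0.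
  pose t := Num.max 0 (t0 - e).
  have tge0 : 0 <= t by rewrite /t le_max lexx.
  have tlt : t < t0 by rewrite /t gt_max t0_gt0 gtrBl.
  have te : `|t - t0| <= e.
    rewrite ler0_norm; last by rewrite subr_le0 ltW.
    by have : t0 - e <= t by [rewrite /t le_max lexx orbT]; move: (t) => t'; lra.
  have t1 : 0 <= t <= 1.
    by rewrite tge0 (le_trans (ltW tlt))//; case/andP: t01.
  have [Xt Kt] := it n t t1.
  have := hd _ Xt Kt (he t t1 te); have := below t n tge0 tlt; rewrite ler_norml.
  by move=> + /andP[_]; move: Jneg; move: (J _) (J _) => p q; lra.
have [w ww lim] := orbit_limit (Xr t0) (Kr _ t01); have [Xw Kw _] := ww.
exists w; split=> //.
  rewrite leNgt; apply/negP => Jneg.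
  have e1 : 0 < - J w / 2 by rewrite divr_gt0// oppr_gt0.
  have [d d0 hd] := J_continuous Xw Kw e1; have [n dn] := lim d d0.
  have [Xn Kn] := it n t0 t01; have := hd _ Xn Kn dn; have := Jn n; rewrite ler_norml.
  by move=> + /andP[_]; move: Jneg; move: (J _) (J _) => p q; lra.
(* A limit of zero energy would lie in the open well, and the orbit would have entered it. *)
move=> w0; have Ww : W w.
  split; first by apply: le_lt_trans rho0; exact: le_trans (En_le_aform (ltW M0) Xw) w0.
  have [_ /andP[I0 _]] := HK Kw; have r4 : 0 < rho / 4 by rewrite divr_gt0.
  by rewrite /J; move: w0 I0 r4; move: (a w w) (\int[mu]_x _) (rho / 4) => p q r; lra.
have [d d0 hd] := W_open Xw Kw Ww; have [n dn] := lim d d0.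
have [Xn Kn] := it n t0 t01; have [_ nW] := Tht0.
exact: nW (hd _ Xn Kn dn).
Qed.

End order_interval.
End dynamics.

(** * The strong maximum principle *)

Lemma Rintegral_eq0_ae d (T : measurableType d) (R : realType)
    (m : {measure set T -> \bar R}) (f : T -> R) :
  m.-integrable setT (EFin \o f) -> (forall x, 0 <= f x) -> \int[m]_x f x <= 0 ->
  {ae m, forall x, f x = 0}.
Proof.
move=> fi f0 fle; have mf : measurable_fun setT (EFin \o f) by exact: measurable_int fi.
have [+ _] := ae_eq_integral_abs m measurableT mf.
have E : (\int[m]_x `|(EFin \o f) x| = 0)%E.
  under eq_integral do rewrite /= ger0_norm//.
  rewrite -(fineK (integrable_fin_num measurableT fi)); congr EFin.
  by apply/le_anti; rewrite fle Rintegral_ge0.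
move=> /(_ E); apply: filterS => x /= /(_ Logic.I) [].
by [].
Qed.

Section maximum_principle.
Context (R : realType) (s : R) (N : nat) (Omega : set 'rV[R]_N).
Local Notation mu := (@lebesgue_rV R N).
Local Notation mu2 := (mu \x mu)%E.
Local Notation T := (lebesgue_space R N).
Local Notation Xz := (Xz s Omega).
Local Notation cutoff := (cutoff Omega).

Hypothesis s01 : 0 < s < 1.
Hypothesis oO : open Omega.
Hypothesis mO : measurable (Omega : set T).
Hypothesis Of : (mu Omega < +oo)%E.

(** Discrete Picone inequality: the energy of w against a^2 / (w + e) is at most the energy of a,
    uniformly in e. *)
Let picone (a b X Y : R) : 0 < X -> 0 < Y ->
  (X - Y) * (a ^+ 2 / X - b ^+ 2 / Y) <= (a - b) ^+ 2.
Proof.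
move=> X0 Y0; rewrite -subr_ge0.
have -> : (a - b) ^+ 2 - (X - Y) * (a ^+ 2 / X - b ^+ 2 / Y) =
    (a * Y - b * X) ^+ 2 / (X * Y) by field; rewrite !gt_eqF.
by rewrite divr_ge0 ?sqr_ge0// mulr_ge0 ?ltW.
Qed.

(** The gain in the Picone inequality for a pair with w = 0 at the first point and w = y >= d at the
    second; it is of order 1/e. *)
Let picone_gap (a b e d y : R) : 0 < e -> 0 <= a <= 1 -> 0 <= b <= 1 -> 0 < d -> d <= y ->
  (e - (y + e)) * (a ^+ 2 / e - b ^+ 2 / (y + e)) <= (a - b) ^+ 2 - (a ^+ 2 * d / e - 2).
Proof.
move=> e0 /andP[a0 a1] /andP[b0 b1] d0 dy.
have Y0 : 0 < y + e by rewrite addr_gt0// (lt_le_trans d0).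
have -> : (e - (y + e)) * (a ^+ 2 / e - b ^+ 2 / (y + e)) =
    b ^+ 2 * (y / (y + e)) - a ^+ 2 * y / e by field; rewrite !gt_eqF.
have h1 : b ^+ 2 * (y / (y + e)) <= b ^+ 2.
  by rewrite ler_piMr ?sqr_ge0// ler_pdivrMr// mul1r lerDl ltW.
have h2 : a ^+ 2 * d / e <= a ^+ 2 * y / e.
  by rewrite ler_pM2r ?invr_gt0// ler_wpM2l ?sqr_ge0.
have h3 : b ^+ 2 <= (a - b) ^+ 2 + 2 by rewrite !expr2; nra.
by move: h1 h2 h3; move: (b ^+ 2) ((a - b) ^+ 2) (a ^+ 2 * d / e) (a ^+ 2 * y / e) (b ^+ 2 * _) => *; lra.
Qed.

Let test_lipschitz (e a b x y : R) : 0 < e -> 0 <= a <= 1 -> 0 <= b <= 1 -> 0 <= x -> 0 <= y ->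
  `|a ^+ 2 / (x + e) - b ^+ 2 / (y + e)| <= `|2 / e * a - 2 / e * b| + `|e ^- 2 * x - e ^- 2 * y|.
Proof.
move=> e0 /andP[a0 a1] /andP[b0 b1] x0 y0.
have X0 : 0 < x + e by rewrite ltr_wpDl.
have Y0 : 0 < y + e by rewrite ltr_wpDl.
have Xe : (x + e)^-1 <= e^-1 by rewrite lef_pV2 ?posrE// lerDr.
have Ye : (y + e)^-1 <= e^-1 by rewrite lef_pV2 ?posrE// lerDr.
have -> : a ^+ 2 / (x + e) - b ^+ 2 / (y + e) = (a - b) * ((a + b) * (x + e)^-1) +
    (x - y) * (- b ^+ 2 * ((x + e)^-1 * (y + e)^-1)) by field; rewrite !gt_eqF.
have X1 : 0 <= (x + e)^-1 by rewrite invr_ge0 ltW.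
have Y1 : 0 <= (y + e)^-1 by rewrite invr_ge0 ltW.
have ab0 : 0 <= (a + b) * (x + e)^-1 by rewrite mulr_ge0// addr_ge0.
have ab : (a + b) * (x + e)^-1 <= 2 / e by apply: ler_pM => //; lra.
have b20 : 0 <= b ^+ 2 * ((x + e)^-1 * (y + e)^-1) by rewrite mulr_ge0 ?sqr_ge0// mulr_ge0.
have b2 : b ^+ 2 * ((x + e)^-1 * (y + e)^-1) <= e ^- 2.
  rewrite -[leRHS]mul1r; apply: ler_pM; rewrite ?sqr_ge0 ?exprn_ile1//.
    exact: mulr_ge0.
  by rewrite expr2 invfM; exact: ler_pM.
apply: le_trans (ler_normD _ _) _; rewrite -!mulrBr mulNr.
rewrite (normrM (a - b)) (normrM (x - y)) (normrM (2 / e)) (normrM (e ^- 2)) normrN.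
have e1 : 0 <= 2 / e by rewrite divr_ge0// ltW.
have e2 : 0 <= e ^- 2 by rewrite invr_ge0 sqr_ge0.
by apply: lerD; rewrite mulrC ler_wpM2r// !ger0_norm.
Qed.

Lemma cutoff01 x : 0 <= cutoff x <= 1.
Proof. by rewrite cutoff_ge0 cutoff_le1. Qed.

(* Testing with cutoff^2 / (w + e) and letting e tend to 0. *)
Lemma strong_maximum_principle (M : R) (w : T -> R) : 0 <= M -> Xz w ->
  (forall x, 0 <= w x) ->
  (forall phi, Xz phi -> (forall x, 0 <= phi x) -> 0 <= aform s M w phi) ->
  {ae mu, forall x, w x = 0} \/ {ae mu, forall x, Omega x -> 0 < w x}.
Proof.
move=> M0 Xw w0 wpos; have [mw wO Lw Ldw] := Xw.
have Xe := Xz_cutoff s01 mO Of; have [me eO Le Lde] := Xe.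
pose A : set T := Omega `&` w @^-1` [set 0].
have mA : measurable A.
  apply: measurableI => //; rewrite -[X in measurable X]setTI.
  by apply: mw => //; exact: measurable_set1.
have Af : (mu A < +oo)%E.
  by apply: le_lt_trans Of; apply: le_measure; rewrite ?inE//; exact: subIsetl.
pose P n : set T := w @^-1` `]n.+1%:R^-1, +oo[%classic.
have mP n : measurable (P n).
  rewrite -[X in measurable X]setTI.
  by apply: mw => //; exact: measurable_itv.
have PO n : P n `<=` Omega.
  move=> x; rewrite /P /= in_itv /= andbT => wx; apply: contrapT => /wO wx0.
  by move: wx; rewrite wx0 ltNge invr_ge0 ler0n.
have Pf n : (mu (P n) < +oo)%E.
  by apply: le_lt_trans Of; apply: le_measure; rewrite ?inE//; exact: PO.
(* If both sets had positive measure, the pairs in A x P n would contribute a gain of order d/e to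
   the tested inequality, whose remaining terms are bounded independently of e. *)
have null n : (mu A = 0 \/ mu (P n) = 0)%E.
  pose d : R := n.+1%:R^-1; have d0 : 0 < d by rewrite invr_gt0.
  (* Capping the kernel at 1 makes it integrable over A x P n, and it remains positive off the
     diagonal. *)
  pose k (z : T * T) : R := Num.min (kern s z) 1.
  have k0 z : 0 <= k z by rewrite le_min kern_ge0 ler01.
  have mk : measurable_fun setT k by apply: measurable_minr => //; exact: measurable_kern.
  have LA := L2_indic mA Af; have LP := L2_indic (mP n) (Pf n).
  have iAP := integrable_prod (L2_integrable_prod LA LA) (L2_integrable_prod LP LP).
  pose f2 (z : T * T) : R := \1_A z.1 * \1_(P n) z.2 * k z.
  pose f1 (z : T * T) : R := f2 z * cutoff z.1 ^+ 2.
  have i0 (B : set T) x : 0 <= (\1_B x : R) by rewrite indicE.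
  have f20 z : 0 <= f2 z by rewrite /f2 mulr_ge0// mulr_ge0.
  have f2le z : f2 z <= \1_A z.1 * \1_A z.1 * (\1_(P n) z.2 * \1_(P n) z.2).
    rewrite /f2 !indicE; case: (_ \in _); case: (_ \in _); rewrite ?(mul1r, mul0r)//.
    by rewrite ge_min lexx orbT.
  have mf2 : measurable_fun setT f2.
    apply: measurable_funM => //; apply: measurable_funM.
      by apply: measurable_comp_fst; exact: measurable_indic.
    by apply: measurable_comp_snd; exact: measurable_indic.
  have mf1 : measurable_fun setT f1.
    apply: measurable_funM => //; apply: measurable_funX.
    exact: (measurable_comp_fst me).
  have i2 : mu2.-integrable setT (EFin \o f2).
    by apply: integrable_dominated iAP _ => // z; rewrite ger0_norm.
  have i1 : mu2.-integrable setT (EFin \o f1).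
    apply: integrable_dominated i2 _ => // z.
    have /andP[e0 e1] := cutoff01 z.1.
    by rewrite /f1 ger0_norm ?mulr_ge0 ?sqr_ge0// ler_piMr// exprn_ile1.
  have main e : 0 < e -> d / e * \int[mu2]_z f1 z <=
      2 * En s cutoff cutoff + 2 * \int[mu2]_z f2 z + 2 * M * ip mu cutoff cutoff.
    move=> e0; pose phi : T -> R := fun x => cutoff x ^+ 2 / (w x + e).
    have we x : 0 < w x + e by rewrite ltr_wpDl.
    have Xphi : Xz phi.
      apply: (@Xz_dominated _ _ _ _ (lin (2 / e) cutoff 0 cutoff) (lin (e ^- 2) w 0 w)).
      - exact: Xz_lin.
      - exact: Xz_lin.
      - apply: measurable_funM; first exact: measurable_funX.
        rewrite (_ : (fun _ => _) = fun x => (w x + e) `^ (-1)); last first.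
          by apply/funext => x; rewrite powR_inv1// ltW.
        apply: (measurableT_comp (measurable_powR _)).
        by apply: measurable_funD => //; exact: measurable_cst.
      - by move=> x Ox; rewrite /phi eO// expr0n mul0r.
      - move=> x; rewrite /lin !mul0r !addr0 /phi.
        have z01 : 0 <= (0 : R) <= 1 by rewrite lexx ler01.
        have := test_lipschitz e0 (cutoff01 x) z01 (w0 x) (w0 x).
        by rewrite expr0n mul0r mulr0 !subr0 subrr normr0 addr0 => /le_trans; apply; rewrite lerDl.
      - move=> x y; rewrite /lin !mul0r !addr0.
        exact: (test_lipschitz e0 (cutoff01 x) (cutoff01 y) (w0 x) (w0 y)).
    have phi0 x : 0 <= phi x by rewrite /phi divr_ge0 ?sqr_ge0// ltW.
    have := wpos phi Xphi phi0; have [_ _ Lphi Ldphi] := Xphi.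
    have ipw : ip mu w phi <= ip mu cutoff cutoff.
      apply: le_ip => // x; rewrite /phi mulrCA -expr2 ler_piMr ?sqr_ge0//.
      by rewrite ler_pdivrMr// mul1r lerDl ltW.
    have i3 := L2_integrable_prod Ldw Ldphi; have i4 := L2_integrable_prod Lde Lde.
    have i5 := integrable_lin (d / e) (-2) i1 i2.
    have dE : \int[mu2]_z (du s w z * du s phi z) <=
        \int[mu2]_z lin 1 (fun z => du s cutoff z * du s cutoff z) (-1) (lin (d / e) f1 (-2) f2) z.
      apply: le_Rintegral => //; first exact: integrable_lin.
      move=> [x y] _; rewrite /lin !du_mul /=.
      have -> : (w x - w y) * (phi x - phi y) = ((w x + e) - (w y + e)) *
          (cutoff x ^+ 2 / (w x + e) - cutoff y ^+ 2 / (w y + e)) by rewrite /phi; ring.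
      have b1 := picone (cutoff x) (cutoff y) (we x) (we y).
      have K0 := kern_ge0 s (x, y).
      have [zA|zA] := pselect (A x /\ P n y); last first.
        have f2z : f2 (x, y) = 0.
          rewrite /f2 !indicE /=; have [Ax|Ax] := boolP (x \in A); last by rewrite !mul0r.
          have [Py|Py] := boolP (y \in P n); last by rewrite mulr0 mul0r.
          by exfalso; apply: zA; split; exact: set_mem.
        rewrite /f1 f2z mul0r !mulr0 addr0 mulr0 addr0 mul1r -expr2.
        exact: ler_wpM2r.
      have [[Ox wx] Py] := zA; rewrite /= in wx.
      have dy : d <= w y by move: Py; rewrite /P /= in_itv /= andbT => /ltW.
      have f2k : f2 (x, y) = k (x, y) by rewrite /f2 !indicE /= !mem_set// !mul1r.
      rewrite /f1 f2k /=; have kK : k (x, y) <= kern s (x, y) by rewrite ge_min lexx.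
      have b2 := picone_gap e0 (cutoff01 x) (cutoff01 y) d0 dy.
      move: b1; rewrite wx add0r => b1; move: b1 b2 K0 kK (k0 (x, y)); rewrite -!expr2.
      move: ((e - (w y + e)) * _) ((cutoff x - cutoff y) ^+ 2) (kern s (x, y)) (k (x, y)) => q r K k' b1 b2 K0 kK k'0.
      have -> : 1 * (r * K) + -1 * (d / e * (k' * cutoff x ^+ 2) + -2 * k') =
        r * K - (cutoff x ^+ 2 * d / e - 2) * k' by ring.
      move: (cutoff x ^+ 2 * d / e - 2) b2 => g b2.
      (* Replacing the kernel by its cap weakens the gain only if g >= 0; for g < 0 the plain Picone
         inequality is already stronger. *)
      have [g0|g0] := leP 0 g.
        apply: (@le_trans _ _ ((r - g) * K)); first exact: ler_wpM2r.
        by rewrite mulrBl lerD2l lerN2 ler_wpM2l.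
      apply: (@le_trans _ _ (r * K)); first exact: ler_wpM2r.
      by rewrite lerDl oppr_ge0 mulr_le0_ge0// ltW.
    move: dE; rewrite (Rintegral_lin _ _ i4 i5) (Rintegral_lin _ _ i1 i2).
    rewrite -!/(ip mu2 _ _) /aform /En => dE.
    have : M * ip mu w phi <= M * ip mu cutoff cutoff by rewrite ler_wpM2l.
    move: dE; move: (d / e * _) (M * ip mu w phi) (ip mu2 (du s w) (du s phi)).
    move=> p q r; rewrite -mulrA; move: (M * _) (ip mu2 _ _) (\int[mu2]_z f2 z) => x y z; lra.
  have f1le : \int[mu2]_z f1 z <= 0.
    rewrite leNgt; apply/negP => I0; set I := \int[mu2]_z f1 z in I0 main.
    pose B := 2 * En s cutoff cutoff + 2 * \int[mu2]_z f2 z + 2 * M * ip mu cutoff cutoff.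
    (* This e turns the left side of [main] into |B| + 1, which exceeds the bound B. *)
    pose e : R := d * I / (`|B| + 1); have B1 : 0 < `|B| + 1 by rewrite ltr_wpDl.
    have e0 : 0 < e by rewrite divr_gt0// mulr_gt0.
    have := main e e0; rewrite -/B.
    have -> : d / e * I = `|B| + 1 by rewrite /e; field; rewrite !gt_eqF.
    by move/le_trans/(_ (ler_norm B)); move: `|B| => r; lra.
  have f1_0 z : 0 <= f1 z by rewrite /f1 mulr_ge0 ?sqr_ge0.
  have ae1 := Rintegral_eq0_ae i1 f1_0 f1le.
  have nAP : mu2.-negligible (A `*` P n).
    apply: negligibleS ae1 => -[x y] [/= Ax Py] /=.
    rewrite /f1 /f2 !indicE /= !mem_set// !mul1r => /eqP.
    rewrite mulf_eq0 sqrf_eq0 => /orP[]; apply/negP; rewrite gt_eqF//.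
      rewrite lt_min ltr01 andbT; apply: kern_gt0 => xy.
      move: Py; rewrite /P -xy /= in_itv /= andbT; case: Ax => _ /= ->.
      by rewrite ltNge invr_ge0 ler0n.
    by apply: cutoff_gt0 => //; case: Ax.
  have : (mu2 (A `*` P n) = 0)%E.
    by apply/negligibleP => //; exact: measurableX.
  move=> /(etrans (esym (product_measure1E mu mu mA (mP n))))/eqP.
  by rewrite mule_eq0 => /orP[/eqP|/eqP]; [left|right].
have [A0|A0] := pselect (mu A = 0)%E.
  right; exists A; split => // x /= nx; split; apply: contrapT => h; apply: nx => //.
  by move=> Ox; rewrite lt_neqAle w0 andbT eq_sym; apply/eqP.
left; have P0 n : mu.-negligible (P n).
  by apply/negligibleP => //; case: (null n).
apply: negligibleS (negligible_bigcup P0) => x /= /eqP wx.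
have wx0 : 0 < w x by rewrite lt_neqAle w0 andbT eq_sym.
exists (Num.truncn (w x)^-1) => //; rewrite /P /= in_itv /= andbT.
by rewrite invf_plt ?posrE// truncnS_gt.
Qed.

End maximum_principle.

(** * A primitive and the mean value theorem *)

Section antiderivative.
Context (R : realType).
Implicit Types (f F : R -> R).

(** The integral starts at -1 and runs up to 2 so that the derivative is two-sided at both ends of
    [0, 1]. *)
Lemma antiderivative f : continuous f -> exists2 F, F 0 = 0 &
  forall x : R, -1 < x < 2 -> is_derive x 1 F (f x).
Proof.
move=> cf; pose F0 x := \int[lebesgue_measure]_(t in `[-1, x]) f t.
have fi : lebesgue_measure.-integrable `[-1, 2] (EFin \o f).
  by apply: continuous_compact_integrable; [exact: segment_compact|exact: continuous_subspaceT].
exists (fun x => F0 x - F0 0) => [|x /andP[x1 x2]]; first by rewrite subrr.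
have [dF F'] := @continuous_FTC1 R f (BLeft (-1)) x 2 x2 fi x1 (cf x).
have : is_derive x 1 F0 (f x) by split; [exact: dF|rewrite -derive1E].
move=> h; have -> : (fun y => F0 y - F0 0) = F0 - cst (F0 0) by [].
have -> : f x = f x - 0 by rewrite subr0.
exact: is_deriveB.
Qed.

Lemma mean_value F f (a b : R) : (forall x : R, -1 < x < 2 -> is_derive x 1 F (f x)) ->
  0 <= a -> a < b -> b <= 1 -> exists2 c, a < c < b & F b - F a = f c * (b - a).
Proof.
move=> dF a0 ab b1.
have [||c cab E] := @MVT R F f a b ab.
- by move=> x; rewrite in_itv /= => /andP[? ?]; apply: dF; apply/andP; split; lra.
- apply: continuous_in_subspaceT => x; rewrite inE /= in_itv /= => /andP[ax xb].
  have d : is_derive x 1 F (f x) by apply: dF; apply/andP; split; lra.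
  by apply/differentiable_continuous/derivable1_diffP; case: d.
by exists c => //; move: cab; rewrite in_itv.
Qed.

End antiderivative.

(** * The energy well around zero *)

Section well.
Context (R : realType) (s : R) (N : nat) (Omega : set 'rV[R]_N).
Local Notation mu := (@lebesgue_rV R N).
Local Notation T := (lebesgue_space R N).
Local Notation Xz := (Xz s Omega).
Hypothesis s0 : 0 < s.
Variable L : R.
Hypothesis L0 : 0 < L.
Hypothesis OL : forall x, Omega x -> `|x| < L.
Hypothesis N0 : (0 < N)%N.
Variables (M : R) (H : R -> R).
Hypothesis mH : measurable_fun setT H.
Hypothesis H_ge0 : forall t, 0 <= t <= 1 -> 0 <= H t.
Hypothesis H_small : forall e : R, 0 < e -> exists d C : R, [/\ 0 < d, 0 <= C &
  forall t, 0 <= t <= 1 -> H t <= (M / 2 + e) * t ^+ 2 + C * Num.max (t - d) 0 ^+ 2].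

(* The truncation (u - d)^+ is supported on a set whose measure tends to 0
   with the energy of u, and on such functions the L2 norm is controlled by an
   arbitrarily small multiple of the energy; this replaces the subcritical
   Sobolev embedding. *)
Lemma well_radius : exists2 rho : R, 0 < rho & forall u, Xz u ->
  (forall x, 0 <= u x <= 1) -> En s u u <= rho -> En s u u / 4 <= J s M H u.
Proof.
have LF := L2_form mu; have EF := En_form s Omega.
have [Cp Cp0 CpP] := poincare s0 L0 OL N0.
(* The constants leave En/8 for the quadratic error and, through [e1], En/8 for the truncated part.
   The term M/2 cancels with the shift, so J >= En/2 - En/4. *)
have e0 : 0 < (8 * Cp)^-1 by rewrite invr_gt0 mulr_gt0.
have [d [C [d0 C0 HdC]]] := H_small e0.
have C1 : 0 < C + 1 by rewrite ltr_wpDl.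
have e1 : 0 < (16 * (C + 1))^-1 by rewrite invr_gt0 mulr_gt0.
have [I [D [C2 [C20 mD Df fr]]]] := finite_rank s0 L0 OL N0 e1.
(* By Chebyshev the support of (u - d)^+ has measure at most d^-2 Cp En. Hence for En <= 1/(2K) the
   averages cost at most half of the squared L^2 norm of (u - d)^+ and can be absorbed. *)
pose K := C2 * #|I|%:R * (d ^- 2 * Cp) + 1.
have K0 : 0 < K.
  by rewrite ltr_wpDl// !mulr_ge0// ?invr_ge0 ?sqr_ge0// ltW.
exists (2 * K)^-1 => [|u Xu u01 Eu]; first by rewrite invr_gt0 mulr_gt0.
have [mu_ uO Lu Ldu] := Xu.
pose w : T -> R := fun x => Num.max (u x - d) 0.
have mw : measurable_fun setT w.
  apply: measurable_maxr; last exact: measurable_cst.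
  by apply: measurable_funB; [exact: mu_|exact: measurable_cst].
have wu x y : `|w x - w y| <= `|u x - u y|.
  apply: le_trans (pos_lipschitz _ _) _; rewrite (_ : u x - d - (u y - d) = u x - u y)//.
  by ring.
have wO x : ~ Omega x -> w x = 0 by move=> Ox; rewrite /w uO// max_r// sub0r oppr_le0 ltW.
have Xw : Xz w.
  apply: (Xz_dominated Xu (Xz0 s Omega) mw wO) => [x|x y].
    have /andP[u0 u1] := u01 x; rewrite normr0 addr0 (ger0_norm u0) /w.
    by have [h|h] := leP (u x - d) 0; rewrite ?normr0// ger0_norm; lra.
  by rewrite subrr normr0 addr0.
have [_ _ Lw Ldw] := Xw.
have Ewu : En s w w <= En s u u.
  apply: (@le_En _ _ _ Omega) => // x y; rewrite -!expr2 -[leLHS]real_normK ?num_real//.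
  by rewrite -[leRHS]real_normK ?num_real// lerXn2r ?nnegrE.
pose S : set T := w @^-1` `]0, +oo[%classic.
have mS : measurable S.
  by rewrite -[X in measurable X]setTI; apply: mw => //; exact: measurable_itv.
have Su x : \1_S x <= d^-1 * u x.
  have /andP[ux0 ux1] := u01 x.
  rewrite indicE; have [Sx|Sx] := boolP (x \in S); last by rewrite mulr_ge0 ?invr_ge0 ?(ltW d0).
  move: (set_mem Sx); rewrite /S /= in_itv /= andbT /w lt_max ltxx orbF subr_gt0 => h.
  by rewrite ler_pdivlMl// mulr1 ltW.
have LS0 := L2_lin d^-1 0 Lu Lu.
have mI : measurable_fun setT (\1_S : T -> R) by exact: measurable_indic.
have SI x : `|(\1_S x : R)| <= `|lin d^-1 u 0 u x|.
  rewrite /lin mul0r addr0 ger0_norm ?indicE//; rewrite -indicE.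
  by apply: le_trans (Su x) _; exact: ler_norm.
have LS : L2 mu \1_S by exact: L2_dominated SI.
have ipS : ip mu \1_S \1_S <= d ^- 2 * (Cp * En s u u).
  apply: le_trans (ip_dominated mI LS0 SI) _.
  rewrite (psd_quad LF)// mulr0 mul0r expr0n /= mul0r !addr0 exprVn.
  by rewrite ler_wpM2l ?invr_ge0 ?sqr_ge0// CpP.
have ww0 : 0 <= ip mu w w by exact: psd_ge0 LF _ Lw.
(* Since w vanishes off S, Cauchy-Schwarz is applied on S, so the factor is the small measure of S
   and not that of the cell. *)
have ipDw i : ip mu \1_(D i) w ^+ 2 <= d ^- 2 * (Cp * En s u u) * ip mu w w.
  have LD := L2_indic (mD i) (Df i).
  have LDS : L2 mu (cutset (D i) \1_S) by exact: L2_cutset.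
  have -> : ip mu \1_(D i) w = ip mu (cutset (D i) \1_S) w.
    apply: eq_Rintegral => x _; rewrite /cutset -mulrA; congr (_ * _).
    rewrite indicE; have [Sx|Sx] := boolP (x \in S); first by rewrite mul1r.
    rewrite mul0r /w max_r//; rewrite leNgt; apply/negP => h; move/negP: Sx; apply.
    by rewrite inE /S /= in_itv /= andbT /w lt_max h.
  apply: le_trans (psd_CS LF LDS Lw) _; rewrite ler_wpM2r//.
  apply: le_trans ipS; apply: ip_dominated => //; first by case: LDS.
  move=> x; rewrite /cutset normrM ler_piMl// indicE.
  by case: (_ \in _); rewrite ?normr1 ?normr0.
have Eu0 : 0 <= En s u u by exact: psd_ge0 EF _ Xu.
have sumD : C2 * \sum_i ip mu \1_(D i) w ^+ 2 <= ip mu w w / 2.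
  apply: (@le_trans _ _ (C2 * (#|I|%:R * (d ^- 2 * (Cp * En s u u) * ip mu w w)))).
    by rewrite ler_wpM2l// mulr_natl -sumr_const; apply: ler_sum => i _.
  have -> : C2 * (#|I|%:R * (d ^- 2 * (Cp * En s u u) * ip mu w w)) =
    C2 * #|I|%:R * (d ^- 2 * Cp) * En s u u * ip mu w w by ring.
  rewrite [leRHS]mulrC ler_wpM2r//.
  apply: (@le_trans _ _ (K * (2 * K)^-1)); last by rewrite invfM mulrCA mulfV ?mulr1// gt_eqF.
  apply: ler_pM => //; last by rewrite /K lerDl.
  by rewrite !mulr_ge0// ?invr_ge0 ?sqr_ge0// ltW.
have wE : ip mu w w <= (8 * (C + 1))^-1 * En s u u.
  have h := fr w Xw.
  have h' : (16 * (C + 1))^-1 * En s w w <= (16 * (C + 1))^-1 * En s u u.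
    by rewrite ler_wpM2l// ltW.
  have -> : (8 * (C + 1))^-1 * En s u u = 2 * ((16 * (C + 1))^-1 * En s u u).
    by field; rewrite gt_eqF.
  move: h h' sumD; move: (_ * En s w w) (_ * En s u u) (C2 * _) (ip mu w w) => p q r t; lra.
have iuu := L2_integrable_prod Lu Lu; have iww := L2_integrable_prod Lw Lw.
have HdC' x := HdC _ (u01 x).
have ibnd := integrable_lin (M / 2 + (8 * Cp)^-1) C iuu iww.
have iH : mu.-integrable setT (EFin \o (H \o u)).
  apply: integrable_dominated ibnd _; first exact: measurableT_comp.
  by move=> x; rewrite /= ger0_norm ?H_ge0// /lin -!expr2.
have HI : \int[mu]_x H (u x) <= (M / 2 + (8 * Cp)^-1) * ip mu u u + C * ip mu w w.
  by rewrite /ip -Rintegral_lin//; exact: le_Rintegral.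
have c1 : (8 * Cp)^-1 * ip mu u u <= En s u u / 8.
  rewrite invfM -mulrA mulrC ler_wpM2r// ler_pdivrMl//; exact: CpP.
have c2 : C * ip mu w w <= En s u u / 8.
  apply: (@le_trans _ _ ((C + 1) * ((8 * (C + 1))^-1 * En s u u))).
    by rewrite ler_pM// lerDl.
  by rewrite le_eqVlt; apply/orP; left; apply/eqP; field; rewrite gt_eqF.
rewrite /J /aform; move: HI c1 c2; rewrite mulrDl.
have -> : M / 2 * ip mu u u = M * ip mu u u / 2 by ring.
move: (\int[mu]_x _) (_^-1 * ip mu u u) (C * _) (M * _) (En s u u) => p q r t y; lra.
Qed.

End well.

(** * From the form to weak solutions; supersolutions *)

Section weak_solutions.
Context (R : realType) (s : R) (N : nat) (Omega : set 'rV[R]_N).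
Local Notation mu := (@lebesgue_rV R N).
Local Notation mu2 := (mu \x mu)%E.
Local Notation T := (lebesgue_space R N).
Local Notation Xz := (Xz s Omega).
Implicit Types (u v w phi b z : T -> R).
Hypothesis mO : measurable (Omega : set T).
Hypothesis Of : (mu Omega < +oo)%E.

Let measurable_Qset : measurable (Qset Omega).
Proof. by apply: measurableC; apply: measurableX; exact: measurableC. Qed.

Lemma Xz_Xs0 u : Xz u -> Xs0 s Omega u.
Proof.
move=> [mu_ uO [_ iu] [mdu idu]]; split; last by apply: aeW => x; exact: uO.
split => //.
- split; first exact: measurable_funTS.
  exact: integrableS iu.
- split; first exact: measurable_funTS.
  exact: integrableS idu.
Qed.

Let restrict v : T -> R := fun x => \1_Omega x * v x.

Let L2_ae_eq d (T' : measurableType d) (m : {measure set T' -> \bar R}) (f g : T' -> R) :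
  measurable_fun setT f -> measurable_fun setT g ->
  m.-integrable setT (EFin \o g) -> {ae m, forall x, f x ^+ 2 = g x} -> L2 m f.
Proof.
move=> mf mg ig fg; split => //.
have mf2 : measurable_fun setT (fun x => (f x ^+ 2)%:E).
  by apply/measurable_EFinP; exact: measurable_funX.
apply/integrableP; split => //; have /integrableP[mg' ig'] := ig.
rewrite (_ : (\int[m]_x `|(f x ^+ 2)%:E|)%E = (\int[m]_x `|(EFin \o g) x|)%E)//.
apply: ge0_ae_eq_integral => //; try exact: measurableT_comp.
by apply: filterS fg => x + _ /=; move=> ->.
Qed.

Let restrictE v x : ~ Omega x -> restrict v x = 0.
Proof. by move=> Ox; rewrite /restrict indicE memNset// mul0r. Qed.

Let restrict_in v x : Omega x -> restrict v x = v x.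
Proof. by move=> Ox; rewrite /restrict indicE mem_set// mul1r. Qed.

(** Multiplying v by the indicator of Omega changes it on a null set only. Outside [Qset Omega] both
    points avoid Omega and the new increments vanish, so integrability over Q extends to all
    pairs. *)
Lemma Xs0_Xz v : Xs0 s Omega v -> exists2 w, Xz w &
  {ae mu, forall x, v x = w x} /\ forall x, Omega x -> v x = w x.
Proof.
move=> [[mv [_ iv] [_ idv]] vO].
have vr : {ae mu, forall x, v x = restrict v x}.
  apply: (@filterS _ _ (ae_filter_ringOfSetsType mu) _ _ _ vO) => x vx.
  have [Ox|Ox] := pselect (Omega x); first by rewrite restrict_in.
  by rewrite restrictE// vx.
exists (restrict v); last by split => // x Ox; rewrite restrict_in.
have mr : measurable_fun setT (restrict v).
  by apply: measurable_funM => //; exact: measurable_indic.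
split => //; first exact: restrictE.
- split => //; rewrite integrable_mkcond// in iv.
  apply: eq_integrable iv => // x _; rewrite /patch.
  have [Ox|Ox] := boolP (x \in Omega); first by rewrite restrict_in//; exact: set_mem.
  by rewrite restrictE ?expr0n// => h; move/negP: Ox; apply; exact: mem_set.
- rewrite integrable_mkcond// in idv.
  pose g (z : T * T) : R := \1_(Qset Omega) z * du s v z ^+ 2.
  apply: (@L2_ae_eq _ _ mu2 _ g).
  + exact: measurable_du.
  + apply: measurable_funM; first exact: measurable_indic.
    by apply: measurable_funX; exact: measurable_du.
  + apply: eq_integrable idv => // z _; rewrite /patch /g /= indicE.
    by case: (_ \in _); rewrite ?mul1r ?mul0r.
  have r1 := ae_prod1 mu vr; have r2 := ae_prod2 mu vr.
  apply: filterS2 r1 r2 => -[x y] /= vx vy; rewrite /g indicE.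
  have [Qz|Qz] := boolP ((x, y) \in Qset Omega).
    by rewrite mul1r /du /= -vx -vy.
  have nn : (~` Omega `*` ~` Omega) (x, y).
    by apply: contrapT => h; move/negP: Qz; apply; exact: mem_set.
  by case: nn => /= nx ny; rewrite mul0r /du /= !restrictE// subrr mul0r expr0n.
Qed.

Lemma weak_solution_of_form (lam : R) (f : R -> R) u : Xz u ->
  L2 mu (f \o u) ->
  (forall phi, Xz phi -> En s u phi = lam * ip mu (f \o u) phi) ->
  weak_solution s Omega lam f u.
Proof.
move=> Xu Lf uE; split; first exact: Xz_Xs0.
move=> v Xv; have [w Xw [vw vwO]] := Xs0_Xz Xv.
have [mv _ _] := Xv.1; have [m_u uO Lu Ldu] := Xu; have [mw wO Lw Ldw] := Xw.
have E1 : (\int[mu2]_z ((u z.1 - u z.2) * (v z.1 - v z.2) *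
    frac_kernel s (z.1 - z.2 : 'rV[R]_N))%:E = (ip mu2 (du s u) (du s w))%:E)%E.
  rewrite /ip /Rintegral fineK; last first.
    exact: integrable_fin_num (L2_integrable_prod Ldu Ldw).
  apply: ae_eq_integral => //.
  - apply/measurable_EFinP; apply: measurable_funM; last exact: measurable_kern.
    apply: measurable_funM.
      by apply: measurable_funB; [exact: measurable_comp_fst|exact: measurable_comp_snd].
    by apply: measurable_funB; [exact: measurable_comp_fst|exact: measurable_comp_snd].
  - exact: measurable_int (L2_integrable_prod Ldu Ldw).
  have r1 := ae_prod1 mu vw; have r2 := ae_prod2 mu vw.
  by apply: filterS2 r1 r2 => z vx vy _; rewrite du_mul vx vy.
have E2 : (\int[mu]_(x in Omega) (f (u x) * v x)%:E = (ip mu (f \o u) w)%:E)%E.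
  rewrite /ip /Rintegral fineK; last first.
    exact: integrable_fin_num (L2_integrable_prod Lf Lw).
  rewrite [LHS]integral_mkcond; apply: eq_integral => x _; rewrite /patch.
  have [Ox|Ox] := boolP (x \in Omega); first by rewrite /= (vwO x)//; exact: set_mem.
  by rewrite (wO x) ?mulr0// => h; move/negP: Ox; apply; exact: mem_set.
rewrite E1 E2 -!EFinM; congr EFin; rewrite -uE//.
by rewrite /En mulrC.
Qed.

Lemma open_lebesgue_gt0 : open Omega -> Omega !=set0 -> (0 < mu Omega)%E.
Proof.
move=> oO [x Ox]; have /nbhs_ballP[e /= e0 be] := open_nbhs_nbhs (conj oO Ox).
pose B := Some (x, x + const_mx (e / 2)) : option ('rV[R]_N * 'rV[R]_N).
have BO : box B `<=` Omega.
  move=> y By; apply: be; rewrite -ball_normE /=.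
  apply: (@le_lt_trans _ _ (e / 2)); last by lra.
  apply/mxnorm_leP => [|i]; first by lra.
  have := By i; rewrite !mxE ler_norml; move: (x 0 i) (y 0 i) => p q /andP[? ?].
  by apply/andP; split; lra.
apply: (@lt_le_trans _ _ (mu (box B))); last exact: le_outer_measure.
rewrite lebesgue_box /= lte_fin; apply: prodr_gt0 => i _.
by rewrite !mxE lt_max; apply/orP; right; lra.
Qed.

Variables (M : R) (h : R -> R).
Hypothesis M0 : 0 < M.
Hypothesis h0 : h 0 = 0.
Hypothesis h1 : h 1 = M.

(** f(1) = 0 enters as h(1) = M: the constant 1 solves the shifted equation. Since z vanishes
    outside Omega, (z - b)^+ equals (z - 1)^+, whose increments are controlled by those of z. *)
Lemma supersolution_indic : supersolution s Omega M h \1_Omega.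
Proof.
move=> z Xzz z0; have [mz zO Lz Ldz] := Xzz.
set phi := pos _; have phiE x : phi x = Num.max (z x - 1) 0.
  rewrite /phi /pos /lin mul1r mulN1r indicE.
  have [Ox|Ox] := pselect (Omega x); first by rewrite mem_set.
  by rewrite memNset// zO// subr0 sub0r !max_r// oppr_le0 ler01.
have mphi : measurable_fun setT phi.
  apply: measurable_maxr => //.
  exact: L2_measurable (L2_lin 1 (-1) Lz (L2_indic mO Of)).
have Xphi : Xz phi.
  apply: (Xz_dominated Xzz (Xz0 s Omega) mphi) => [x Ox|x|x y].
  - by rewrite phiE zO// sub0r max_r// oppr_le0 ler01.
  - have := z0 x; rewrite phiE normr0 addr0; move: (z x) => t t0.
    by rewrite (ger0_norm t0); have [|] := leP (t - 1) 0 => ?; rewrite ?normr0// ger0_norm; lra.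
  - rewrite !phiE subrr normr0 addr0; apply: le_trans (pos_lipschitz _ _) _.
    by rewrite (_ : z x - 1 - (z y - 1) = z x - z y)//; ring.
split => //; have [_ _ Lphi Ldphi] := Xphi.
have LI := L2_indic mO Of; have LF := L2_form mu.
have hE : h \o \1_Omega = lin M \1_Omega 0 \1_Omega.
  apply/funext => x; rewrite /lin mul0r addr0 /= indicE.
  by case: (_ \in _); rewrite ?mulr1 ?mulr0 ?h0 ?h1.
have Lh : L2 mu (h \o \1_Omega) by rewrite hE; exact: L2_lin.
have E1 : En s phi phi <= En s z phi.
  apply: (@le_En _ _ _ Omega) => // x y; rewrite -expr2 !phiE.
  apply: le_trans (pos_monotone _ _) _.
  by rewrite (_ : z x - 1 - (z y - 1) = z x - z y)//; ring.
have E2 : ip mu (lin 1 (h \o \1_Omega) M phi) phi <= ip mu (lin M z 0 z) phi.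
  apply: le_ip => //; [exact: L2_lin|exact: L2_lin|move=> x].
  rewrite hE /lin mul0r !addr0 mul1r phiE; have [Ox|Ox] := pselect (Omega x); last first.
    by rewrite zO// sub0r max_r ?mulr0// oppr_le0 ler01.
  rewrite indicE mem_set// mulr1; move: (z x) => t.
  have [|] := leP (t - 1) 0 => _; first by rewrite !mulr0.
  by rewrite (_ : M + M * (t - 1) = M * t + 0 * t)//; ring.
move: E2; rewrite !(psd_linl LF)// /aform mul0r addr0 mul1r; move: E1.
move: (ip mu (h \o _) phi) (M * ip mu phi phi) (M * ip mu z phi) (En _ _ _) (En _ _ _) => p q r x y.
by lra.
Qed.

Lemma supersolution_solves b v : solves s Omega M h b v v ->
  supersolution s Omega M h v.
Proof.
move=> [Xv _ vE] z Xzz _; have aF := aform_form s Omega (ltW M0).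
have Xd := Xz_lin 1 (-1) Xzz Xv; have Xp := Xz_pos Xd; split => //.
rewrite -vE//; have := aform_pos (ltW M0) Xd; set phi := pos _ in Xp *.
by rewrite (psd_linl aF)//; move: (aform _ _ _ _) (aform _ _ _ _) (aform _ _ _ _) => p q r; lra.
Qed.

End weak_solutions.

(** * Calculus for the nonlinearity *)

Lemma is_derive_add_square (R : realType) (G f : R -> R) (k x : R) :
  is_derive x 1 G (f x) ->
  is_derive x 1 (fun y => G y + k * (y * y)) (f x + 2 * k * x).
Proof.
move=> dG.
have h1 : is_derive x 1 (id * id : R -> R) (x *: 1 + x *: 1) by exact: is_deriveM.
have h2 := is_deriveZ k h1; have h3 := is_deriveD dG h2.
apply: is_derive_eq h3 _; rewrite /GRing.scale /=; ring.
Qed.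

Lemma superlinear_at0 (R : realType) (f : R -> R) (p e : R) : 1 < p -> 0 < e ->
  f t / (`|t| `^ (p - 1) * t) @[t --> 0^'+] --> (1 : R) ->
  exists2 d : R, 0 < d & forall t : R, 0 < t < d -> f t <= e * t.
Proof.
move=> p1 e0 F1; have e2 : 0 < e / 2 by rewrite divr_gt0.
have /cvgrPdist_lt/(_ 1 ltr01)/nbhs_ballP[d0 /= d00 hd] := F1.
have q0 : 0 < p - 1 by rewrite subr_gt0.
(* For t < d1 one has t^(p-1) <= e/2, while f(t) < 2 t^p near 0. *)
pose d1 := (e / 2) `^ (p - 1)^-1; have d10 : 0 < d1 by exact: powR_gt0.
exists (Num.min d0 d1) => [|t /andP[t0]]; first by rewrite lt_min d00.
rewrite lt_min => /andP[td0 td1].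
have : `|1 - f t / (`|t| `^ (p - 1) * t)| < 1.
  by apply: hd => //; rewrite -ball_normE /= sub0r normrN gtr0_norm.
have T0 : 0 < `|t| `^ (p - 1) * t by rewrite mulr_gt0// powR_gt0// normr_gt0 gt_eqF.
rewrite ltr_norml => /andP[h _].
have {}h : f t / (`|t| `^ (p - 1) * t) < 2 by move: h; move: (f t / _) => r; lra.
rewrite ltr_pdivrMr// in h; apply: (le_trans (ltW h)).
rewrite mulrA ler_wpM2r ?(ltW t0)// -ler_pdivlMl// mulrC.
have -> : e / 2 = d1 `^ (p - 1) by rewrite /d1 -powRrM mulVf ?powRr1 ?gt_eqF ?(ltW e2).
rewrite gtr0_norm//; apply: (ge0_ler_powR (ltW q0)); rewrite ?nnegrE ?ltW//.
Qed.

(** * Construction of the two solutions *)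

Section two_solutions.
Context (R : realType) (s : R) (N : nat) (Omega : set 'rV[R]_N) (f : R -> R) (M0 : R).
Local Notation mu := (@lebesgue_rV R N).
Local Notation T := (lebesgue_space R N).
Local Notation Xz := (Xz s Omega).
Implicit Types (u v w y phi : T -> R).
Hypothesis s01 : 0 < s < 1.
Hypothesis N0 : (0 < N)%N.
Hypothesis oO : open Omega.
Hypothesis O0 : Omega !=set0.
Variable L : R.
Hypothesis L0 : 0 < L.
Hypothesis OL : forall x, Omega x -> `|x| < L.
Hypothesis f_ge0 : forall t, 0 <= f t.
Hypothesis f_cont : continuous f.
Hypothesis f1 : f 1 = 0.
Hypothesis f_gt0 : forall t : R, 0 < t < 1 -> 0 < f t.
Hypothesis f_small : forall e : R, 0 < e ->
  exists2 d : R, 0 < d & forall t : R, 0 < t < d -> f t <= e * t.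
Hypothesis M0_gt0 : 0 < M0.
Hypothesis f_mono : {homo (fun t : R => f t + M0 * t) : t1 t2 / t1 <= t2}.

Let s0 : 0 < s. Proof. by case/andP: s01. Qed.

Let mO : measurable (Omega : set T). Proof. exact: open_lebesgue_measurable. Qed.

Let Of : (mu Omega < +oo)%E.
Proof.
have [mc cL] := @lebesgue_cball_le R N 0 L (ltW L0).
apply: (@le_lt_trans _ _ (mu (cball 0 L))); last exact: le_lt_trans cL (ltry _).
apply: le_outer_measure => x Ox; rewrite /cball /= sub0r normrN.
by apply: ltW; exact: OL.
Qed.

Let f0 : f 0 = 0.
Proof.
apply/le_anti; rewrite f_ge0 andbT leNgt; apply/negP => f00.
have [d d0 hd] := f_small ltr01.
have e0 : 0 < f 0 / 2 by rewrite divr_gt0.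
have /cvgrPdist_lt/(_ _ e0)/nbhs_ballP[r /= r0 hr] := @f_cont 0.
pose m := Num.min (Num.min d r) (f 0 / 2).
have m0 : 0 < m by rewrite !lt_min d0 r0.
have md : m <= d by rewrite !ge_min lexx.
have mr : m <= r by rewrite !ge_min lexx orbT.
have mf : m <= f 0 / 2 by rewrite ge_min lexx orbT.
have h1 : f (m / 2) <= 1 * (m / 2) by apply: hd; apply/andP; split; lra.
have : `|f 0 - f (m / 2)| < f 0 / 2.
  by apply: hr; rewrite -ball_normE /= sub0r normrN gtr0_norm; lra.
rewrite ltr_norml => /andP[_]; move: h1 mf m0; move: (f (m / 2)) (m) => a c; lra.
Qed.

Let f_leM0 t : 0 <= t <= 1 -> f t <= M0.
Proof.
move=> /andP[t0 t1]; have := f_mono t1; rewrite f1 add0r mulr1; apply: le_trans.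
by rewrite lerDl mulr_ge0// ltW.
Qed.

Let clamp (t : R) := Num.min (Num.max t 0) 1.

Let clamp01 t : 0 <= clamp t <= 1.
Proof. by rewrite /clamp !(le_min, ge_min, le_max, lexx, ler01, orbT). Qed.

Let clamp_id t : 0 <= t <= 1 -> clamp t = t.
Proof. by move=> /andP[t0 t1]; rewrite /clamp max_l// min_l. Qed.

Let primitive : exists G : R -> R, [/\ measurable_fun setT G /\ G 0 = 0,
  (forall t : R, 0 <= t <= 1 -> 0 <= G t <= M0 * t), (forall t : R, 0 < t <= 1 -> 0 < G t),
  (forall e : R, 0 < e -> exists2 d : R, 0 < d & forall t : R, 0 <= t <= 1 -> t < d -> G t <= e * t ^+ 2) &
  forall t t' : R, 0 <= t <= 1 -> 0 <= t' <= 1 ->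
    (f t + M0 * t) * (t' - t) <= (G t' + M0 / 2 * t' ^+ 2) - (G t + M0 / 2 * t ^+ 2)].
Proof.
have [F F0 dF] := antiderivative f_cont.
have mv a b := @mean_value R F f a b dF.
have Fle a b : 0 <= a -> a <= b -> b <= 1 -> F a <= F b.
  move=> a0; rewrite le_eqVlt => /orP[/eqP -> //|ab] b1.
  have [c _ E] := mv a b a0 ab b1.
  by rewrite -subr_ge0 E mulr_ge0// subr_ge0 ltW.
have Ft t : 0 < t -> t <= 1 -> exists2 c, 0 < c < t & F t = f c * t.
  by move=> t0 t1; have [c ct] := mv 0 t (lexx _) t0 t1; rewrite F0 !subr0; exists c.
(* F is controlled near [0, 1] only; composed with [clamp] it is monotone on the whole line, hence
   measurable. *)
exists (fun t => F (clamp t)); split.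
- split; last by rewrite clamp_id// lexx ler01.
  apply: nondecreasing_measurable => // a c xy.
  have /andP[? ?] := clamp01 a; have /andP[? ?] := clamp01 c; apply: Fle => //.
  by rewrite /clamp !(le_min, ge_min, ge_max, le_max, xy, lexx, ler01, orbT).
- move=> t t01; rewrite clamp_id//; case/andP: t01 => t0 t1.
  rewrite -{1}F0 Fle//=; move: t0; rewrite le_eqVlt => /orP[/eqP <-|t0].
    by rewrite F0 mulr0.
  have [c /andP[c0 ct] ->] := Ft t t0 t1; rewrite ler_wpM2r ?(ltW t0)// f_leM0//.
  by rewrite (ltW c0) (le_trans (ltW ct)).
- move=> t /andP[t0 t1]; rewrite clamp_id ?(ltW t0)//.
  have [c /andP[c0 ct] ->] := Ft t t0 t1; rewrite mulr_gt0// f_gt0//.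
  by rewrite c0 (lt_le_trans ct).
- move=> e e0; have [d d0 hd] := f_small e0; exists d => // t t01 td.
  rewrite clamp_id//; case/andP: t01 => t0 t1.
  move: t0; rewrite le_eqVlt => /orP[/eqP <-|t0].
    by rewrite F0 expr0n mulr0.
  have [c /andP[c0 ct] ->] := Ft t t0 t1; rewrite expr2 mulrA ler_wpM2r ?(ltW t0)//.
  apply: (@le_trans _ _ (e * c)); first by apply: hd; rewrite c0 (lt_trans ct).
  by rewrite ler_wpM2l ?ltW.
have dH (x : R) : -1 < x < 2 -> is_derive x 1 (fun r : R => F r + M0 / 2 * (r * r)) (f x + M0 * x).
  move=> /dF/(is_derive_add_square (M0 / 2)).
  by rewrite (_ : 2 * (M0 / 2) * x = M0 * x)//; field.
have mvH a b := @mean_value R _ (fun x => f x + M0 * x) a b dH.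
move=> t t' t01 t'01; rewrite !clamp_id//; case/andP: t01 => t0 t1; case/andP: t'01 => t'0 t'1.
rewrite !expr2; have [tt|tt|->] := ltgtP t t'; last by rewrite !subrr mulr0.
- have [c /andP[/ltW tc _] ->] := mvH t t' t0 tt t'1.
  by rewrite ler_wpM2r ?subr_ge0 ?(ltW tt)//; exact: f_mono.
- have [c /andP[_ /ltW ct] E] := mvH t' t t'0 tt t1.
  rewrite -lerN2 -mulrN !opprB E ler_wpM2r ?subr_ge0 ?(ltW tt)//; exact: f_mono.
Qed.

Let b : T -> R := \1_Omega.
Let mb : measurable_fun setT b. Proof. exact: measurable_indic. Qed.
Let b01 x : 0 <= b x <= 1. Proof. by rewrite /b indicE; case: (_ \in _); rewrite lexx ler01. Qed.
Let b0 x : ~ Omega x -> b x = 0. Proof. by move=> Ox; rewrite /b indicE memNset. Qed.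

Let w0 : T -> R := lin 2^-1 (cutoff Omega) 0 (cutoff Omega).
Let Xw0 : Xz w0. Proof. by apply: Xz_lin; exact: Xz_cutoff. Qed.
Let w0E x : w0 x = cutoff Omega x / 2.
Proof. by rewrite /w0 /lin mul0r addr0 mulrC. Qed.
Let w001 x : 0 <= w0 x <= 1.
Proof. by rewrite w0E; have := cutoff_ge0 Omega x; have := cutoff_le1 Omega x; move: (cutoff _ _) => t ? ?; apply/andP; split; lra. Qed.
Let Kw0 : Kb b w0.
Proof.
split; first by case: Xw0.
move=> x; have /andP[-> /= h] := w001 x; have [Ox|Ox] := pselect (Omega x).
  by rewrite /b indicE mem_set.
by rewrite b0// w0E cutoff_eq0// mul0r.
Qed.

Lemma two_solutions : exists2 lam0 : R, 0 < lam0 & forall lam, lam0 < lam ->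
  exists u v : T -> R, [/\ weak_solution s Omega lam f u, weak_solution s Omega lam f v,
    ~ {ae mu, forall x, u x = 0}, ~ {ae mu, forall x, v x = 0} &
    {ae mu, forall x, Omega x -> [/\ 0 <= u x, u x < v x & v x <= 1]}].
Proof.
have [G [[mG G0] Gb G_pos G_small G_convex]] := primitive.
have LF := L2_form mu; have LI := L2_indic mO Of; have II := L2_integrable_prod LI LI.
have muO := open_lebesgue_gt0 oO O0.
have iG u : measurable_fun setT u -> (forall x, 0 <= u x <= 1) ->
    (forall x, ~ Omega x -> u x = 0) -> mu.-integrable setT (EFin \o (G \o u)).
  move=> mu_ u01 uO; apply: integrable_dominated (integrable_lin M0 0 II II) _.
    exact: measurableT_comp.
  move=> x; rewrite /lin mul0r addr0 indicE; have [Ox|Ox] := pselect (Omega x).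
    rewrite mem_set// !mulr1 /=; have /andP[? h] := Gb _ (u01 x); rewrite ger0_norm//.
    by apply: (le_trans h); rewrite ler_piMr ?(ltW M0_gt0)//; case/andP: (u01 x).
  by rewrite memNset// !mulr0 /= uO// G0 normr0.
have w0O x : ~ Omega x -> w0 x = 0 by move=> Ox; rewrite w0E cutoff_eq0// mul0r.
have mw0 : measurable_fun setT w0 by case: Xw0.
have iGw := iG w0 mw0 w001 w0O.
pose g := \int[mu]_x G (w0 x).
have g0 : 0 < g.
  rewrite ltNge; apply/negP => gle.
  have Gw0 x : 0 <= (G \o w0) x by have /andP[] := Gb _ (w001 x).
  have aeG := Rintegral_eq0_ae iGw Gw0 gle.
  have : mu.-negligible Omega.
    apply: negligibleS aeG => x Ox /=; apply/eqP; rewrite gt_eqF// G_pos//.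
    have /andP[_ ->] := w001 x; rewrite andbT w0E divr_gt0//.
    exact: cutoff_gt0.
  by move=> /(measure_negligible mO) h; move: muO; rewrite -[X in (0 < X)%E]/(_ Omega) h ltxx.
(* The shift cancels in J(w0) = En(w0)/2 - lam g, negative for lam > En(w0)/(2g). Adding 1 makes the
   threshold positive. *)
pose lam0 := En s w0 w0 / (2 * g) + 1.
have E0 : 0 <= En s w0 w0 by exact: psd_ge0 (En_form s Omega) _ Xw0.
have lam00 : 0 < lam0 by rewrite /lam0 ltr_wpDl// divr_ge0// mulr_ge0// ltW.
exists lam0 => // lam lamP; have lam_gt0 : 0 < lam by exact: lt_trans lamP.
pose M := lam * M0; have M_gt0 : 0 < M by rewrite mulr_gt0.
pose h t := lam * (f t + M0 * t).
pose H t := lam * (G t + M0 / 2 * t ^+ 2).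
have ch : continuous h.
  move=> t; apply: cvgM; first exact: cvg_cst.
  apply: cvgD; first exact: f_cont.
  by apply: cvgM; [exact: cvg_cst|exact: cvg_id].
have h0 : h 0 = 0 by rewrite /h f0 mulr0 addr0 mulr0.
have h1 : h 1 = M by rewrite /h f1 add0r mulr1.
have h_mono (t t' : R) : 0 <= t -> t <= t' -> t' <= 1 -> h t <= h t'.
  by move=> _ tt _; rewrite ler_wpM2l ?(ltW lam_gt0)//; exact: f_mono.
have mH : measurable_fun setT H.
  apply: measurable_funM => //; apply: measurable_funD => //.
  by apply: measurable_funM => //; apply: measurable_funX.
have H0 : H 0 = 0 by rewrite /H G0 expr0n /= mulr0 addr0 mulr0.
have H_convex (t t' : R) : 0 <= t <= 1 -> 0 <= t' <= 1 -> h t * (t' - t) <= H t' - H t.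
  by move=> t1 t2; rewrite /h /H -mulrA -mulrBr ler_wpM2l ?(ltW lam_gt0)// G_convex.
have H_ge0 (t : R) : 0 <= t <= 1 -> 0 <= H t.
  move=> t1; rewrite mulr_ge0 ?(ltW lam_gt0)// addr_ge0//; first by case/andP: (Gb _ t1).
  by rewrite mulr_ge0 ?sqr_ge0// divr_ge0// ltW.
have H_small (e : R) : 0 < e -> exists d C : R, [/\ 0 < d, 0 <= C &
    forall t : R, 0 <= t <= 1 -> H t <= (M / 2 + e) * t ^+ 2 + C * Num.max (t - d) 0 ^+ 2].
  move=> e0; have el : 0 < e / lam by rewrite divr_gt0.
  (* Cutting at d/2 makes t - d/2 >= d/2 for all t >= d, so the last term is then at least M, which
     bounds lam G(t); for t < d the quadratic bound suffices. *)
  have [d d0 hd] := G_small _ el; exists (d / 2), (M / (d / 2) ^+ 2).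
  have d2 : 0 < d / 2 by rewrite divr_gt0.
  have C0 : 0 <= M / (d / 2) ^+ 2 by rewrite divr_ge0 ?sqr_ge0// ltW.
  split => // t t01; rewrite /H mulrDr mulrDl.
  have -> : lam * (M0 / 2 * t ^+ 2) = M / 2 * t ^+ 2 by rewrite /M; ring.
  rewrite addrC -addrA lerD2l; have [td|td] := ltP t d.
    apply: (@le_trans _ _ (e * t ^+ 2)).
      have := hd t t01 td; rewrite -(ler_pM2l lam_gt0) => /le_trans; apply.
      by rewrite le_eqVlt; apply/orP; left; apply/eqP; field; rewrite gt_eqF.
    by rewrite lerDl mulr_ge0// sqr_ge0.
  apply: (@le_trans _ _ M).
    rewrite /M ler_pM2l//; have /andP[_ hG] := Gb _ t01; apply: (le_trans hG).
    by rewrite ler_piMr ?(ltW M0_gt0)//; case/andP: t01.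
  apply: (@le_trans _ _ (M / (d / 2) ^+ 2 * (d / 2) ^+ 2)).
    by rewrite divfK// gt_eqF// exprn_gt0.
  rewrite -[leLHS]add0r; apply: lerD.
    by apply: mulr_ge0; [exact: ltW|exact: sqr_ge0].
  apply: ler_wpM2l => //.
  have m0 : 0 <= Num.max (t - d / 2) 0 by rewrite le_max lexx orbT.
  rewrite lerXn2r ?nnegrE ?(ltW d2)// le_max; apply/orP; left; lra.
have aF := aform_form s Omega (ltW M_gt0).
have step (b' : T -> R) : measurable_fun setT b' -> (forall x, 0 <= b' x <= 1) ->
    (forall x, ~ Omega x -> b' x = 0) -> supersolution s Omega M h b' ->
    exists S : (T -> R) -> T -> R, forall u, Kb b' u -> solves s Omega M h b' u (S u).
  move=> mb' b'01 b'0 sup.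
  have ex u : exists z, Kb b' u -> solves s Omega M h b' u z.
    have [Ku|Ku] := pselect (Kb b' u); last by exists u.
    have [z zP] := resolvent mO Of M_gt0 ch h0 h1 h_mono mb' b'01 b'0 sup Ku.
    by exists z.
  by have [S SP] := choice ex; exists S.
have Jw0 : J s M H w0 < 0.
  rewrite /J /aform; have [_ _ Lw0 _] := Xw0; have iw := L2_integrable_prod Lw0 Lw0.
  have -> : \int[mu]_x H (w0 x) = lam * g + M / 2 * ip mu w0 w0.
    rewrite /g /ip -(Rintegral_lin lam (M / 2) iGw iw); apply: eq_Rintegral => x _.
    by rewrite /lin /H /M /= expr2; ring.
  have : En s w0 w0 < lam * g * 2.
    have : En s w0 w0 / (2 * g) < lam by apply: lt_trans lamP; rewrite /lam0 ltrDl.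
    by rewrite ltr_pdivrMr ?mulr_gt0// mulrA mulrAC.
  by move: (En s w0 w0) (lam * g) (ip mu w0 w0) => x y z; lra.
have sup1 : supersolution s Omega M h b by exact: supersolution_indic.
have [S SP] := step b mb b01 b0 sup1.
have [v vv lim] := orbit_limit s0 L0 OL N0 mO Of M_gt0 ch h0 h1 h_mono mH H0 H_convex mb b01 b0 SP Xw0 Kw0.
have [Xv [mv vb] vE] := vv.
have Kv : Kb b v by [].
have v01 x : 0 <= v x <= 1.
  by have /andP[-> h2] := vb x; case/andP: (b01 x) => _; exact: le_trans.
have vO x : ~ Omega x -> v x = 0 by case: Xv => _ vO _ _; exact: vO.
have Jv : J s M H v < 0.
  (* Iterates have J <= J(w0), so by continuity the limit keeps J <= J(w0)/2. *)
  have e0 : 0 < - J s M H w0 / 2 by rewrite divr_gt0// oppr_gt0.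
  have [d d0 hd] := J_continuous mO Of M_gt0 h0 h1 h_mono mH H0 H_convex b01 b0 Xv Kv e0.
  have [n dn] := lim d d0.
  have [Xn Kn] := iter_XK SP n Xw0 Kw0.
  have := hd _ Xn Kn dn.
  have := J_iter mO Of M_gt0 ch h0 h1 h_mono mH H0 H_convex b01 b0 SP Xw0 Kw0 (leq0n n).
  rewrite ler_norml => /= j1 /andP[j2 _]; move: j1 j2 Jw0.
  by move: (J _ _ _ _) (J _ _ _ _) (J _ _ _ _) => x y z; lra.
have [S' SP'] := step v mv v01 vO (supersolution_solves M_gt0 vv).
have Kvv : Kb v v by split=> // x; have /andP[-> _] := v01 x; rewrite lexx.
have [rho rho0 well] := well_radius s0 L0 OL N0 mH H_ge0 H_small.
have well' u : Xz u -> Kb v u -> En s u u <= rho -> En s u u / 4 <= J s M H u.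
  move=> Xu [_ uv]; apply: well => // x; have /andP[-> h2] := uv x.
  by apply: le_trans h2 _; case/andP: (v01 x).
have [u [uu Ju nu]] := unstable_solution s0 L0 OL N0 mO Of M_gt0 ch h0 h1 h_mono mH H0
  H_convex mv v01 vO SP' rho0 well' Xv Kvv Jv.
have [Xu [mu_ uv] uE] := uu.
have u01 x : 0 <= u x <= 1.
  by have /andP[-> h2] := uv x; case/andP: (v01 x) => _; exact: le_trans.
have uO x : ~ Omega x -> u x = 0 by case: Xu => _ uO _ _; exact: uO.
have Lfy y : measurable_fun setT y -> (forall x, 0 <= y x <= 1) ->
    (forall x, ~ Omega x -> y x = 0) -> L2 mu (f \o y).
  move=> my y01 yO; apply: (L2_dominated _ (L2_lin M0 0 LI LI)).
    by apply: measurableT_comp => //; exact: continuous_measurable_fun.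
  move=> x; rewrite /lin mul0r addr0 indicE; have [Ox|Ox] := pselect (Omega x).
    by rewrite mem_set// mulr1 /= !ger0_norm ?(ltW M0_gt0)// f_leM0.
  by rewrite memNset// mulr0 /= yO// f0 normr0.
have hE y : h \o y = lin lam (f \o y) M y.
  by apply/funext => x; rewrite /h /lin /M /=; ring.
have Lhy y : Xz y -> (forall x, 0 <= y x <= 1) -> L2 mu (h \o y).
  move=> [my yO Ly _] y01; rewrite hE; apply: L2_lin => //; exact: Lfy.
have weak y : Xz y -> (forall x, 0 <= y x <= 1) ->
    (forall phi, Xz phi -> aform s M y phi = ip mu (h \o y) phi) -> weak_solution s Omega lam f y.
  move=> Xy y01 yE; have [my yO Ly _] := Xy; have Lf := Lfy y my y01 yO.
  apply: (weak_solution_of_form mO) => // phi Xphi; have := yE phi Xphi.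
  have [_ _ Lphi _] := Xphi.
  by rewrite hE (psd_linl LF)// /aform => /addIr.
have L0z : L2 mu (cst 0 : T -> R) by case: (Xz0 s Omega).
have ip0 y : ip mu y (cst 0) = 0.
  by rewrite /ip; under eq_Rintegral do rewrite mulr0; rewrite Rintegral_cst// mul0r.
have nzu : ~ {ae mu, forall x, u x = 0}.
  move=> u0; apply: nu; rewrite uE// -(ip0 (h \o u)).
  have Lhu := Lhy u Xu u01; have [_ _ Lu _] := Xu.
  rewrite (eq_ip_ae Lhu Lu Lhu L0z)//.
  by apply: aeW.
have LhU := Lhy u Xu u01; have LhV := Lhy v Xv v01.
have Xd := Xz_lin 1 (-1) Xv Xu.
have dE phi : Xz phi -> aform s M (lin 1 v (-1) u) phi = ip mu (h \o v) phi - ip mu (h \o u) phi.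
  by move=> Xphi; rewrite (psd_linl aF)// vE// uE// mul1r mulN1r.
have d_ge0 x : 0 <= lin 1 v (-1) u x.
  by rewrite /lin mul1r mulN1r subr_ge0; case/andP: (uv x).
have dpos phi : Xz phi -> (forall x, 0 <= phi x) -> 0 <= aform s M (lin 1 v (-1) u) phi.
  move=> Xphi phi0; have [_ _ Lphi _] := Xphi; rewrite dE// subr_ge0.
  apply: le_ip => // x; rewrite ler_wpM2r//=; have /andP[? ?] := uv x.
  by apply: h_mono => //; case/andP: (v01 x).
have [dz|dgt] := strong_maximum_principle s01 oO mO Of (ltW M_gt0) Xd d_ge0 dpos.
  (* If v = u almost everywhere, their energy distance is 0 and continuity of J contradicts J(v) < 0
     <= J(u). *)
  exfalso; have [_ _ Ld _] := Xd.
  have z1 : ip mu (h \o v) (lin 1 v (-1) u) = 0.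
    by rewrite -(ip0 (h \o v)); apply: eq_ip_ae => //; exact: aeW.
  have z2 : ip mu (h \o u) (lin 1 v (-1) u) = 0.
    by rewrite -(ip0 (h \o u)); apply: eq_ip_ae => //; exact: aeW.
  have dist0 : dist2 s M v u = 0 by rewrite /dist2 dE// z1 z2 subr0.
  have Kuv : Kb v u by [].
  have e0 : 0 < - J s M H v / 2 by rewrite divr_gt0// oppr_gt0.
  have [d d0 hd] := J_continuous mO Of M_gt0 h0 h1 h_mono mH H0 H_convex v01 vO Xu Kuv e0.
  have := hd v Xv Kvv; rewrite dist0 => /(_ (ltW d0)); rewrite ler_norml => /andP[+ _].
  by move: Ju Jv; move: (J _ _ _ _) (J _ _ _ _) => x y; lra.
exists u, v; split => //; [exact: weak|exact: weak| |].
  move=> v0; have : mu.-negligible Omega.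
    have [A [mA A0 hA]] := v0; have [B [mB B0 hB]] := dgt.
    exists (A `|` B); split; first exact: measurableU.
      apply/eqP; rewrite -measure_le0; apply: le_trans (measureU2 _ _ _) _ => //.
      by move: A0 B0 => /= -> ->; rewrite adde0.
    move=> x Ox; apply: contrapT => /not_orP[nA nB].
    have vx : v x = 0 by apply: contrapT => h'; apply: nA; exact: hA.
    have dx : Omega x -> 0 < lin 1 v (-1) u x by apply: contrapT => h'; apply: nB; exact: hB.
    have := dx Ox; rewrite /lin vx mulr0 add0r mulN1r oppr_gt0.
    by case/andP: (u01 x) => h2 _; rewrite ltNge h2.
  by move=> /(measure_negligible mO) h'; move: muO; rewrite -[X in (0 < X)%E]/(_ Omega) h' ltxx.
apply: (@filterS _ _ (ae_filter_ringOfSetsType mu) _ _ _ dgt) => x hx Ox.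
have := hx Ox; rewrite /lin mul1r mulN1r subr_gt0 => ?.
by split => //; [case/andP: (u01 x)|case/andP: (v01 x)].
Qed.

End two_solutions.

Theorem theorem1p1 (R : realType) (s : R) (N : nat) (Omega : set 'rV[R]_N)
    (f : R -> R)
    (hs : 0 < s < 1)
    (hN : 2 * s < N%:R)
    (hOmega : bounded_smooth_domain Omega)
    (f_ge0 : forall t, 0 <= f t)
    (f_cont : continuous f)
    (F1 : exists2 p : R, 1 < p < (N%:R + 2 * s) / (N%:R - 2 * s) &
      f t / (`|t| `^ (p - 1) * t) @[t --> 0^'+] --> (1 : R))
    (F2 : f 1 = 0 /\ forall t, 0 < t < 1 \/ 1 < t < 2 -> 0 < f t)
    (F3 : exists2 M0 : R, 0 < M0 &
      {homo (fun t : R => f t + M0 * t) : t1 t2 / t1 <= t2}) :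
  exists2 lambda_bar : R, 0 < lambda_bar &
  forall lambda : R, lambda_bar < lambda ->
  exists u v : 'rV[R]_N -> R,
    [/\ weak_solution s Omega lambda f u,
        weak_solution s Omega lambda f v,
        ~ {ae @lebesgue_rV R N, forall x, u x = 0},
        ~ {ae @lebesgue_rV R N, forall x, v x = 0} &
        {ae @lebesgue_rV R N, forall x, Omega x ->
          [/\ 0 <= u x, u x < v x & v x <= 1]}].
Proof.
have [p /andP[p1 _] F1p] := F1.
have [f1 f_gt0] := F2.
have [M0 M0_gt0 f_mono] := F3.
have s0 : 0 < s by case/andP: hs.
have N0 : (0 < N)%N by rewrite -(ltr_nat R); apply: lt_trans hN; rewrite mulr_gt0.
have [oO _ O0 bO _] := hOmega.
have [L L0 OL] : exists2 L : R, 0 < L & forall x, Omega x -> `|x| < L.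
  case: bO => K [_ hK]; exists (`|K| + 2) => [|x Ox]; first by rewrite ltr_wpDl.
  apply: (@le_lt_trans _ _ (`|K| + 1)); last by rewrite ltrD2l ltr1n.
  by apply: hK Ox; apply: le_lt_trans (ler_norm K) _; rewrite ltrDl.
have f_small e : 0 < e -> exists2 d : R, 0 < d & forall t : R, 0 < t < d -> f t <= e * t.
  by move=> e0; exact: superlinear_at0 p1 e0 F1p.
have f_gt01 t : 0 < t < 1 -> 0 < f t by move=> t01; apply: f_gt0; left.
have [lam0 lam00 H] := two_solutions hs N0 oO O0 L0 OL f_ge0 f_cont f1 f_gt01 f_small M0_gt0 f_mono.
by exists lam0.
Qed.
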